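(* Let $A$ be a graded associative unital algebra over a commutative unital ring $k$, let $\mathcal{E}_A^*$ be its differential graded algebra of Hochschild cochains, and let $\bullet=\bullet_1+\bullet_2$ be the pairing defined in the context. Then $$\bullet : C_*(A,A)\otimes C_*(\mathcal{E}_A^*,\mathcal{E}_A^* )\to C_*(A,A)$$ is a morphism of complexes, i.e. for all (homogeneous) $a\in C_*(A,A)$ and all $x\in C_*(\mathcal{E}_A^*,\mathcal{E}_A^* )$, $$b(a\bullet x)=(ba)\bullet x+(-1)^{\deg a}\,a\bullet (b+\delta)x .$$
   Context: Cochains. $\overline A=A/k\cdot 1$, $C^d(A,A)=\mathrm{Hom}_k(\overline A^{\otimes d},A)$, $C^*(A,A)=\bigoplus_d C^d(A,A)$. For a homogeneous cochain $D$ of arity $d$: $\deg D=(\text{degree of the linear map }D)+d$, $|D|=\deg D-1$; for $a\in A$, $|a|=\deg a-1$. Put $\eta_j=\sum_{i=1}^j|a_i|$ and $(D\smile E)(a_1,\dots,a_{d+e})=(-1)^{\deg E\cdot\eta_d}D(a_1,\dots,a_d)E(a_{d+1},\dots,a_{d+e})$; $$(\delta D)(a_1,\dots,a_{d+1})=(-1)^{|a_1||D|+|a_1|+1}a_1D(a_2,\dots,a_{d+1})+\sum_{j=1}^d(-1)^{|D|+\eta_j}D(a_1,\dots,a_ja_{j+1},\dots,a_{d+1})+(-1)^{|D|+\eta_d+1}D(a_1,\dots,a_d)a_{d+1}.$$ $\mathcal{E}_A^*$ is the differential graded algebra $(C^*(A,A),\deg,\smile,\delta)$. Chains. For a graded algebra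 $R$, $C_n(R,R)=R\otimes\overline R^{\otimes n}$, elements written $(a_0,\dots,a_n)$, $\deg(a_0,\dots,a_n)=\sum\deg a_i+n$. For chains put $\eta_j=\sum_{i<j}|a_i|$ (so $\eta_{n+1}=\sum_{i=0}^n|a_i|$) and $$b(a_0,\dots,a_n)=\sum_{j=0}^{n-1}(-1)^{\eta_{j+1}+1}(a_0,\dots,a_ja_{j+1},\dots,a_n)+(-1)^{(|a_n|+1)(\eta_n+1)+\eta_n}(a_na_0,a_1,\dots,a_{n-1}).$$ If $R$ has a differential $\partial$, it is extended to chains by $\partial(a_0,\dots,a_n)=\sum_j(-1)^{\eta_j}(a_0,\dots,\partial a_j,\dots,a_n)$; for $R=\mathcal{E}_A^*$ this extension is denoted $\delta$, and $C_*(\mathcal{E}_A^*,\mathcal{E}_A^* )$ carries the differential $b+\delta$. Pairing. Let $D_r$ have arity $d_r$. Then $a\bullet x=a\bullet_1x+a\bullet_2x$ with: $(a_0,\dots,a_n)\bullet_1(D_0,\dots,D_m)=\sum(-1)^{\epsilon_1}(a_0D_0(a_1,\dots,a_{d_0}),\dots,a_{i_1},D_1(a_{i_1+1},\dots,a_{i_1+d_1}),\dots,a_{i_m},D_m(a_{i_m+1},\dots,a_{i_m+d_m}),\dots,a_n)$, the sum over all $d_0\le i_1$, $i_r+d_r\le i_{r+1}$, $i_m+d_m\le n$, with $\epsilon_1=\deg D_0\sum_{i>0}|a_i|+\sum_{r=1}^m|D_r|\sum_{i>i_r}|a_i|$. $(a_0,\dots,a_n)\bullet_2(D_0,\dots,D_m)$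 is $0$ if $m=0$, and for $m\ge1$ equals $\sum(-1)^{\epsilon_2}(D_m(a_q,\dots,a_n,a_0,\dots,a_{i_0})D_0(a_{i_0+1},\dots),\dots,a_{i_1},D_1(a_{i_1+1},\dots),\dots,D_{m-1}(a_{i_{m-1}+1},\dots),\dots,a_{q-1})$, the sum over all $1\le q\le n+1$, $0\le i_0\le q-1$ and $i_1,\dots,i_{m-1}$ for which the expression makes sense (all arities matching, $a_0$ being among the arguments of $D_m$, arguments of $D_0,\dots,D_{m-1}$ being consecutive disjoint blocks in order inside $a_{i_0+1},\dots,a_{q-1}$), with $$\epsilon_2=\sum_{i<q}|a_i|\sum_{i\ge q}|a_i|+\deg D_0\sum_{i_0<i<q}|a_i|+\sum_{r=1}^{m-1}|D_r|\sum_{i_r<i<q}|a_i|+|D_m|\Big(\sum_{i=0}^n|a_i|+\deg D_0+\sum_{r=1}^{m-1}|D_r|\Big).$$ *)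

(* Defs.v *)
From HB Require Import structures.
From mathcomp Require Import all_boot all_order all_algebra.
From mathcomp Require Import boolp functions.
From mathcomp Require Import ring zify.

Set Implicit Arguments.
Unset Strict Implicit.
Unset Printing Implicit Defensive.
Import GRing.Theory.
Local Open Scope ring_scope.
Local Open Scope quotient_scope.

Definition sgn (k : pzRingType) (e : int) : k := (-1) ^+ `|e|%N.
Arguments sgn : simpl never.

Lemma sgn_odd (k : pzRingType) (e : int) : sgn k e = (-1) ^+ odd `|e|%N.
Proof. by rewrite /sgn signr_odd. Qed.

Lemma sgnD (k : pzRingType) (e f : int) : sgn k (e + f) = sgn k e * sgn k f.
Proof.
rewrite !sgn_odd -signr_addb; congr (_ ^+ (nat_of_bool _)).
by rewrite -oddD; lia.
Qed.

Lemma sgn_eq (k : pzRingType) (e f : int) :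
  odd `|e - f|%N = false -> sgn k e = sgn k f.
Proof. by move=> h; rewrite -(subrK f e) sgnD sgn_odd h mul1r. Qed.

Lemma sgn_opp (k : pzRingType) (e f : int) :
  odd `|e - f|%N -> sgn k e = - sgn k f.
Proof. by move=> h; rewrite -(subrK f e) sgnD sgn_odd h mulN1r. Qed.

Definition splits (T : Type) (s : seq T) : seq (seq T * seq T) :=
  [seq (take i s, drop i s) | i <- iota 0 (size s).+1].

Lemma splits_cons (T : Type) (x : T) s :
  splits (x :: s) = ([::], x :: s) :: [seq (x :: p.1, p.2) | p <- splits s].
Proof.
rewrite /splits.
have -> : iota 0 (size (x :: s)).+1 = 0%N :: iota (1 + 0) (size s).+1 by [].
by rewrite iotaDl map_cons -!map_comp.
Qed.

Section SumSplits.
Variables (V : nmodType) (T : Type) (F : seq T -> seq T -> V).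

Lemma sum_splits0 : \sum_(p <- splits [::]) F p.1 p.2 = F [::] [::].
Proof. by rewrite /splits /= big_seq1. Qed.

Lemma sum_splits_cons x s :
  \sum_(p <- splits (x :: s)) F p.1 p.2 =
  F [::] (x :: s) + \sum_(p <- splits s) F (x :: p.1) p.2.
Proof. by rewrite splits_cons big_cons big_map. Qed.
End SumSplits.

Lemma sum_splits_cat (V : nmodType) (T : Type) (F : seq T -> seq T -> V)
    s1 x s2 :
  \sum_(p <- splits (s1 ++ x :: s2)) F p.1 p.2 =
  \sum_(p <- splits s1) F p.1 (p.2 ++ x :: s2) +
  \sum_(p <- splits s2) F (s1 ++ x :: p.1) p.2.
Proof.
elim: s1 F => [|y s1 IH] F /=.
  by rewrite sum_splits_cons (sum_splits0 (fun a b => F a (b ++ x :: s2))).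
rewrite sum_splits_cons (IH (fun a b => F (y :: a) b)) addrA.
by rewrite (sum_splits_cons (fun a b => F a (b ++ x :: s2))).
Qed.

Lemma sum_splits_rcons (V : nmodType) (T : Type) (F : seq T -> seq T -> V) s x :
  \sum_(p <- splits (rcons s x)) F p.1 p.2 =
  \sum_(p <- splits s) F p.1 (rcons p.2 x) + F (rcons s x) [::].
Proof.
rewrite -cats1 sum_splits_cat (sum_splits0 (fun a b => F (s ++ x :: a) b)).
by congr (_ + _); apply: eq_bigr => p _; rewrite cats1.
Qed.

Lemma sum_splits_assoc (V : nmodType) (T : Type)
    (F : seq T -> seq T -> seq T -> V) s :
  \sum_(p <- splits s) \sum_(q <- splits p.1) F q.1 q.2 p.2 =
  \sum_(p <- splits s) \sum_(q <- splits p.2) F p.1 q.1 q.2.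
Proof.
elim: s F => [|x s IH] F.
  rewrite (sum_splits0 (fun a b => \sum_(q <- splits a) F q.1 q.2 b)).
  rewrite (sum_splits0 (fun a b => \sum_(q <- splits b) F a q.1 q.2)).
  by rewrite (sum_splits0 (fun a b => F a b [::])) (sum_splits0 (F [::])).
rewrite (sum_splits_cons (fun a b => \sum_(q <- splits a) F q.1 q.2 b)).
rewrite (sum_splits_cons (fun a b => \sum_(q <- splits b) F a q.1 q.2)).
rewrite (sum_splits0 (fun a b => F a b (x :: s))) (sum_splits_cons (F [::])).
rewrite -addrA; congr (_ + _); rewrite -(IH (fun a => F (x :: a))) -big_split.
apply: eq_bigr => p _ /=.
by rewrite (sum_splits_cons (fun a b => F a b p.2)).
Qed.

Lemma splitsP (T : eqType) (s : seq T) p : p \in splits s -> s = p.1 ++ p.2.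
Proof. by case/mapP => i _ -> /=; rewrite cat_take_drop. Qed.

(* Associativity and unitality relate elements of components whose indices are
   only propositionally equal, so they are stated in the total space. *)
Record gralg (k : comPzRingType) := GrAlg {
  gcomp :> int -> lmodType k;
  gone : gcomp 0;
  gmul : forall i j, gcomp i -> gcomp j -> gcomp (i + j);
  gmulDl : forall i j c (x x' : gcomp i) (y : gcomp j),
    gmul (c *: x + x') y = c *: gmul x y + gmul x' y;
  gmulDr : forall i j c (x : gcomp i) (y y' : gcomp j),
    gmul x (c *: y + y') = c *: gmul x y + gmul x y';
  gmul1l : forall i (x : gcomp i), Tagged (fun n => gcomp n) (gmul gone x) = Tagged (fun n => gcomp n) x;
  gmul1r : forall i (x : gcomp i), Tagged (fun n => gcomp n) (gmul x gone) = Tagged (fun n => gcomp n) x;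
  gmulA : forall i j l (x : gcomp i) (y : gcomp j) (z : gcomp l),
    Tagged (fun n => gcomp n) (gmul (gmul x y) z) = Tagged (fun n => gcomp n) (gmul x (gmul y z)) }.
Arguments gone {k g}.

Definition hom (k : comPzRingType) (R : gralg k) := {i : int & R i}.

Section Homogeneous.
Variables (k : comPzRingType) (R : gralg k).

Definition toh i (x : R i) : hom R := Tagged (fun j => R j) x.
Definition hone : hom R := toh gone.
Definition hmul (x y : hom R) : hom R := toh (gmul (tagged x) (tagged y)).

(* deg a, |a| = deg a - 1, and the eta-type sum of the |a_i| over a list *)
Definition hdeg (x : hom R) : int := tag x.
Definition hwt (x : hom R) : int := hdeg x - 1.
Definition wt (s : seq (hom R)) : int := \sum_(x <- s) hwt x.

Lemma hmul1l x : hmul hone x = x.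
Proof. by case: x => i x; rewrite /hmul /toh gmul1l. Qed.
Lemma hmul1r x : hmul x hone = x.
Proof. by case: x => i x; rewrite /hmul /toh gmul1r. Qed.
Lemma wt0 : wt [::] = 0. Proof. by rewrite /wt big_nil. Qed.
Lemma wt_cons x s : wt (x :: s) = hwt x + wt s.
Proof. by rewrite /wt big_cons. Qed.
Lemma wt_cat s t : wt (s ++ t) = wt s + wt t.
Proof. by rewrite /wt big_cat. Qed.
Lemma wt_rcons s x : wt (rcons s x) = wt s + hwt x.
Proof. by rewrite -cats1 wt_cat wt_cons wt0 addr0. Qed.

(* Functions on lists of homogeneous elements, k-linear in every entry (within
   each degree): a degreewise description of linear maps out of the tensor
   powers of the direct sum of the components. *)
Definition multilinear (M : lmodType k) (f : seq (hom R) -> M) : Prop :=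
  forall s1 s2 i c (x y : R i),
    f (s1 ++ toh (c *: x + y) :: s2) =
    c *: f (s1 ++ toh x :: s2) + f (s1 ++ toh y :: s2).

Definition vanishes_at_one (M : lmodType k) (f : seq (hom R) -> M) : Prop :=
  forall s1 s2, f (s1 ++ hone :: s2) = 0.

Definition degree_only (T : Type) (g : seq (hom R) -> T) : Prop :=
  forall s1 s2 i (x y : R i), g (s1 ++ toh x :: s2) = g (s1 ++ toh y :: s2).

Lemma degree_only_wt : degree_only wt.
Proof. by move=> s1 s2 i x y; rewrite !wt_cat !wt_cons. Qed.

Section Multilinear.
Variable M : lmodType k.
Implicit Types f : seq (hom R) -> M.

Lemma multilinear0 f s1 s2 i : multilinear f -> f (s1 ++ toh (0 : R i) :: s2) = 0.
Proof.
move=> hf; have := hf s1 s2 i (-1) 0 0.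
by rewrite scaler0 addr0 scaleN1r addNr.
Qed.

Lemma multilinear_scale f (g : seq (hom R) -> k) :
  degree_only g -> multilinear f -> multilinear (fun s => g s *: f s).
Proof.
move=> hg hf s1 s2 i c x y /=.
rewrite hf (hg s1 s2 i (c *: x + y) x) (hg s1 s2 i y x) scalerDr !scalerA.
by rewrite [g _ * c]mulrC.
Qed.

Lemma multilinear_zero : multilinear (fun=> 0 : M).
Proof. by move=> *; rewrite scaler0 addr0. Qed.

Lemma multilinear_add f g :
  multilinear f -> multilinear g -> multilinear (fun s => f s + g s).
Proof. by move=> hf hg s1 s2 i c x y; rewrite hf hg scalerDr addrACA. Qed.

Lemma multilinear_sum (I : Type) (r : seq I) (F : I -> seq (hom R) -> M) :
  (forall i, multilinear (F i)) -> multilinear (fun s => \sum_(i <- r) F i s).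
Proof.
move=> hF s1 s2 i c x y; rewrite scaler_sumr -big_split.
by apply: eq_bigr => j _; rewrite hF.
Qed.

Lemma multilinear_cons f u : multilinear f -> multilinear (fun s => f (u ++ s)).
Proof. by move=> hf s1 s2 i c x y; rewrite !catA hf. Qed.

Lemma multilinear_catr f u : multilinear f -> multilinear (fun s => f (s ++ u)).
Proof. by move=> hf s1 s2 i c x y; rewrite -!catA !cat_cons hf. Qed.

Lemma multilinear_splits (F : seq (hom R) -> seq (hom R) -> M) :
  (forall v, multilinear (F^~ v)) -> (forall u, multilinear (F u)) ->
  multilinear (fun s => \sum_(p <- splits s) F p.1 p.2).
Proof.
move=> h1 h2 s1 s2 i c x y; rewrite !sum_splits_cat scalerDr addrACA.
congr (_ + _); rewrite scaler_sumr -big_split; apply: eq_bigr => p _.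
  by rewrite h2.
by rewrite h1.
Qed.

Lemma vanishes_splits (F : seq (hom R) -> seq (hom R) -> M) :
  (forall v, vanishes_at_one (F^~ v)) -> (forall u, vanishes_at_one (F u)) ->
  vanishes_at_one (fun s => \sum_(p <- splits s) F p.1 p.2).
Proof.
move=> h1 h2 s1 s2; rewrite sum_splits_cat big1 ?big1 ?addr0 // => p _.
  by rewrite h1.
by rewrite h2.
Qed.
End Multilinear.
End Homogeneous.
Arguments hone {k R}.
Arguments hdeg : simpl never.
Arguments hwt : simpl never.
Arguments wt : simpl never.

(* C_*(R, R), the direct sum over n of R (x) Rbar^(x)n, presented by generators
   (a_0, [:: a_1; ...; a_n]) with homogeneous entries. *)
Section Chains.
Variables (k : comPzRingType) (R : gralg k).

Definition formal := seq (k * (hom R * seq (hom R))).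

Definition fscale (c : k) (u : formal) : formal :=
  [seq (c * t.1, t.2) | t <- u].

Inductive chain_rel : formal -> formal -> Prop :=
| ChainRefl u : chain_rel u u
| ChainSym u v : chain_rel u v -> chain_rel v u
| ChainTrans u v w : chain_rel u v -> chain_rel v w -> chain_rel u w
| ChainCat u u' v v' :
    chain_rel u u' -> chain_rel v v' -> chain_rel (u ++ v) (u' ++ v')
| ChainScale c u v : chain_rel u v -> chain_rel (fscale c u) (fscale c v)
| ChainComm u v : chain_rel (u ++ v) (v ++ u)
| ChainAdd c d g : chain_rel [:: (c, g); (d, g)] [:: (c + d, g)]
| ChainZero g : chain_rel [:: (0, g)] [::]
| ChainHead i c (x y : R i) s :
    chain_rel [:: (1, (toh (c *: x + y), s))]
              [:: (c, (toh x, s)); (1, (toh y, s))]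
| ChainSlot a s1 i c (x y : R i) s2 :
    chain_rel [:: (1, (a, s1 ++ toh (c *: x + y) :: s2))]
              [:: (c, (a, s1 ++ toh x :: s2)); (1, (a, s1 ++ toh y :: s2))]
| ChainUnit a s1 s2 : chain_rel [:: (1, (a, s1 ++ hone :: s2))] [::].

Definition chain_eq (u v : formal) : bool := `[< chain_rel u v >].

Lemma chain_eq_refl : reflexive chain_eq.
Proof. by move=> u; apply/asboolP/ChainRefl. Qed.
Lemma chain_eq_sym : symmetric chain_eq.
Proof. by move=> u v; apply/asboolP/asboolP => /ChainSym. Qed.
Lemma chain_eq_trans : transitive chain_eq.
Proof.
move=> v u w /asboolP h1 /asboolP h2; apply/asboolP; exact: ChainTrans h1 h2.
Qed.
Canonical chain_equiv :=
  EquivRel chain_eq chain_eq_refl chain_eq_sym chain_eq_trans.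

Definition chains := {eq_quot chain_equiv}.
HB.instance Definition _ := Choice.on chains.
HB.instance Definition _ : EqQuotient formal chain_equiv chains :=
  EqQuotient.on chains.

Definition cls (u : formal) : chains := \pi_chains u.

Lemma clsP u v : chain_rel u v -> cls u = cls v.
Proof. by move=> h; apply/eqmodP/asboolP. Qed.
Lemma clsE u v : cls u = cls v -> chain_rel u v.
Proof. by move/eqmodP/asboolP. Qed.
Lemma cls_repr x : cls (repr x) = x. Proof. exact: reprK. Qed.
Lemma repr_cls u : chain_rel (repr (cls u)) u.
Proof. by apply: clsE; rewrite cls_repr. Qed.

Definition chain_zero : chains := cls [::].
Definition chain_add (x y : chains) : chains := cls (repr x ++ repr y).
Definition chain_scale (c : k) (x : chains) : chains := cls (fscale c (repr x)).
Definition chain_opp (x : chains) : chains := chain_scale (-1) x.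

Lemma chain_addE u v : chain_add (cls u) (cls v) = cls (u ++ v).
Proof. by apply: clsP; apply: ChainCat; apply: repr_cls. Qed.
Lemma chain_scaleE c u : chain_scale c (cls u) = cls (fscale c u).
Proof. by apply: clsP; apply/ChainScale/repr_cls. Qed.

Lemma chain_ind (P : chains -> Prop) :
  (forall u, P (cls u)) -> forall x, P x.
Proof. by move=> h x; rewrite -(cls_repr x). Qed.

Lemma fscale_cons c t u : fscale c (t :: u) = [:: (c * t.1, t.2)] ++ fscale c u.
Proof. by []. Qed.

Lemma cls_cat0 u v : cls (u ++ v) = chain_add (cls u) (cls v).
Proof. by rewrite chain_addE. Qed.
Lemma cls_cons t u : cls (t :: u) = chain_add (cls [:: t]) (cls u).
Proof. by rewrite chain_addE. Qed.

Lemma chain_addA : associative chain_add.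
Proof.
by elim/chain_ind => u; elim/chain_ind => v; elim/chain_ind => w;
  rewrite !chain_addE catA.
Qed.
Lemma chain_addC : commutative chain_add.
Proof.
elim/chain_ind => u; elim/chain_ind => v; rewrite !chain_addE.
exact/clsP/ChainComm.
Qed.
Lemma chain_add0 : left_id chain_zero chain_add.
Proof. by elim/chain_ind => u; rewrite /chain_zero chain_addE. Qed.

Lemma chain_scaleDr c : {morph chain_scale c : x y / chain_add x y}.
Proof.
elim/chain_ind => u; elim/chain_ind => v.
by rewrite !(chain_addE, chain_scaleE) /fscale map_cat.
Qed.

Lemma chain_scaleDl x : {morph chain_scale^~ x : c d / c + d >-> chain_add c d}.
Proof.
move=> c d; elim/chain_ind: x => u; rewrite !chain_scaleE.
elim: u => [|t u IH]; first by rewrite chain_addE.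
rewrite !fscale_cons !cls_cat0 IH mulrDl.
rewrite -(clsP (ChainAdd (c * t.1) (d * t.1) t.2)) cls_cons !chain_addA.
congr (chain_add _ _); rewrite -!chain_addA; congr (chain_add _ _).
exact: chain_addC.
Qed.

Lemma chain_scale0 x : chain_scale 0 x = chain_zero.
Proof.
elim/chain_ind: x => u; rewrite chain_scaleE.
elim: u => [|t u IH]; first by [].
rewrite fscale_cons cls_cat0 IH mul0r (clsP (ChainZero _)).
exact: chain_addE.
Qed.

Lemma chain_scale1 : left_id 1 chain_scale.
Proof.
elim/chain_ind => u; rewrite chain_scaleE /fscale; congr cls.
by rewrite -[RHS]map_id; apply: eq_map => -[c g] /=; rewrite mul1r.
Qed.

Lemma chain_scaleA c d x :
  chain_scale c (chain_scale d x) = chain_scale (c * d) x.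
Proof.
elim/chain_ind: x => u; rewrite !chain_scaleE /fscale -map_comp; congr cls.
by apply: eq_map => t /=; rewrite mulrA.
Qed.

Lemma chain_addN : left_inverse chain_zero chain_opp chain_add.
Proof.
move=> x; rewrite /chain_opp -{2}(chain_scale1 x) -chain_scaleDl addNr.
exact: chain_scale0.
Qed.

HB.instance Definition _ := GRing.isZmodule.Build chains
  chain_addA chain_addC chain_add0 chain_addN.
HB.instance Definition _ := GRing.Zmodule_isLmodule.Build k chains
  chain_scaleA chain_scale1 chain_scaleDr chain_scaleDl.

(* The class of (a_0, ..., a_n); the empty list, which is not a generator, is
   sent to 0. *)
Definition chain (w : seq (hom R)) : chains :=
  if w is a :: s then cls [:: (1, (a, s))] else 0.

Lemma cls_cat u v : cls (u ++ v) = cls u + cls v.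
Proof. by rewrite -chain_addE. Qed.

Lemma cls_seq1 c a s : cls [:: (c, (a, s))] = c *: chain (a :: s).
Proof. by rewrite /chain [RHS]chain_scaleE /fscale /= mulr1. Qed.

Lemma cls_sum u : cls u = \sum_(t <- u) t.1 *: chain (t.2.1 :: t.2.2).
Proof.
elim: u => [|[c [a s]] u IH]; first by rewrite big_nil.
by rewrite -cat1s cls_cat big_cons cls_seq1 IH.
Qed.

Lemma chain_multilinear : multilinear chain.
Proof.
move=> [|a s1] s2 i c x y /=.
  by rewrite (clsP (ChainHead _ _ _ _)) -cat1s cls_cat !cls_seq1 !scale1r.
by rewrite (clsP (ChainSlot _ _ _ _ _ _)) -cat1s cls_cat !cls_seq1 !scale1r.
Qed.

Lemma chain_unit a : vanishes_at_one (fun s => chain (a :: s)).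
Proof. by move=> s1 s2; rewrite /chain (clsP (ChainUnit _ _ _)). Qed.

Section Lift.
Variable M : lmodType k.
Implicit Types f : seq (hom R) -> M.

Definition balanced f : Prop :=
  multilinear f /\ (forall a, vanishes_at_one (fun s => f (a :: s))).

Definition lext f (u : formal) : M := \sum_(t <- u) t.1 *: f (t.2.1 :: t.2.2).

(* repr picks a representing formal sum, so this is the linear map induced by f
   on the quotient provided f is balanced (lift_chain, lift_linear).  This is
   proved below for b, the extension of a differential, and the pairing. *)
Definition lift f (x : chains) : M := lext f (repr x).

Lemma lext_cat f u v : lext f (u ++ v) = lext f u + lext f v.
Proof. by rewrite /lext big_cat. Qed.

Lemma lext_scale f c u : lext f (fscale c u) = c *: lext f u.
Proof.
rewrite /lext big_map scaler_sumr; apply: eq_bigr => t _ /=.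
by rewrite scalerA.
Qed.

Lemma lext_rel f u v : balanced f -> chain_rel u v -> lext f u = lext f v.
Proof.
case=> hf h1; elim=> {u v} //.
- by move=> u v w _ -> _ ->.
- by move=> u u' v v' _ hu _ hv; rewrite !lext_cat hu hv.
- by move=> c u v _ h; rewrite !lext_scale h.
- by move=> u v; rewrite !lext_cat addrC.
- by move=> c d g; rewrite /lext !big_cons !big_nil /= !addr0 scalerDl.
- by move=> g; rewrite /lext big_seq1 big_nil scale0r.
- move=> i c x y s; rewrite /lext !big_cons !big_nil /= !addr0 !scale1r.
  exact: (hf [::]).
- move=> a s1 i c x y s2; rewrite /lext !big_cons !big_nil /= !addr0 !scale1r.
  exact: (hf (a :: s1)).
by move=> a s1 s2; rewrite /lext big_seq1 big_nil /= h1 scaler0.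
Qed.

Lemma lift_cls f u : balanced f -> lift f (cls u) = lext f u.
Proof. by move=> hf; apply: lext_rel => //; apply: repr_cls. Qed.

Lemma lift_chain f a s : balanced f -> lift f (chain (a :: s)) = f (a :: s).
Proof. by move=> hf; rewrite lift_cls // /lext big_seq1 scale1r. Qed.

Lemma lift_linear f : balanced f -> linear (lift f).
Proof.
move=> hf c x y; rewrite -(cls_repr x) -(cls_repr y).
rewrite [c *: _]chain_scaleE [_ + _]chain_addE !lift_cls // lext_cat.
by rewrite lext_scale.
Qed.
End Lift.

Lemma chain_balanced : balanced chain.
Proof. by split; [exact: chain_multilinear | exact: chain_unit]. Qed.

Local Notation sg e := (sgn k e).

(* (u, x :: y :: v) runs over the ways of choosing two consecutive entries
   x = a_j, y = a_(j+1), so that eta_(j+1) = wt (rcons u x). *)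
Definition b_inner (w : seq (hom R)) : chains :=
  \sum_(p <- splits w)
    if p.2 is x :: y :: v then
      sg (wt (rcons p.1 x) + 1) *: chain (p.1 ++ hmul x y :: v)
    else 0.

Definition b_cyclic (w : seq (hom R)) : chains :=
  if w is a0 :: a1 :: s then
    let an := last a1 s in
    let init := a0 :: belast a1 s in
    sg ((hwt an + 1) * (wt init + 1) + wt init) *:
      chain (hmul an a0 :: belast a1 s)
  else 0.

Definition b_gen (w : seq (hom R)) : chains := b_inner w + b_cyclic w.

Definition b : chains -> chains := lift b_gen.

Definition d_gen (d : forall i, R i -> R (i + 1)) (w : seq (hom R)) : chains :=
  \sum_(p <- splits w)
    if p.2 is x :: v then
      sg (wt p.1) *: chain (p.1 ++ toh (d _ (tagged x)) :: v)
    else 0.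

Definition dext (d : forall i, R i -> R (i + 1)) : chains -> chains :=
  lift (d_gen d).

(* deg (a_0, ..., a_n) = sum of the deg a_i + n. *)
Definition chain_deg (w : seq (hom R)) : int :=
  \sum_(x <- w) hdeg x + (size w).-1%:Z.

Definition chain_homog (e : int) (x : chains) : Prop :=
  exists u : seq (k * seq (hom R)),
    {in u, forall t, chain_deg t.2 = e} /\ x = \sum_(t <- u) t.1 *: chain t.2.

End Chains.
Arguments chain {k R} w : simpl never.
Arguments b {k R} x.
Section BalancedB.
Variables (k : comPzRingType) (R : gralg k).
Local Notation sg e := (sgn k e).
Implicit Types s u v w : seq (hom R).

Lemma hmulDl i c (x y : R i) z :
  hmul (toh (c *: x + y)) z =
  toh (c *: gmul x (tagged z) + gmul y (tagged z)).
Proof. by rewrite /hmul gmulDl. Qed.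

Lemma hmulDr i c (x y : R i) z :
  hmul z (toh (c *: x + y)) =
  toh (c *: gmul (tagged z) x + gmul (tagged z) y).
Proof. by rewrite /hmul gmulDr. Qed.

Lemma degree_only_comp (T T' : Type) (h : T -> T') (g : seq (hom R) -> T) :
  degree_only g -> degree_only (h \o g).
Proof. by move=> hg s1 s2 i x y /=; rewrite (hg s1 s2 i x y). Qed.

Lemma multilinear_mull (M : lmodType k) (f : seq (hom R) -> M) z u :
  multilinear f ->
  forall i c (x y : R i) s, f (u ++ hmul z (toh (c *: x + y)) :: s) =
   c *: f (u ++ hmul z (toh x) :: s) + f (u ++ hmul z (toh y) :: s).
Proof. by move=> hf i c x y s; rewrite hmulDr hf. Qed.

Lemma multilinear_mulr (M : lmodType k) (f : seq (hom R) -> M) z u :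
  multilinear f ->
  forall i c (x y : R i) s, f (u ++ hmul (toh (c *: x + y)) z :: s) =
   c *: f (u ++ hmul (toh x) z :: s) + f (u ++ hmul (toh y) z :: s).
Proof. by move=> hf i c x y s; rewrite hmulDl hf. Qed.

Lemma wt_toh s1 s2 i (x y : R i) :
  wt (s1 ++ toh x :: s2) = wt (s1 ++ toh y :: s2).
Proof. exact: degree_only_wt. Qed.

Lemma scale_lin (M : lmodType k) (e c : k) (x y : M) :
  e *: (c *: x + y) = c *: (e *: x) + e *: y.
Proof. by rewrite scalerDr !scalerA mulrC. Qed.

Lemma hwt_toh i (x : R i) : hwt (toh x) = i - 1. Proof. by []. Qed.

Lemma b_inner_multilinear : multilinear (@b_inner k R).
Proof.
pose F u v : chains R := if v is x :: y :: v' then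
      sg (wt (rcons u x) + 1) *: chain (u ++ hmul x y :: v') else 0.
apply: (@multilinear_splits _ _ _ F) => [v|u].
  case: v => [|z [|z' v]] s1 s2 i c x y /=; rewrite ?scaler0 ?addr0 //.
  rewrite !wt_rcons (wt_toh _ _ (c *: x + y) x) (wt_toh _ _ y x).
  by rewrite -scale_lin -!catA !cat_cons chain_multilinear.
move=> [|z [|z' s1]] s2 i c x y /=.
- case: s2 => [|z s2] /=; rewrite ?scaler0 ?addr0 //.
  rewrite (multilinear_mulr _ _ (@chain_multilinear _ _)) !wt_rcons !hwt_toh.
  by rewrite scale_lin.
- by rewrite (multilinear_mull _ _ (@chain_multilinear _ _)) scale_lin.
rewrite -scale_lin; have := @chain_multilinear _ _ (u ++ hmul z z' :: s1) s2 i c x y.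
by rewrite -!catA !cat_cons => ->.
Qed.

Lemma b_cyclicE a0 s an :
  b_cyclic (a0 :: rcons s an) =
  sg ((hwt an + 1) * (wt (a0 :: s) + 1) + wt (a0 :: s)) *:
      chain (hmul an a0 :: s).
Proof. by case: s => [|a1 s] //=; rewrite last_rcons belast_rcons. Qed.

Lemma b_cyclic_multilinear : multilinear (@b_cyclic k R).
Proof.
move=> [|a0 s1] s2 i c x y.
  rewrite !cat0s; case/lastP: s2 => [|s an]; first by rewrite /= scaler0 addr0.
  rewrite !b_cyclicE.
  rewrite (multilinear_mull _ [::] (@chain_multilinear _ _)) /=.
  by rewrite !wt_cons !hwt_toh scale_lin.
rewrite !cat_cons; case/lastP: s2 => [|s2 an].
  rewrite !cats1 !b_cyclicE !hwt_toh.
  rewrite (multilinear_mulr _ [::] (@chain_multilinear _ _)) /=.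
  by rewrite scale_lin.
rewrite -!rcons_cons -!rcons_cat !b_cyclicE !wt_cons.
rewrite (wt_toh _ _ (c *: x + y) x) (wt_toh _ _ y x).
by rewrite (@chain_multilinear _ _ (hmul an a0 :: s1)) scale_lin.
Qed.

Lemma chain_one a s1 s2 : chain (a :: s1 ++ hone :: s2) = 0 :> chains R.
Proof. exact: chain_unit. Qed.

Lemma chain_one' s1 s2 : s1 <> [::] -> chain (s1 ++ hone :: s2) = 0 :> chains R.
Proof. by case: s1 => // a s1 _; exact: chain_one. Qed.

Lemma sum_splits_nil (V : nmodType) (T : Type) (F : seq T -> V) (t : seq T) :
  \sum_(p <- splits t) (if p.2 is [::] then F p.1 else 0) = F t.
Proof.
elim: t F => [|x t IH] F; first by rewrite /splits big_seq1.
by rewrite splits_cons big_cons big_map add0r (IH (F \o cons x)).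
Qed.

Lemma b_gen_vanishes a : vanishes_at_one (fun s => b_gen (a :: s) : chains R).
Proof.
move=> s1 s2 /=; rewrite /b_gen /b_inner.
pose F u v : chains R := if v is x :: y :: v' then
      sg (wt (rcons u x) + 1) *: chain (u ++ hmul x y :: v') else 0.
have -> : a :: s1 ++ hone :: s2 = (a :: s1) ++ hone :: s2 by [].
rewrite (sum_splits_cat F).
have -> : \sum_(p <- splits (a :: s1)) F p.1 (p.2 ++ hone :: s2) =
    sg (wt (a :: s1) + 1) *: chain (a :: s1 ++ s2) + F (a :: s1) (hone :: s2).
  rewrite -(cat_cons a s1 s2) (lastI a s1); move: (belast a s1) (last a s1) => t y.
  rewrite (sum_splits_rcons (fun u v => F u (v ++ hone :: s2))).
  have -> : \sum_(p <- splits t) F p.1 (rcons p.2 y ++ hone :: s2) =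
      \sum_(p <- splits t) if p.2 is [::] then
        sg (wt (rcons t y) + 1) *: chain (rcons t y ++ s2) else 0.
    apply: eq_big_seq => -[u v] /splitsP /= ->.
    case: v => [|x v]; first by rewrite /= hmul1r cats0 cat_rcons.
    case: v => [|x' v] /=.
      by rewrite -cat_rcons chain_one' ?scaler0 //; case: (u).
    rewrite -!cat_cons catA chain_one' ?scaler0 //; by case: (u).
  rewrite (sum_splits_nil (fun=> sg (wt (rcons t y) + 1) *: chain (rcons t y ++ s2))).
  by [].
rewrite [X in _ + X + _]big1 ?addr0; last first.
  case=> u [|x [|y v]] _ //=.
  by rewrite -catA /= chain_one scaler0.
have hone_wt : hwt (hone : hom R) = -1 by rewrite hwt_toh.
case: s2 => [|z s2].
  rewrite cats1 b_cyclicE hmul1l hone_wt addNr mul0r add0r cats0 addr0.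
  rewrite -scalerDl (@sgn_opp _ (wt (a :: s1) + 1) (wt (a :: s1))) ?addNr ?scale0r //.
  by have -> : wt (a :: s1) + 1 - wt (a :: s1) = 1 by ring.
rewrite /F hmul1l wt_rcons hone_wt -scalerDl.
rewrite (@sgn_opp _ (wt (a :: s1) + 1) (wt (a :: s1) - 1 + 1)); last first.
  by have -> : wt (a :: s1) + 1 - (wt (a :: s1) - 1 + 1) = 1 by ring.
rewrite addNr scale0r add0r.
have -> : (a :: s1) ++ hone :: z :: s2 =
    a :: rcons (s1 ++ hone :: belast z s2) (last z s2).
  by rewrite rcons_cat rcons_cons -lastI.
by rewrite b_cyclicE chain_one scaler0.
Qed.

Lemma b_gen_balanced : balanced (@b_gen k R).
Proof.
split; last exact: b_gen_vanishes.
by apply: multilinear_add; [exact: b_inner_multilinear|exact: b_cyclic_multilinear].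
Qed.

Lemma b_linear : linear (@b k R).
Proof. exact: lift_linear b_gen_balanced. Qed.
Lemma b_chain a s : b (chain (a :: s)) = b_gen (a :: s) :> chains R.
Proof. exact: lift_chain b_gen_balanced. Qed.

Section Derivation.
Variable d : forall i, R i -> R (i + 1).
Hypothesis d_linear : forall i, linear (d (i := i)).
Hypothesis d_one : d gone = 0.

Lemma d_gen_balanced : balanced (d_gen d).
Proof.
pose F u v : chains R := if v is x :: v' then
      sg (wt u) *: chain (u ++ toh (d (tagged x)) :: v') else 0.
split=> [|a s1 s2].
  apply: (@multilinear_splits _ _ _ F) => [v|u].
    case: v => [|z v] s1 s2 i c x y /=; rewrite ?scaler0 ?addr0 //.
    rewrite (wt_toh _ _ (c *: x + y) x) (wt_toh _ _ y x).
    by rewrite -scale_lin -!catA !cat_cons chain_multilinear.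
  move=> [|z s1] s2 i c x y /=.
    by rewrite d_linear chain_multilinear scale_lin.
  rewrite -scale_lin.
  have := @chain_multilinear _ _ (u ++ toh (d (tagged z)) :: s1) s2 i c x y.
  by rewrite -!catA !cat_cons => ->.
rewrite /d_gen -cat_cons (sum_splits_cat F) !big1 ?addr0 //.
  case=> u [|x v] _ //=; by rewrite -catA /= chain_one scaler0.
case=> u [|x v] _ /=.
  by rewrite d_one (multilinear0 _ _ _ (@chain_multilinear _ _)) scaler0.
by rewrite -cat_cons catA chain_one' ?scaler0 //; case: (u).
Qed.

Lemma dext_linear : linear (dext d).
Proof. exact: lift_linear d_gen_balanced. Qed.
Lemma dext_chain a s : dext d (chain (a :: s)) = d_gen d (a :: s).
Proof. exact: lift_chain d_gen_balanced. Qed.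
End Derivation.
End BalancedB.
(* A Z-graded associative unital k-algebra: the algebra [galg] is the internal
   direct sum of the submodules [part i]. *)
Record gradedAlg (k : comPzRingType) := GradedAlg {
  galg :> algType k;
  part : int -> submodClosed galg;
  part_one : 1 \in part 0;
  part_mul : forall i j (x y : galg),
    x \in part i -> y \in part j -> x * y \in part (i + j);
  part_sum : forall x : galg, exists (s : seq int) (f : int -> galg),
    (forall i, f i \in part i) /\ x = \sum_(i <- s) f i;
  part_direct : forall (s : seq int) (f : int -> galg),
    uniq s -> (forall i, f i \in part i) -> \sum_(i <- s) f i = 0 ->
    {in s, forall i, f i = 0} }.

Section Components.
Variables (k : comPzRingType) (A : gradedAlg k).

Record comp (i : int) := Comp { cval :> A; cvalP : cval \in part A i }.
HB.instance Definition _ i := [isSub for @cval i].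
HB.instance Definition _ i := [Choice of comp i by <:].
HB.instance Definition _ i := [SubChoice_isSubLmodule of comp i by <:].

Definition comp_one : comp 0 := Comp (part_one A).
Definition comp_mul i j (x : comp i) (y : comp j) : comp (i + j) :=
  Comp (part_mul (cvalP x) (cvalP y)).

Lemma Tagged_comp i j (x : comp i) (y : comp j) :
  i = j -> (x : A) = y -> Tagged (fun n => comp n) x = Tagged (fun n => comp n) y.
Proof. by move=> e; case: j / e y => y e; congr Tagged; apply: val_inj. Qed.

Lemma comp_mulDl i j c (x x' : comp i) (y : comp j) :
  comp_mul (c *: x + x') y = c *: comp_mul x y + comp_mul x' y.
Proof. by apply: val_inj; rewrite /= mulrDl scalerAl. Qed.
Lemma comp_mulDr i j c (x : comp i) (y y' : comp j) :
  comp_mul x (c *: y + y') = c *: comp_mul x y + comp_mul x y'.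
Proof. by apply: val_inj; rewrite /= mulrDr scalerAr. Qed.
Lemma comp_mul1l i (x : comp i) :
  Tagged (fun n => comp n) (comp_mul comp_one x) = Tagged (fun n => comp n) x.
Proof. by apply: Tagged_comp; rewrite ?add0r //= mul1r. Qed.
Lemma comp_mul1r i (x : comp i) :
  Tagged (fun n => comp n) (comp_mul x comp_one) = Tagged (fun n => comp n) x.
Proof. by apply: Tagged_comp; rewrite ?addr0 //= mulr1. Qed.
Lemma comp_mulA i j l (x : comp i) (y : comp j) (z : comp l) :
  Tagged (fun n => comp n) (comp_mul (comp_mul x y) z) =
  Tagged (fun n => comp n) (comp_mul x (comp_mul y z)).
Proof. by apply: Tagged_comp; rewrite ?addrA //= mulrA. Qed.

Definition components : gralg k := @GrAlg k (fun i => comp i : lmodType k)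
  comp_one comp_mul comp_mulDl comp_mulDr comp_mul1l comp_mul1r comp_mulA.

End Components.
Arguments components : simpl never.

Section Cochains.
Variables (k : comPzRingType) (A : gradedAlg k).
Local Notation sg e := (sgn k e).
Local Notation homA := (hom (components A)).

Definition hval (x : homA) : A := cval (tagged x).
Definition homP (x : homA) : hval x \in part A (hdeg x) := cvalP (tagged x).

(* An element of deg n of C^*(A, A): its restriction to lists of length d is its
   component in C^d(A, A), which is normalized and raises degrees by n - d, so
   that D (a_1, ..., a_d) has degree (sum of the |a_i|) + n; all but finitely
   many components are zero. *)
Definition is_cochain (n : int) (D : seq homA -> A) : Prop :=
  [/\ multilinear D, vanishes_at_one D,
      forall s, D s \in part A (wt s + n)
    & exists N : nat, forall s, (N < size s)%N -> D s = 0].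

Definition cochain_pred (n : int) : {pred (seq homA -> A)} :=
  fun D => `[< is_cochain n D >].

Lemma cochain_predP n D : reflect (is_cochain n D) (D \in cochain_pred n).
Proof. exact: asboolP. Qed.

Lemma cochain_submod n : submod_closed (cochain_pred n).
Proof.
split=> [|c D E /cochain_predP [mD vD gD [N fD]] /cochain_predP [mE vE gE [N' fE]]].
  apply/cochain_predP; split=> [||s|].
  - exact: multilinear_zero.
  - by [].
  - exact: rpred0.
  - by exists 0%N.
apply/cochain_predP; split=> [s1 s2 i c' x y|s1 s2|s|].
- rewrite !fctE mD mE !scalerDr !scalerA [c * c']mulrC addrACA.
  by [].
- by rewrite !fctE vD vE scaler0 addr0.
- by rewrite fctE rpredD // rpredZ.
exists (maxn N N') => s; rewrite gtn_max => /andP[h1 h2].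
by rewrite !fctE fD // fE // scaler0 addr0.
Qed.
HB.instance Definition _ n :=
  GRing.isSubmodClosed.Build k (seq homA -> A) (cochain_pred n)
    (cochain_submod n).

Record cochain (n : int) := Cochain {
  cfun :> seq homA -> A; cochain_in : cfun \in cochain_pred n }.
HB.instance Definition _ n := [isSub for @cfun n].
HB.instance Definition _ n := [Choice of cochain n by <:].
HB.instance Definition _ n := [SubChoice_isSubLmodule of cochain n by <:].
End Cochains.
Section CochainAlgebra.
Variables (k : comPzRingType) (A : gradedAlg k).
Local Notation sg e := (sgn k e).
Local Notation R := (components A).
Local Notation homA := (hom (components A)).
Local Notation cochain := (@cochain k A).
Implicit Types s u v : seq homA.

Lemma cfun_multilinear n (D : cochain n) : multilinear (cfun D).
Proof. by case: D => D /= /cochain_predP[]. Qed.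
Lemma cfun_vanishes n (D : cochain n) : vanishes_at_one (cfun D).
Proof. by case: D => D /= /cochain_predP[]. Qed.
Lemma cfun_part n (D : cochain n) s : D s \in part A (wt s + n).
Proof. by case: D => D /= /cochain_predP[]. Qed.
Lemma cfun_finite n (D : cochain n) :
  exists N : nat, forall s, (N < size s)%N -> D s = 0.
Proof. by case: D => D /= /cochain_predP[]. Qed.

Lemma hval_lin i c (x y : R i) :
  hval (toh (c *: x + y)) = c *: hval (toh x) + hval (toh y).
Proof. by []. Qed.

Lemma part_eq i j (x : A) : x \in part A i -> i = j -> x \in part A j.
Proof. by move=> h <-. Qed.

(* Sum over all arities of the two factors; E has degree m. *)
Definition cup_fun (n m : int) (D : cochain n) (E : cochain m) s : A :=
  \sum_(p <- splits s) sg (m * wt p.1) *: (D p.1 * E p.2).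

Lemma cup_cochain n m (D : cochain n) (E : cochain m) :
  cup_fun D E \in @cochain_pred k A (n + m).
Proof.
apply/cochain_predP; split.
- apply: (@multilinear_splits _ _ _ (fun u v => sg (m * wt u) *: (D u * E v))).
    move=> v s1 s2 i c x y /=.
    rewrite (wt_toh _ _ (c *: x + y) x) (wt_toh _ _ y x) -scale_lin.
    by rewrite cfun_multilinear mulrDl scalerAl.
  move=> u s1 s2 i c x y /=.
  by rewrite -scale_lin cfun_multilinear mulrDr scalerAr.
- apply: (@vanishes_splits _ _ _ (fun u v => sg (m * wt u) *: (D u * E v))).
    by move=> v s1 s2; rewrite cfun_vanishes mul0r scaler0.
  by move=> u s1 s2; rewrite cfun_vanishes mulr0 scaler0.
- move=> s; rewrite /cup_fun big_seq; apply: rpred_sum => p /splitsP e.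
  apply: rpredZ; apply: part_eq (part_mul (cfun_part D p.1) (cfun_part E p.2)) _.
  by rewrite [in RHS]e wt_cat; ring.
have [[N hN] [N' hN']] := (cfun_finite D, cfun_finite E).
exists (N + N')%N => s hs; rewrite /cup_fun big_seq big1 // => p /splitsP e.
have [h|h] := ltnP N (size p.1); first by rewrite hN // mul0r scaler0.
by rewrite hN' ?mulr0 ?scaler0 // -(ltn_add2l N) (leq_trans hs) // e size_cat leq_add2r.
Qed.

Definition cup n m (D : cochain n) (E : cochain m) : cochain (n + m) :=
  Cochain (cup_cochain D E).

Definition cochain_one_fun s : A := if s is [::] then 1 else 0.

Lemma cochain_one_in : cochain_one_fun \in @cochain_pred k A 0.
Proof.
apply/cochain_predP; split.
- by case=> [|z s1] s2 i c x y /=; rewrite scaler0 addr0.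
- by case.
- by case=> [|z s]; rewrite ?rpred0 //= wt0 addr0 part_one.
by exists 0%N; case.
Qed.

Definition cochain_one : cochain 0 := Cochain cochain_one_in.

Lemma Tagged_cochain i j (x : cochain i) (y : cochain j) :
  i = j -> (x : seq homA -> A) =1 y ->
  Tagged (fun n => cochain n) x = Tagged (fun n => cochain n) y.
Proof.
move=> e; case: j / e y => y e; congr Tagged; apply: val_inj.
exact: funext.
Qed.

Lemma cup_Dl i j c (x x' : cochain i) (y : cochain j) :
  cup (c *: x + x') y = c *: cup x y + cup x' y.
Proof.
apply: val_inj; apply: funext => s; rewrite /= !fctE /= /cup_fun.
rewrite scaler_sumr -big_split; apply: eq_bigr => p _ /=.
by rewrite -scale_lin !fctE mulrDl scalerAl.
Qed.

Lemma cup_Dr i j c (x : cochain i) (y y' : cochain j) :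
  cup x (c *: y + y') = c *: cup x y + cup x y'.
Proof.
apply: val_inj; apply: funext => s; rewrite /= !fctE /= /cup_fun.
rewrite scaler_sumr -big_split; apply: eq_bigr => p _ /=.
by rewrite -scale_lin !fctE mulrDr scalerAr.
Qed.

Lemma cup_1l i (x : cochain i) :
  Tagged (fun n => cochain n) (cup cochain_one x) = Tagged (fun n => cochain n) x.
Proof.
apply: Tagged_cochain => [|s]; first by rewrite add0r.
rewrite /= /cup_fun; case: s => [|a s].
  by rewrite /splits big_seq1 /= wt0 mulr0 /sgn expr0 scale1r mul1r.
rewrite splits_cons big_cons big_map /= wt0 mulr0 /sgn expr0 scale1r mul1r.
by rewrite big1 ?addr0 // => p _; rewrite mul0r scaler0.
Qed.

Lemma cup_1r i (x : cochain i) :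
  Tagged (fun n => cochain n) (cup x cochain_one) = Tagged (fun n => cochain n) x.
Proof.
apply: Tagged_cochain => [|s]; first by rewrite addr0.
rewrite /= /cup_fun -[RHS](sum_splits_nil x); apply: eq_bigr => -[u [|z v]] _ /=.
  by rewrite mul0r /sgn expr0 scale1r mulr1.
by rewrite mulr0 scaler0.
Qed.

Lemma cup_A i j l (x : cochain i) (y : cochain j) (z : cochain l) :
  Tagged (fun n => cochain n) (cup (cup x y) z) =
  Tagged (fun n => cochain n) (cup x (cup y z)).
Proof.
apply: Tagged_cochain => [|s]; first by rewrite addrA.
rewrite /= /cup_fun.
pose F u v w := sg (l * wt u) *: (sg (l * wt v) *: (sg (j * wt u) *: (x u * y v * z w))).
transitivity (\sum_(p <- splits s) \sum_(q <- splits p.1) F q.1 q.2 p.2).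
  apply: eq_big_seq => p _; rewrite mulr_suml scaler_sumr.
  apply: eq_big_seq => q /splitsP e; rewrite /F e wt_cat mulrDr sgnD.
  by rewrite -scalerAl !scalerA.
rewrite sum_splits_assoc; apply: eq_big_seq => p _.
rewrite [x _ * _]mulr_sumr scaler_sumr; apply: eq_bigr => q _.
rewrite /F mulrDl sgnD -scalerAr mulrA !scalerA; congr (_ *: _).
by ring.
Qed.

(* On lists of length d + 1, with n = deg D: |D| = n - 1; in delta_inner,
   x = a_j, y = a_(j+1) and eta_j = wt (rcons p.1 x); in delta_right,
   belast a1 s' = (a_1, ..., a_d), whose wt is eta_d. *)
Definition delta_left n (D : cochain n) s : A :=
  if s is a1 :: s' then
    sg (hwt a1 * (n - 1) + hwt a1 + 1) *: (hval a1 * D s')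
  else 0.

Definition delta_inner n (D : cochain n) s : A :=
  \sum_(p <- splits s)
    if p.2 is x :: y :: v then
      sg (n - 1 + wt (rcons p.1 x)) *: D (p.1 ++ hmul x y :: v)
    else 0.

Definition delta_right n (D : cochain n) s : A :=
  if s is a1 :: s' then
    sg (n - 1 + wt (belast a1 s') + 1) *: (D (belast a1 s') * hval (last a1 s'))
  else 0.

Definition delta_fun n (D : cochain n) s : A :=
  delta_left D s + delta_inner D s + delta_right D s.

Lemma delta_rightE n (D : cochain n) s x :
  delta_right D (rcons s x) = sg (n - 1 + wt s + 1) *: (D s * hval x).
Proof. by case: s => [|a s] //=; rewrite belast_rcons last_rcons. Qed.

Lemma delta_multilinear n (D : cochain n) : multilinear (delta_fun D).
Proof.
have mD := cfun_multilinear D.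
apply: multilinear_add; first apply: multilinear_add.
- move=> [|z s1] s2 i c x y /=.
    by rewrite hval_lin [_ * D _]mulrDl -scalerAl !hwt_toh scale_lin.
  by rewrite mD [hval _ * _]mulrDr -scalerAr scale_lin.
- pose F u v : A := if v is x :: y :: v' then
      sg (n - 1 + wt (rcons u x)) *: D (u ++ hmul x y :: v') else 0.
  apply: (@multilinear_splits _ _ _ F) => [v|u].
    case: v => [|z [|z' v]] s1 s2 i c x y /=; rewrite ?scaler0 ?addr0 //.
    rewrite !wt_rcons (wt_toh _ _ (c *: x + y) x) (wt_toh _ _ y x).
    by rewrite -scale_lin -!catA !cat_cons mD.
  move=> [|z [|z' s1]] s2 i c x y /=.
  + case: s2 => [|z s2] /=; rewrite ?scaler0 ?addr0 //.
    by rewrite (multilinear_mulr _ _ mD) !wt_rcons !hwt_toh scale_lin.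
  + by rewrite (multilinear_mull _ _ mD) scale_lin.
  rewrite -scale_lin; have := mD (u ++ hmul z z' :: s1) s2 i c x y.
  by rewrite -!catA !cat_cons => ->.
move=> s1 s2 i c x y; case/lastP: s2 => [|s2 z].
  by rewrite !cats1 !delta_rightE hval_lin [D _ * _]mulrDr -scalerAr scale_lin.
rewrite -!rcons_cons -!rcons_cat !delta_rightE.
rewrite (wt_toh _ _ (c *: x + y) x) (wt_toh _ _ y x) mD [_ * hval _]mulrDl -scalerAl.
by rewrite scale_lin.
Qed.

Lemma hval1 : hval hone = 1 :> A. Proof. by []. Qed.
Lemma hwt1 : hwt (hone : homA) = -1. Proof. by []. Qed.

Lemma sgn_cancel (M : lmodType k) (e f : int) (x : M) :
  odd `|e - f|%N -> sg e *: x + sg f *: x = 0.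
Proof. by move=> h; rewrite (sgn_opp _ h) scaleNr addNr. Qed.

Lemma delta_vanishes n (D : cochain n) : vanishes_at_one (delta_fun D).
Proof.
have vD := cfun_vanishes D; move=> s1 s2; rewrite /delta_fun /delta_inner.
pose F u v : A := if v is x :: y :: v' then
      sg (n - 1 + wt (rcons u x)) *: D (u ++ hmul x y :: v') else 0.
rewrite (sum_splits_cat F) [X in _ + (_ + X)]big1 ?addr0; last first.
  by case=> u [|x [|y v]] _ //=; rewrite -catA /= vD scaler0.
have -> : \sum_(p <- splits s1) F p.1 (p.2 ++ hone :: s2) =
    (if s1 is [::] then 0 else sg (n - 1 + wt s1) *: D (s1 ++ s2)) +
    F s1 (hone :: s2).
  case/lastP: s1 => [|t y]; first by rewrite /splits big_seq1 add0r.
  rewrite (sum_splits_rcons (fun u v => F u (v ++ hone :: s2))).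
  have -> : \sum_(p <- splits t) F p.1 (rcons p.2 y ++ hone :: s2) =
      \sum_(p <- splits t) if p.2 is [::] then
        sg (n - 1 + wt (rcons t y)) *: D (rcons t y ++ s2) else 0.
    apply: eq_big_seq => -[u v] /splitsP /= ->.
    case: v => [|x v]; first by rewrite /= hmul1r cats0 cat_rcons.
    case: v => [|x' v] /=; first by rewrite -cat_rcons vD scaler0.
    by rewrite -!cat_cons catA vD scaler0.
  rewrite (sum_splits_nil (fun=> sg (n - 1 + wt (rcons t y)) *: D (rcons t y ++ s2))).
  by case: (t).
have -> : delta_left D (s1 ++ hone :: s2) =
    if s1 is [::] then sg (1 - n) *: D s2 else 0.
  case: s1 => [|a s1] /=; last by rewrite vD mulr0 scaler0.
  rewrite hval1 mul1r hwt1; congr (sg _ *: _); ring.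
have -> : delta_right D (s1 ++ hone :: s2) =
    if s2 is [::] then sg (n + wt s1) *: D s1 else 0.
  case/lastP: s2 => [|s2 x].
    rewrite cats1 delta_rightE hval1 mulr1; congr (sg _ *: _); ring.
  by rewrite -rcons_cons -rcons_cat delta_rightE vD mul0r scaler0; case: s2.
rewrite {}/F; case: s2 => [|z s2]; case: s1 => [|a s1];
  rewrite ?hmul1l ?wt_rcons ?hwt1 ?wt0 ?cats0 ?cat0s ?addr0 ?add0r;
  apply: sgn_cancel; lia.
Qed.

Lemma delta_cochain n (D : cochain n) : delta_fun D \in @cochain_pred k A (n + 1).
Proof.
apply/cochain_predP; split.
- exact: delta_multilinear.
- exact: delta_vanishes.
- move=> s; apply: rpredD; first apply: rpredD.
  + case: s => [|a s]; first exact: rpred0.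
    apply: rpredZ; apply: part_eq (part_mul (homP a) (cfun_part D s)) _.
    by rewrite wt_cons /hwt; ring.
  + rewrite /delta_inner big_seq; apply: rpred_sum => -[u [|x [|y v]]] //.
    * by rewrite rpred0.
    * by rewrite rpred0.
    move/splitsP => /= ->; apply: rpredZ; apply: part_eq (cfun_part D _) _.
    by rewrite !wt_cat !wt_cons /hwt /hmul /hdeg /=; ring.
  case/lastP: s => [|s x]; first exact: rpred0.
  rewrite delta_rightE; apply: rpredZ.
  apply: part_eq (part_mul (cfun_part D s) (homP x)) _.
  by rewrite wt_rcons /hwt; ring.
have [N hN] := cfun_finite D; exists N.+1 => s hs.
rewrite /delta_fun /delta_inner big_seq big1 => [|[u [|x [|y v]]] // /splitsP /= e].
  case/lastP: s hs => [|s x] // hs; rewrite delta_rightE.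
  rewrite hN ?mul0r ?scaler0 ?addr0; last by move: hs; rewrite size_rcons.
  by case: s hs => [|a s] //= hs; rewrite hN ?mulr0 ?scaler0 //; move: hs; rewrite !size_rcons.
by rewrite hN ?scaler0 //; move: hs; rewrite e !size_cat /= !addnS.
Qed.

Definition delta n (D : cochain n) : cochain (n + 1) := Cochain (delta_cochain D).

Lemma delta_linear n : linear (@delta n).
Proof.
move=> c D E; apply: val_inj; apply: funext => s.
have hl : delta_left (c *: D + E) s = c *: delta_left D s + delta_left E s.
  case: s => [|a s] /=; first by rewrite scaler0 addr0.
  by rewrite !fctE [hval _ * _]mulrDr -scalerAr scale_lin.
have hi : delta_inner (c *: D + E) s = c *: delta_inner D s + delta_inner E s.
  rewrite /delta_inner scaler_sumr -big_split; apply: eq_bigr => -[u [|x [|y v]]] _ /=.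
  - by rewrite scaler0 addr0.
  - by rewrite scaler0 addr0.
  by rewrite !fctE scale_lin.
have hr : delta_right (c *: D + E) s = c *: delta_right D s + delta_right E s.
  case: s {hl hi} => [|a s] /=; first by rewrite scaler0 addr0.
  by rewrite !fctE [_ * hval _]mulrDl -scalerAl scale_lin.
rewrite /= !fctE /= /delta_fun hl hi hr !scalerDr.
by rewrite [X in X + _ = _]addrACA [LHS]addrACA.
Qed.

Lemma delta_one : delta cochain_one = 0.
Proof.
apply: val_inj; rewrite [RHS]raddf0; apply: funext => s.
rewrite -[RHS]/(0 : A) /= /delta_fun /delta_inner.
rewrite big1 ?addr0; last by case=> [[|z u] [|x [|y v]]] _ //=; rewrite scaler0.
case: s => [|a [|a' s]] /=; rewrite ?addr0 ?mulr0 ?mul0r ?scaler0 ?addr0 //.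
rewrite mulr1 mul1r wt0; apply: sgn_cancel.
by rewrite (_ : _ - _ = 1) //; ring.
Qed.

Definition cochains : gralg k := @GrAlg k (fun n => cochain n : lmodType k)
  cochain_one cup cup_Dl cup_Dr cup_1l cup_1r cup_A.
End CochainAlgebra.
Arguments cochains : simpl never.

Section Pairing.
Variables (k : comPzRingType) (A : gradedAlg k).
Local Notation sg e := (sgn k e).
Local Notation CA := (chains (components A)).
Local Notation CE := (chains (cochains A)).
Local Notation homA := (hom (components A)).
Local Notation homE := (hom (cochains A)).
Implicit Types s u v : seq homA.

Definition heval (D : homE) (s : seq homA) : homA :=
  toh (Comp (cfun_part (tagged D) s) : components A (wt s + hdeg D)).

(* The sum, over all ways of inserting D_1, ..., D_m in this order into s, i.e.
   of replacing disjoint consecutive blocks of s (possibly empty) by the values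
   of D_1, ..., D_m, of (-1)^(sum over r of |D_r| * the sum of the |a_i| over
   the entries of s from the block of D_r on) *: g (result).  Here p.1 is what
   precedes the block q.1 of the first cochain D. *)
Fixpoint insertions (M : lmodType k) (Ds : seq homE) (s : seq homA)
    (g : seq homA -> M) {struct Ds} : M :=
  if Ds is D :: Ds' then
    \sum_(p <- splits s) \sum_(q <- splits p.2)
      sg (hwt D * wt p.2) *:
        insertions Ds' q.2 (fun t => g (p.1 ++ heval D q.1 :: t))
  else g s.

(* p.1 is the block of arguments of D_0. *)
Definition pair1_gen (w : seq homA) (z : seq homE) : CA :=
  match w, z with
  | a0 :: s, D0 :: Ds =>
      \sum_(p <- splits s)
        sg (hdeg D0 * wt s) *:
          insertions Ds p.2 (fun t => chain (hmul a0 (heval D0 p.1) :: t))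
  | _, _ => 0
  end.

(* D_m = last D1 Ds, and Dmid = (D_1, ..., D_(m-1)).  The list (a_1, ..., a_n) is
   cut as u ++ v ++ r with u = (a_1, ..., a_(i_0)),
   v = (a_(i_0+1), ..., a_(q-1)), r = (a_q, ..., a_n), and v0 is the block of
   arguments of D_0. *)
Definition pair2_gen (w : seq homA) (z : seq homE) : CA :=
  match w, z with
  | a0 :: s, D0 :: D1 :: Ds =>
      let Dm := last D1 Ds in
      let Dmid := belast D1 Ds in
      \sum_(p <- splits s) \sum_(p' <- splits p.2) \sum_(q <- splits p'.1)
        let: (u, v, r, v0, v1) := (p.1, p'.1, p'.2, q.1, q.2) in
        sg (wt (a0 :: u ++ v) * wt r + hdeg D0 * wt v
            + hwt Dm * (wt (a0 :: s) + hdeg D0 + wt Dmid)) *: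
          insertions Dmid v1
            (fun t => chain (hmul (heval Dm (r ++ a0 :: u)) (heval D0 v0) :: t))
  | _, _ => 0
  end.

Definition pair_gen (w : seq homA) (z : seq homE) : CA :=
  pair1_gen w z + pair2_gen w z.

Definition pairing (a : CA) (x : CE) : CA :=
  lift (fun w => lift (pair_gen w) x) a.

Section Insertions.
Variable M : lmodType k.
Implicit Types (g h : seq homA -> M) (Ds : seq homE).

Lemma insertions_ext Ds s g h :
  (forall t, g t = h t) -> insertions Ds s g = insertions Ds s h.
Proof. by move=> e; congr insertions; apply: funext. Qed.

Lemma insertions_lin Ds s c g h :
  insertions Ds s (fun t => c *: g t + h t) =
  c *: insertions Ds s g + insertions Ds s h.
Proof.
elim: Ds s g h => [|D Ds IH] s g h //=.
rewrite scaler_sumr -big_split; apply: eq_bigr => p _ /=.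
rewrite scaler_sumr -big_split; apply: eq_bigr => q _ /=.
by rewrite IH scale_lin.
Qed.

Lemma insertions_zero Ds s g : (forall t, g t = 0) -> insertions Ds s g = 0.
Proof.
elim: Ds s g => [|D Ds IH] s g hg //=.
by rewrite big1 // => p _; rewrite big1 // => q _; rewrite IH ?scaler0.
Qed.

Lemma heval_lin i (D : cochain A i) s1 s2 j c (x y : components A j) :
  exists (n : int) (X Y : components A n),
  [/\ heval (toh (D : cochains A i)) (s1 ++ toh (c *: x + y) :: s2) =
        toh (c *: X + Y),
      heval (toh (D : cochains A i)) (s1 ++ toh x :: s2) = toh X &
      heval (toh (D : cochains A i)) (s1 ++ toh y :: s2) = toh Y].
Proof.
pose X : components A (wt (s1 ++ toh x :: s2) + i) :=
  Comp (cfun_part D (s1 ++ toh x :: s2)).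
have hY : D (s1 ++ toh y :: s2) \in part A (wt (s1 ++ toh x :: s2) + i).
  by rewrite (wt_toh _ _ x y) cfun_part.
pose Y : components A (wt (s1 ++ toh x :: s2) + i) := Comp hY.
exists (wt (s1 ++ toh x :: s2) + i), X, Y; split.
- apply: Tagged_comp; first by rewrite (wt_toh _ _ (c *: x + y) x).
  by rewrite /= cfun_multilinear.
- by [].
- by apply: Tagged_comp; first by rewrite (wt_toh _ _ x y).
Qed.

Lemma heval_multilinear g (D : homE) u w :
  multilinear g -> multilinear (fun s => g (u ++ heval D s :: w)).
Proof.
move=> hg s1 s2 j c x y; case: D => i D.
have [n [X [Y [-> -> ->]]]] := heval_lin D s1 s2 c x y.
exact: hg.
Qed.

Lemma heval_zero (D : homE) s : tagged D s = 0 -> exists n, heval D s = toh (0 : components A n).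
Proof.
move=> h; exists (wt s + hdeg D); apply: Tagged_comp => //=.
Qed.

Lemma heval_vanishes g (D : homE) u w :
  multilinear g -> vanishes_at_one (fun s => g (u ++ heval D s :: w)).
Proof.
move=> hg s1 s2; have [|n ->] := @heval_zero D (s1 ++ hone :: s2).
  exact: cfun_vanishes.
exact: multilinear0.
Qed.

Lemma multilinear_insertions Ds g :
  multilinear g -> multilinear (fun s => insertions Ds s g).
Proof.
elim: Ds g => [|D Ds IH] g hg //=.
apply: (@multilinear_splits _ _ _ (fun u v => \sum_(q <- splits v)
  sg (hwt D * wt v) *: insertions Ds q.2 (fun t => g (u ++ heval D q.1 :: t)))).
  move=> v; apply: multilinear_sum => q s1 s2 i c x y.
  rewrite -scale_lin -insertions_lin; congr (_ *: _); apply: insertions_ext => t.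
  by rewrite -!catA !cat_cons hg.
move=> u; pose F v w := insertions Ds w (fun t => g (u ++ heval D v :: t)).
have hF : multilinear (fun v => \sum_(q <- splits v) F q.1 q.2).
  apply: (@multilinear_splits _ _ _ F) => [w|v].
    move=> s1 s2 i c x y; rewrite /F -insertions_lin; apply: insertions_ext => t.
    exact: (heval_multilinear D u t hg).
  apply: IH => s1 s2 i c x y.
  by have := hg (u ++ heval D v :: s1) s2 i c x y; rewrite -!catA !cat_cons.
move=> s1 s2 i c x y; rewrite -!scaler_sumr hF.
by rewrite (wt_toh _ _ (c *: x + y) x) (wt_toh _ _ y x) scale_lin.
Qed.

Lemma vanishes_insertions Ds g : multilinear g -> vanishes_at_one g ->
  vanishes_at_one (fun s => insertions Ds s g).
Proof.
elim: Ds g => [|D Ds IH] g hg h1 //=.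
apply: (@vanishes_splits _ _ _ (fun u v => \sum_(q <- splits v)
  sg (hwt D * wt v) *: insertions Ds q.2 (fun t => g (u ++ heval D q.1 :: t)))).
  move=> v s1 s2; rewrite big1 // => q _.
  by rewrite insertions_zero ?scaler0 // => t; rewrite -catA /= h1.
move=> u; pose F v w := insertions Ds w (fun t => g (u ++ heval D v :: t)).
have hF : vanishes_at_one (fun v => \sum_(q <- splits v) F q.1 q.2).
  apply: (@vanishes_splits _ _ _ F) => [w|v].
    move=> s1 s2; rewrite /F insertions_zero // => t.
    exact: (heval_vanishes D u t hg).
  apply: IH => [s1 s2 i c x y|s1 s2].
    by have := hg (u ++ heval D v :: s1) s2 i c x y; rewrite -!catA !cat_cons.
  by rewrite -cat_cons catA h1.
by move=> s1 s2; rewrite -scaler_sumr hF scaler0.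
Qed.

Lemma heval_linD i c (D E : cochain A i) s :
  exists (n : int) (X Y : components A n),
  [/\ heval (toh (c *: D + E : cochains A i)) s = toh (c *: X + Y),
      heval (toh (D : cochains A i)) s = toh X &
      heval (toh (E : cochains A i)) s = toh Y].
Proof.
exists (wt s + i), (Comp (cfun_part D s)), (Comp (cfun_part E s)); split=> //.
exact: Tagged_comp.
Qed.

Lemma multilinear_insertionsD s g :
  multilinear g -> multilinear (fun Ds => insertions Ds s g).
Proof.
move=> hg Ds1; elim: Ds1 s g hg => [|D' Ds1 IH] s g hg Ds2 i c D E /=.
  rewrite scaler_sumr -big_split; apply: eq_bigr => p _ /=.
  rewrite scaler_sumr -big_split; apply: eq_bigr => q _ /=.
  rewrite !hwt_toh -scale_lin -insertions_lin; congr (_ *: _).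
  apply: insertions_ext => t.
  by have [n [X [Y [-> -> ->]]]] := heval_linD c D E q.1; rewrite hg.
rewrite scaler_sumr -big_split; apply: eq_bigr => p _ /=.
rewrite scaler_sumr -big_split; apply: eq_bigr => q _ /=.
rewrite -scale_lin IH // => s1 s2 j c' x y.
by have := hg (p.1 ++ heval D' q.1 :: s1) s2 j c' x y; rewrite -!catA !cat_cons.
Qed.

Lemma heval_one s : heval hone s = hone \/ exists n, heval hone s = toh (0 : components A n).
Proof.
case: s => [|a s]; [left|by right; apply: heval_zero].
by apply: Tagged_comp; rewrite //= wt0.
Qed.

Lemma vanishes_insertionsD s g : multilinear g -> vanishes_at_one g ->
  vanishes_at_one (fun Ds => insertions Ds s g).
Proof.
move=> hg h1 Ds1; elim: Ds1 s g hg h1 => [|D' Ds1 IH] s g hg h1 Ds2 /=.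
  rewrite big1 // => p _; rewrite big1 // => q _.
  rewrite insertions_zero ?scaler0 // => t.
  by have [->|[n ->]] := heval_one q.1; [exact: h1 | exact: multilinear0].
rewrite big1 // => p _; rewrite big1 // => q _; rewrite IH ?scaler0 //.
  move=> s1 s2 j c' x y.
  by have := hg (p.1 ++ heval D' q.1 :: s1) s2 j c' x y; rewrite -!catA !cat_cons.
by move=> s1 s2; rewrite -cat_cons catA h1.
Qed.
End Insertions.

Local Notation chain_ml := (@chain_multilinear k (components A)).

Lemma hmul_heval_lin (f : seq homA -> CA) (a0 : homA) i (D : cochain A i) s1 s2 j c
    (x y : components A j) t :
  multilinear f ->
  f (hmul a0 (heval (toh (D : cochains A i)) (s1 ++ toh (c *: x + y) :: s2)) :: t) =
  c *: f (hmul a0 (heval (toh (D : cochains A i)) (s1 ++ toh x :: s2)) :: t) +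
  f (hmul a0 (heval (toh (D : cochains A i)) (s1 ++ toh y :: s2)) :: t).
Proof.
move=> hf; have [n [X [Y [-> -> ->]]]] := heval_lin D s1 s2 c x y.
exact: (multilinear_mull a0 [::] hf).
Qed.

Lemma heval_hmul_lin (f : seq homA -> CA) (b0 : homA) i (D : cochain A i) s1 s2 j c
    (x y : components A j) t :
  multilinear f ->
  f (hmul (heval (toh (D : cochains A i)) (s1 ++ toh (c *: x + y) :: s2)) b0 :: t) =
  c *: f (hmul (heval (toh (D : cochains A i)) (s1 ++ toh x :: s2)) b0 :: t) +
  f (hmul (heval (toh (D : cochains A i)) (s1 ++ toh y :: s2)) b0 :: t).
Proof.
move=> hf; have [n [X [Y [-> -> ->]]]] := heval_lin D s1 s2 c x y.
exact: (multilinear_mulr b0 [::] hf).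
Qed.

Lemma hmul0r (a0 : homA) n : exists m, hmul a0 (toh (0 : components A n)) = toh (0 : components A m).
Proof. by eexists; apply: Tagged_comp => //=; rewrite mulr0. Qed.
Lemma hmul0l (a0 : homA) n : exists m, hmul (toh (0 : components A n)) a0 = toh (0 : components A m).
Proof. by eexists; apply: Tagged_comp => //=; rewrite mul0r. Qed.

Lemma chain_cons_ml (a0 : homA) : multilinear (fun t => chain (a0 :: t) : CA).
Proof. by move=> s1 s2 i c x y; exact: (chain_ml (a0 :: s1)). Qed.

Lemma ins_hmul_ml Ds v a0 (D : homE) :
  multilinear (fun s => insertions Ds v (fun t => chain (hmul a0 (heval D s) :: t))).
Proof.
case: D => i D s1 s2 j c x y; rewrite -insertions_lin; apply: insertions_ext => t.
exact: hmul_heval_lin chain_ml.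
Qed.
Lemma ins_hmul_v Ds v a0 (D : homE) :
  vanishes_at_one (fun s => insertions Ds v (fun t => chain (hmul a0 (heval D s) :: t))).
Proof.
case: D => i D s1 s2; apply: insertions_zero => t.
have [|n ->] := @heval_zero (toh (D : cochains A i)) (s1 ++ hone :: s2).
  exact: cfun_vanishes.
have [m ->] := hmul0r a0 n; exact: (multilinear0 [::] _ _ chain_ml).
Qed.
Lemma ins_mulh_ml Ds v b0 (D : homE) :
  multilinear (fun s => insertions Ds v (fun t => chain (hmul (heval D s) b0 :: t))).
Proof.
case: D => i D s1 s2 j c x y; rewrite -insertions_lin; apply: insertions_ext => t.
exact: heval_hmul_lin chain_ml.
Qed.
Lemma ins_mulh_v Ds v b0 (D : homE) :
  vanishes_at_one (fun s => insertions Ds v (fun t => chain (hmul (heval D s) b0 :: t))).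
Proof.
case: D => i D s1 s2; apply: insertions_zero => t.
have [|n ->] := @heval_zero (toh (D : cochains A i)) (s1 ++ hone :: s2).
  exact: cfun_vanishes.
have [m ->] := hmul0l b0 n; exact: (multilinear0 [::] _ _ chain_ml).
Qed.

Lemma pair1_balanced_l z : balanced (pair1_gen^~ z).
Proof.
case: z => [|D0 Ds].
  by split=> [|a0]; [case=> [|a0 s1] s2 i c x y /=; rewrite scaler0 addr0|].
pose F a0 u v := insertions Ds v (fun t => chain (hmul a0 (heval D0 u) :: t)).
have pairE a0 s : pair1_gen (a0 :: s) (D0 :: Ds) =
    sg (hdeg D0 * wt s) *: \sum_(p <- splits s) F a0 p.1 p.2.
  by rewrite scaler_sumr.
split=> [[|a0 s1] s2 i c x y|a0 s1 s2]; rewrite ?cat0s ?cat_cons !pairE.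
- rewrite -scale_lin; congr (_ *: _).
  rewrite scaler_sumr -big_split; apply: eq_bigr => p _; rewrite /F /= -insertions_lin; apply: insertions_ext => t.
  exact: (multilinear_mulr _ [::] chain_ml).
- rewrite (wt_toh _ _ (c *: x + y) x) (wt_toh _ _ y x) -scale_lin; congr (_ *: _).
  apply: (@multilinear_splits _ _ _ (F a0)) => [v|u]; first exact: ins_hmul_ml.
  exact/multilinear_insertions/chain_cons_ml.
rewrite (@vanishes_splits _ _ _ (F a0)) ?scaler0 // => [v|u].
  exact: ins_hmul_v.
apply: vanishes_insertions; [exact: chain_cons_ml | exact: chain_unit].
Qed.

Lemma pair1_balanced_r w : balanced (pair1_gen w : seq homE -> CA).
Proof.
case: w => [|a0 s].
  by split=> [|D0]; [move=> z1 z2 i c x y /=; rewrite scaler0 addr0|].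
split=> [[|D0 z1] z2 i c D E|D0 z1 z2]; rewrite ?cat0s ?cat_cons /=.
- rewrite /= scaler_sumr -big_split; apply: eq_bigr => p _ /=.
  rewrite -[hdeg (toh (c *: D + E))]/i -[hdeg (toh D)]/i -[hdeg (toh E)]/i.
  rewrite -scale_lin -insertions_lin; congr (_ *: _); apply: insertions_ext => t.
  have [n [X [Y [-> -> ->]]]] := heval_linD c D E p.1.
  exact: (multilinear_mull _ [::] chain_ml).
- rewrite scaler_sumr -big_split; apply: eq_bigr => p _ /=.
  by rewrite -scale_lin multilinear_insertionsD //; apply: chain_cons_ml.
rewrite big1 // => p _; rewrite vanishes_insertionsD ?scaler0 //.
  exact: chain_cons_ml.
exact: chain_unit.
Qed.

Section Pair2.
Variables (D0 Dm : homE) (Ds : seq homE).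

Definition p2_sign (xa xu x0 x1 xr : int) : int :=
  (xa + xu + x0 + x1) * xr + hdeg D0 * (x0 + x1)
  + hwt Dm * (xa + xu + x0 + x1 + xr + hdeg D0 + wt Ds).
Definition p2_term (a0 : homA) u v0 v1 r : CA :=
  insertions Ds v1
    (fun t => chain (hmul (heval Dm (r ++ a0 :: u)) (heval D0 v0) :: t)).
Definition p2_signed (a0 : homA) u v0 v1 r : CA :=
  sg (p2_sign (hwt a0) (wt u) (wt v0) (wt v1) (wt r)) *: p2_term a0 u v0 v1 r.
Definition p2_sum (a0 : homA) s : CA :=
  \sum_(p <- splits s) \sum_(p' <- splits p.2) \sum_(q <- splits p'.1)
    p2_signed a0 p.1 q.1 q.2 p'.2.

Lemma p2_sum_lin s i c (x y : components A i) :
  p2_sum (toh (c *: x + y)) s = c *: p2_sum (toh x) s + p2_sum (toh y) s.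
Proof.
rewrite ?/p2_sum scaler_sumr -big_split; apply: eq_bigr => p _ /=.
rewrite scaler_sumr -big_split; apply: eq_bigr => p' _ /=.
rewrite scaler_sumr -big_split; apply: eq_bigr => q _ /=.
by rewrite /p2_signed /p2_term !hwt_toh ins_mulh_ml scale_lin.
Qed.

Lemma p2_signed_u a0 v0 v1 r : multilinear (fun u => p2_signed a0 u v0 v1 r).
Proof.
move=> s1 s2 i c x y; rewrite /p2_signed /p2_term.
rewrite (wt_toh _ _ (c *: x + y) x) (wt_toh _ _ y x) -scale_lin.
by have := ins_mulh_ml Ds v1 (heval D0 v0) Dm (r ++ a0 :: s1) s2 c x y;
  rewrite -!catA !cat_cons => ->.
Qed.
Lemma p2_signed_r a0 u v0 v1 : multilinear (p2_signed a0 u v0 v1).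
Proof.
move=> s1 s2 i c x y; rewrite /p2_signed /p2_term.
rewrite (wt_toh _ _ (c *: x + y) x) (wt_toh _ _ y x) -scale_lin.
by rewrite -!catA !cat_cons ins_mulh_ml.
Qed.
Lemma p2_signed_v0 a0 u v1 r : multilinear (fun v0 => p2_signed a0 u v0 v1 r).
Proof.
move=> s1 s2 i c x y; rewrite /p2_signed /p2_term.
rewrite (wt_toh _ _ (c *: x + y) x) (wt_toh _ _ y x) -scale_lin.
by rewrite ins_hmul_ml.
Qed.
Lemma p2_signed_v1 a0 u v0 r : multilinear (fun v1 => p2_signed a0 u v0 v1 r).
Proof.
move=> s1 s2 i c x y; rewrite /p2_signed /p2_term.
rewrite (wt_toh _ _ (c *: x + y) x) (wt_toh _ _ y x) -scale_lin.
by rewrite multilinear_insertions //; apply: chain_cons_ml.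
Qed.

Lemma p2_sum_ml a0 : multilinear (p2_sum a0).
Proof.
apply: (@multilinear_splits _ _ _ (fun u w => \sum_(p' <- splits w)
   \sum_(q <- splits p'.1) p2_signed a0 u q.1 q.2 p'.2)) => [w|u].
  by do 2 (apply: multilinear_sum => ?); apply: p2_signed_u.
apply: (@multilinear_splits _ _ _ (fun v r =>
   \sum_(q <- splits v) p2_signed a0 u q.1 q.2 r)) => [r|v].
  apply: (@multilinear_splits _ _ _ (fun v0 v1 => p2_signed a0 u v0 v1 r)).
    by move=> v1; apply: p2_signed_v0.
  by move=> v0; apply: p2_signed_v1.
by apply: multilinear_sum => ?; apply: p2_signed_r.
Qed.

Lemma p2_sum_v a0 : vanishes_at_one (p2_sum a0).
Proof.
apply: (@vanishes_splits _ _ _ (fun u w => \sum_(p' <- splits w)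
   \sum_(q <- splits p'.1) p2_signed a0 u q.1 q.2 p'.2)) => [w|u].
  move=> s1 s2; rewrite big1 // => p' _; rewrite big1 // => q _.
  by rewrite /p2_signed /p2_term -cat_cons catA ins_mulh_v scaler0.
apply: (@vanishes_splits _ _ _ (fun v r =>
   \sum_(q <- splits v) p2_signed a0 u q.1 q.2 r)) => [r|v].
  apply: (@vanishes_splits _ _ _ (fun v0 v1 => p2_signed a0 u v0 v1 r)).
    by move=> v1 s1 s2; rewrite /p2_signed /p2_term ins_hmul_v scaler0.
  move=> v0 s1 s2; rewrite /p2_signed /p2_term vanishes_insertions ?scaler0 //.
    exact: chain_cons_ml.
  exact: chain_unit.
move=> s1 s2; rewrite big1 // => q _.
by rewrite /p2_signed /p2_term -catA cat_cons ins_mulh_v scaler0.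
Qed.
End Pair2.

Lemma pair2E a0 s D0 Ds Dm :
  pair2_gen (a0 :: s) (D0 :: rcons Ds Dm) = p2_sum D0 Dm Ds a0 s.
Proof.
have -> : pair2_gen (a0 :: s) (D0 :: rcons Ds Dm) =
  \sum_(p <- splits s) \sum_(p' <- splits p.2) \sum_(q <- splits p'.1)
    sg (wt (a0 :: p.1 ++ p'.1) * wt p'.2 + hdeg D0 * wt p'.1
            + hwt Dm * (wt (a0 :: s) + hdeg D0 + wt Ds)) *:
    p2_term D0 Dm Ds a0 p.1 q.1 q.2 p'.2.
  by case: Ds => [|D1 Ds] //=; rewrite last_rcons belast_rcons.
apply: eq_big_seq => p /splitsP e1; apply: eq_big_seq => p' /splitsP e2.
apply: eq_big_seq => q /splitsP e3; rewrite /p2_signed; congr (sg _ *: _).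
rewrite e1 e2 e3 !(wt_cons, wt_cat) /p2_sign; ring.
Qed.

Lemma pair2_balanced_l z : balanced (pair2_gen^~ z).
Proof.
case: z => [|D0 z].
  by split=> [|a0]; [case=> [|a0 s1] s2 i c x y /=; rewrite scaler0 addr0|].
case/lastP: z => [|Ds Dm].
  by split=> [|a0]; [case=> [|a0 s1] s2 i c x y /=; rewrite scaler0 addr0|].
split=> [[|a0 s1] s2 i c x y|a0 s1 s2]; rewrite ?cat0s ?cat_cons !pair2E.
- exact: p2_sum_lin.
- exact: p2_sum_ml.
exact: p2_sum_v.
Qed.

Lemma pair2_balanced_r w : balanced (pair2_gen w : seq homE -> CA).
Proof.
case: w => [|a0 s].
  by split=> [|D0]; [move=> z1 z2 i c x y /=; rewrite scaler0 addr0|].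
split=> [[|D0 z1] z2 i c D E|D0 z1 z2]; rewrite ?cat0s ?cat_cons.
- case/lastP: z2 => [|Ds Dm]; first by rewrite /= scaler0 addr0.
  rewrite !pair2E /p2_sum scaler_sumr -big_split; apply: eq_bigr => p _ /=.
  rewrite scaler_sumr -big_split; apply: eq_bigr => p' _ /=.
  rewrite scaler_sumr -big_split; apply: eq_bigr => q _ /=.
  rewrite /p2_signed -scale_lin /p2_term -insertions_lin; congr (_ *: _).
  apply: insertions_ext => t.
  have [n [X [Y [-> -> ->]]]] := heval_linD c D E q.1.
  exact: (multilinear_mull _ [::] chain_ml).
- case/lastP: z2 => [|z2 Dm].
    rewrite !cats1 !pair2E /p2_sum scaler_sumr -big_split; apply: eq_bigr => p _ /=.
    rewrite scaler_sumr -big_split; apply: eq_bigr => p' _ /=.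
    rewrite scaler_sumr -big_split; apply: eq_bigr => q _ /=.
    rewrite /p2_signed /p2_sign !hwt_toh -scale_lin /p2_term -insertions_lin.
    congr (_ *: _); apply: insertions_ext => t.
    have [n [X [Y [-> -> ->]]]] := heval_linD c D E (p'.2 ++ a0 :: p.1).
    exact: (multilinear_mulr _ [::] chain_ml).
  rewrite -!rcons_cons -!rcons_cat !pair2E /p2_sum scaler_sumr -big_split.
  apply: eq_bigr => p _ /=; rewrite scaler_sumr -big_split.
  apply: eq_bigr => p' _ /=; rewrite scaler_sumr -big_split.
  apply: eq_bigr => q _ /=; rewrite /p2_signed /p2_sign.
  rewrite (wt_toh _ _ (c *: D + E) D) (wt_toh _ _ E D) -scale_lin.
  by rewrite /p2_term multilinear_insertionsD //; apply: chain_cons_ml.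
case/lastP: z2 => [|z2 Dm].
  rewrite cats1 pair2E /p2_sum big1 // => p _; rewrite big1 // => p' _.
  rewrite big1 // => q _; rewrite /p2_signed /p2_term insertions_zero ?scaler0 //.
  move=> t; have [|n ->] := @heval_zero hone (p'.2 ++ a0 :: p.1).
    by case: p'.2.
  have [m ->] := hmul0l (heval D0 q.1) n; exact: (multilinear0 [::] _ _ chain_ml).
rewrite -rcons_cons -rcons_cat pair2E /p2_sum big1 // => p _; rewrite big1 // => p' _.
rewrite big1 // => q _; rewrite /p2_signed /p2_term vanishes_insertionsD ?scaler0 //.
  exact: chain_cons_ml.
exact: chain_unit.
Qed.

Lemma pair_gen_balanced_l z : balanced (pair_gen^~ z).
Proof.
have [h1 h2] := pair1_balanced_l z; have [h3 h4] := pair2_balanced_l z.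
split; first exact: multilinear_add.
by move=> a s1 s2; rewrite /pair_gen h2 h4 addr0.
Qed.

Lemma pair_gen_balanced_r w : balanced (pair_gen w : seq homE -> CA).
Proof.
have [h1 h2] := pair1_balanced_r w; have [h3 h4] := pair2_balanced_r w.
split; first exact: multilinear_add.
by move=> a s1 s2; rewrite /pair_gen h2 h4 addr0.
Qed.

Lemma pairing_balanced x : balanced (fun w => lift (pair_gen w) x).
Proof.
rewrite -(cls_repr x); move: (repr x) => u.
have liftE w : lift (pair_gen w) (cls u) =
    \sum_(t <- u) t.1 *: pair_gen w (t.2.1 :: t.2.2).
  exact: lift_cls (pair_gen_balanced_r w).
split=> [s1 s2 i c y z|a s1 s2]; rewrite !liftE.
  rewrite scaler_sumr -big_split; apply: eq_bigr => t _ /=.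
  by rewrite (proj1 (pair_gen_balanced_l _)) scale_lin.
rewrite big1 // => t _.
by rewrite (proj2 (pair_gen_balanced_l _)) scaler0.
Qed.

Lemma pairing_chain a s D Ds :
  pairing (chain (a :: s)) (chain (D :: Ds)) = pair_gen (a :: s) (D :: Ds).
Proof.
rewrite /pairing (lift_chain _ _ (pairing_balanced _)).
exact: lift_chain (pair_gen_balanced_r _).
Qed.

Lemma pairing_linear_l x : linear (pairing^~ x).
Proof. exact: lift_linear (pairing_balanced x). Qed.

Lemma pairing_linear_r a : linear (pairing a).
Proof.
move=> c x y; rewrite /pairing -(cls_repr a); move: (repr a) => u.
rewrite !(lift_cls _ (pairing_balanced _)) /lext scaler_sumr -big_split.
apply: eq_bigr => t _ /=.
by rewrite (lift_linear (pair_gen_balanced_r _)) scale_lin.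
Qed.

Definition delta_ext : CE -> CE := dext (R := cochains A) (@delta k A).

Lemma delta_ext_linear : linear delta_ext.
Proof. by apply: dext_linear; [exact: delta_linear | exact: delta_one]. Qed.

Lemma delta_ext_chain D Ds :
  delta_ext (chain (D :: Ds)) = d_gen (R := cochains A) (@delta k A) (D :: Ds).
Proof. by apply: dext_chain; [exact: delta_linear | exact: delta_one]. Qed.

End Pairing.

(* Main.v *)
(** Inserting [D_1, ..., D_m] into a word commutes with the bar differentials of
    [A] and of the cochain algebra: a product of two neighbouring values is a cup
    product, and the products involving the arguments of some [D_r] make up
    [delta D_r].  Hence [b (a bullet_1 x)] has the required form, except for the
    cyclic term in which the block of [D_m] ends the word and its value
    multiplies [a_0] from the left.

    If [D_m] swallows the cyclic block [r ++ a_0 :: u], then [bullet_2] is a sum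
    of terms of type [bullet_1] with head [D_m (r ++ a_0 :: u)] on the remaining
    word and cochains.  So its boundary is known, and it is compared with
    [delta D_m], with the cup product of the last two cochains and with the
    rotated cochain chains, in which [D_m] multiplies [D_0]: the extra terms are
    the same sums over cuts of the word, with the border of a block moved by one
    letter or by one block, and the exceptional term above is the summand of
    [delta D_m] in which [a_0] is the right factor. *)
Require Import Defs.
From HB Require Import structures.
From mathcomp Require Import all_boot all_order all_algebra.
From mathcomp Require Import ring zify.
Import Defs.

Set Implicit Arguments.
Unset Strict Implicit.
Unset Printing Implicit Defensive.
Import GRing.Theory.
Local Open Scope ring_scope.

(** * Signs through parities of exponents *)

Definition par (e : int) : bool := odd `|e|%N.

Lemma parD e f : par (e + f) = par e (+) par f.
Proof. by rewrite /par -oddD; lia. Qed.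
Lemma parN e : par (- e) = par e.
Proof. by rewrite /par abszN. Qed.
Lemma parM e f : par (e * f) = par e && par f.
Proof. by rewrite /par abszM oddM. Qed.
Lemma par1 : par 1 = true. Proof. by []. Qed.
Lemma par0 : par 0 = false. Proof. by []. Qed.
Definition parE := (parD, parN, parM, par1, par0).

Lemma sgn_par (k : pzRingType) e f : par e = par f -> sgn k e = sgn k f.
Proof. by rewrite !sgn_odd /par => ->. Qed.

Lemma sgn_parN (k : pzRingType) e f : par e = ~~ par f -> sgn k e = - sgn k f.
Proof. by rewrite !sgn_odd /par => ->; case: odd; rewrite ?expr0 ?expr1 ?opprK. Qed.

Lemma sgn0 (k : pzRingType) : sgn k 0 = 1. Proof. by []. Qed.

(** A sign sees its exponent only modulo 2, where sums become exclusive ors and products become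
    conjunctions. An identity of signs is therefore a propositional tautology in the parities of the
    weights, checked by cases. *)
Ltac parity :=
  rewrite ?parE;
  repeat match goal with |- context [par ?x] => generalize (par x) end;
  by do ![case].

(** * Sums over cuts of a word into two blocks *)

Section Cuts.
Variables (V : nmodType) (T : Type).
Implicit Types (s u v : seq T).

Definition cuts s (F : seq T -> seq T -> V) : V := \sum_(p <- splits s) F p.1 p.2.

(** The value on the empty word is 0, so a summand that takes a letter from a block simply vanishes
    when the block is empty, and sums over cuts need no side conditions. *)
Definition uncons s (F : T -> seq T -> V) : V := if s is x :: s' then F x s' else 0.

Definition unrcons s (F : seq T -> T -> V) : V :=
  if s is x :: s' then F (belast x s') (last x s') else 0.

Lemma uncons_cons s x F : uncons (x :: s) F = F x s.
Proof. by []. Qed.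

Lemma unrcons_rcons s x F : unrcons (rcons s x) F = F s x.
Proof. by case: s => //= y s; rewrite belast_rcons last_rcons. Qed.

Lemma cuts_nil F : cuts [::] F = F [::] [::].
Proof. exact: sum_splits0. Qed.

Lemma cuts_cons x s F : cuts (x :: s) F = F [::] (x :: s) + cuts s (fun u => F (x :: u)).
Proof. exact: sum_splits_cons. Qed.

Lemma cuts_rcons s x F :
  cuts (rcons s x) F = cuts s (fun u v => F u (rcons v x)) + F (rcons s x) [::].
Proof. exact: sum_splits_rcons. Qed.

Lemma cuts_cat s1 x s2 F :
  cuts (s1 ++ x :: s2) F =
  cuts s1 (fun u v => F u (v ++ x :: s2)) + cuts s2 (fun u => F (s1 ++ x :: u)).
Proof. exact: sum_splits_cat. Qed.

Lemma cutsA s (F : seq T -> seq T -> seq T -> V) :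
  cuts s (fun u w => cuts u (fun u1 u2 => F u1 u2 w)) =
  cuts s (fun u v => cuts v (F u)).
Proof. exact: sum_splits_assoc. Qed.

Lemma eq_cuts s F G : (forall u v, s = u ++ v -> F u v = G u v) -> cuts s F = cuts s G.
Proof.
elim: s F G => [|x s IH] F G e; first by rewrite !cuts_nil e.
by rewrite !cuts_cons e // (IH _ (fun u => G (x :: u))) // => u v es; rewrite e // es.
Qed.

Lemma cutsD s F G : cuts s (fun u v => F u v + G u v) = cuts s F + cuts s G.
Proof. exact: big_split. Qed.

Lemma eq_uncons s F G : (forall x v, s = x :: v -> F x v = G x v) -> uncons s F = uncons s G.
Proof. by case: s => //= x s; apply. Qed.

Lemma eq_unrcons s F G :
  (forall u x, s = rcons u x -> F u x = G u x) -> unrcons s F = unrcons s G.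
Proof. by case: s / lastP => // s x e; rewrite !unrcons_rcons e. Qed.

Lemma unconsD s F G : uncons s (fun x v => F x v + G x v) = uncons s F + uncons s G.
Proof. by case: s => //=; rewrite addr0. Qed.

Lemma unrconsD s F G : unrcons s (fun u x => F u x + G u x) = unrcons s F + unrcons s G.
Proof. by case: s => //=; rewrite addr0. Qed.

Lemma cuts_uncons s (F : T -> seq T -> seq T -> V) :
  cuts s (fun u v => uncons u (fun x u' => F x u' v)) =
  uncons s (fun x s' => cuts s' (F x)).
Proof. by case: s => [|x s]; rewrite ?cuts_nil // cuts_cons add0r. Qed.

(** Both sides run over the decompositions [s = u ++ x :: v]: the letter at the border may be
    counted with either block. Induction on the word isolates the summand in which [x] comes
    first. *)
Lemma cuts_unrcons s (F : seq T -> T -> seq T -> V) :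
  cuts s (fun u v => unrcons u (fun u' x => F u' x v)) =
  cuts s (fun u v => uncons v (F u)).
Proof.
elim: s F => [|x s IH] F; first by rewrite !cuts_nil.
rewrite !cuts_cons /= add0r.
transitivity (cuts s (fun u v => (if u is [::] then F [::] x v else 0) +
   unrcons u (fun u' y => F (x :: u') y v))).
  apply: eq_cuts => u v _; case: u => [|y u]; first by rewrite addr0.
  by rewrite add0r.
rewrite cutsD IH; congr (_ + _).
by case: s {IH} => [|y s]; rewrite ?cuts_nil // cuts_cons /cuts big1 ?addr0.
Qed.

Lemma cuts_unrcons_r s (F : seq T -> seq T -> T -> V) :
  cuts s (fun u v => unrcons v (F u)) =
  unrcons s (fun s' x => cuts s' (fun u v => F u v x)).
Proof.
case: s / lastP => [|s x]; first by rewrite cuts_nil.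
rewrite cuts_rcons /= addr0 unrcons_rcons.
by apply: eq_cuts => u v _; rewrite unrcons_rcons.
Qed.

End Cuts.

Section CutsModule.
Variables (V W : zmodType) (T : Type).
Implicit Types (s : seq T) (f : {additive V -> W}).

Lemma raddf_cuts f s F : f (cuts s F) = cuts s (fun u v => f (F u v)).
Proof. exact: raddf_sum. Qed.
Lemma raddf_uncons f s F : f (uncons s F) = uncons s (fun u v => f (F u v)).
Proof. by case: s => //=; rewrite raddf0. Qed.
Lemma raddf_unrcons f s F : f (unrcons s F) = unrcons s (fun u v => f (F u v)).
Proof. by case: s => //=; rewrite raddf0. Qed.

End CutsModule.

Section CutsScale.
Variables (k : pzRingType) (M : lmodType k) (T : Type).
Implicit Types (s : seq T) (c : k).

Lemma scale_cuts c s F : c *: cuts s F = cuts s (fun u v => c *: F u v) :> M.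
Proof. exact: scaler_sumr. Qed.
Lemma scale_uncons c s F : c *: uncons s F = uncons s (fun u v => c *: F u v) :> M.
Proof. by case: s => //=; rewrite scaler0. Qed.
Lemma scale_unrcons c s F : c *: unrcons s F = unrcons s (fun u v => c *: F u v) :> M.
Proof. by case: s => //=; rewrite scaler0. Qed.
Lemma cutsN s F : - cuts s F = cuts s (fun u v => - F u v) :> M.
Proof. by rewrite /cuts sumrN. Qed.
Lemma unconsN s F : - uncons s F = uncons s (fun u v => - F u v) :> M.
Proof. by case: s => //=; rewrite oppr0. Qed.
Lemma unrconsN s F : - unrcons s F = unrcons s (fun u v => - F u v) :> M.
Proof. by case: s => //=; rewrite oppr0. Qed.

End CutsScale.

(** Indicator of the empty word; it singles out the boundary summands in which a block next to a
    distinguished letter is empty. *)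
Definition unnil (V : zmodType) (T : Type) (s : seq T) (m : V) : V :=
  if s is [::] then m else 0.

Lemma cuts_unnil_l (V : zmodType) (T : Type) (s : seq T) (F : seq T -> V) :
  cuts s (fun u v => unnil u (F v)) = F s.
Proof.
case: s => [|x s]; first by rewrite cuts_nil.
by rewrite cuts_cons /cuts big1 ?addr0.
Qed.

Lemma cuts_unnil_r (V : zmodType) (T : Type) (s : seq T) (F : seq T -> V) :
  cuts s (fun u v => unnil v (F u)) = F s.
Proof. exact: sum_splits_nil. Qed.

Lemma uncons_cat (V : zmodType) (T : Type) (p : seq T) x s (G : T -> seq T -> V) :
  uncons (p ++ x :: s) G =
  uncons p (fun y p' => G y (p' ++ x :: s)) + unnil p (G x s).
Proof. by case: p => [|y p]; rewrite /= ?add0r ?addr0. Qed.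

(** * Sums over cuts into three blocks, and moving the borders *)

Section Cuts3.
Variables (V : zmodType) (T : Type).
Implicit Types (s u v r : seq T) (F G : seq T -> seq T -> seq T -> V).

Definition cuts3 s F : V := cuts s (fun u w => cuts w (F u)).

Lemma cuts3A s F : cuts3 s F = cuts s (fun t r => cuts t (fun u v => F u v r)).
Proof. by rewrite cutsA. Qed.

Lemma eq_cuts3 s F G :
  (forall u v r, s = u ++ v ++ r -> F u v r = G u v r) -> cuts3 s F = cuts3 s G.
Proof. by move=> e; apply: eq_cuts => u w es; apply: eq_cuts => v r ew; rewrite e // es ew. Qed.

Lemma cuts3D s F G : cuts3 s (fun u v r => F u v r + G u v r) = cuts3 s F + cuts3 s G.
Proof. by rewrite /cuts3 -cutsD; apply: eq_cuts => u w _; rewrite cutsD. Qed.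

(** Only the border between the first two blocks moves, so the third block is fixed first and the
    statement for two blocks is applied to the rest. *)
Lemma cuts3_pass_uv s (F : seq T -> T -> seq T -> seq T -> V) :
  cuts3 s (fun u v r => unrcons u (fun u' x => F u' x v r)) =
  cuts3 s (fun u v r => uncons v (fun x v' => F u x v' r)).
Proof.
rewrite !cuts3A; apply: eq_cuts => t r _.
exact: (cuts_unrcons t (fun u x v => F u x v r)).
Qed.

Lemma cuts3_pass_vr s (F : seq T -> seq T -> T -> seq T -> V) :
  cuts3 s (fun u v r => unrcons v (fun v' x => F u v' x r)) =
  cuts3 s (fun u v r => uncons r (F u v)).
Proof. by apply: eq_cuts => u w _; exact: (cuts_unrcons w (F u)). Qed.

Lemma cuts3_move_uv s (F : seq T -> seq T -> seq T -> seq T -> V) :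
  cuts3 s (fun u v r => cuts u (fun u' q => F u' q v r)) =
  cuts3 s (fun u v r => cuts v (fun q v' => F u q v' r)).
Proof. by rewrite !cuts3A; apply: eq_cuts => t r _; exact: cutsA (fun u q v => F u q v r). Qed.

Lemma cuts3_move_vr s (F : seq T -> seq T -> seq T -> seq T -> V) :
  cuts3 s (fun u v r => cuts v (fun v' q => F u v' q r)) =
  cuts3 s (fun u v r => cuts r (F u v)).
Proof. by apply: eq_cuts => u w _; exact: (cutsA w (F u)). Qed.

Lemma cuts3_uncons s (F : T -> seq T -> seq T -> seq T -> V) :
  cuts3 s (fun u v r => uncons u (fun x u' => F x u' v r)) =
  uncons s (fun x s' => cuts3 s' (F x)).
Proof.
rewrite -(cuts_uncons s (fun x u w => cuts w (F x u))).
by apply: eq_cuts => -[|x u] w _ //=; rewrite /cuts big1.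
Qed.

Lemma cuts3_unrcons s (F : seq T -> seq T -> seq T -> T -> V) :
  cuts3 s (fun u v r => unrcons r (F u v)) =
  unrcons s (fun s' x => cuts3 s' (fun u v r => F u v r x)).
Proof.
rewrite -(cuts_unrcons_r s (fun u w x => cuts w (fun v r => F u v r x))).
by apply: eq_cuts => u w _; exact: (cuts_unrcons_r w (F u)).
Qed.

Lemma cuts3_unnil_l s (F : seq T -> seq T -> V) :
  cuts3 s (fun u v r => unnil u (F v r)) = cuts s F.
Proof.
rewrite -[RHS](cuts_unnil_l s (fun w => cuts w F)).
by apply: eq_cuts => -[|x u] w _ //; rewrite /cuts big1.
Qed.

Lemma cuts3_unnil_r s (F : seq T -> seq T -> V) :
  cuts3 s (fun u v r => unnil r (F u v)) = cuts s F.
Proof. by apply: eq_cuts => u w _; exact: cuts_unnil_r. Qed.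

Lemma cuts3_unrcons_out (T' : Type) s (l : seq T')
    (F : seq T -> seq T -> seq T -> seq T' -> T' -> V) :
  cuts3 s (fun u v r => unrcons l (F u v r)) =
  unrcons l (fun l' x => cuts3 s (fun u v r => F u v r l' x)).
Proof.
case/lastP: l => [|l x].
  by rewrite /cuts3 /cuts big1 // => p _; rewrite big1.
by rewrite unrcons_rcons; apply: eq_cuts3 => u v r _; rewrite unrcons_rcons.
Qed.

End Cuts3.

Lemma scale_unnil (k : pzRingType) (M : lmodType k) (T : Type) (c : k) (s : seq T) (m : M) :
  c *: unnil s m = unnil s (c *: m).
Proof. by case: s => //=; rewrite scaler0. Qed.

Lemma scale_cuts3 (k : pzRingType) (M : lmodType k) (T : Type) (c : k) (s : seq T) F :
  c *: cuts3 s F = cuts3 s (fun u v r => c *: F u v r) :> M.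
Proof. by rewrite scale_cuts; apply: eq_cuts => u w _; rewrite scale_cuts. Qed.

Lemma cuts3N (k : pzRingType) (M : lmodType k) (T : Type) (s : seq T) F :
  - cuts3 s F = cuts3 s (fun u v r => - F u v r) :> M.
Proof. by rewrite /cuts3 cutsN; apply: eq_cuts => u w _; rewrite cutsN. Qed.

(** * Bar differentials in continuation form *)

Section Merges.
Variables (k : comPzRingType) (R : gralg k) (M : lmodType k).
Local Notation sg e := (sgn k e).
Implicit Types (s u v : seq (hom R)) (F : seq (hom R) -> M).

Lemma hwt_hmul (x y : hom R) : hwt (hmul x y) = hwt x + hwt y + 1.
Proof. by rewrite /hwt /hdeg /=; ring. Qed.

Lemma hdegE (x : hom R) : hdeg x = hwt x + 1.
Proof. by rewrite /hwt subrK. Qed.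

Lemma hmulA (x y z : hom R) : hmul (hmul x y) z = hmul x (hmul y z).
Proof. exact: gmulA. Qed.

Lemma hwt_d (d : forall i, R i -> R (i + 1)) x : hwt (toh (d _ (tagged x))) = hwt x + 1.
Proof. by rewrite /hwt /hdeg /= addrAC. Qed.

(** Up to a global sign, the non-cyclic part of the Hochschild boundary, followed by the function
    [F] on words. Leaving [F] free allows the same calculus for words in [A], words of cochains, and
    values of a cochain. *)
Definition merges s F : M :=
  cuts s (fun u v => uncons v (fun x v1 => uncons v1 (fun y v2 =>
    sg (wt u + hwt x) *: F (u ++ hmul x y :: v2)))).

Definition derivs (d : forall i, R i -> R (i + 1)) s F : M :=
  cuts s (fun u v => uncons v (fun x v' => sg (wt u) *: F (u ++ toh (d _ (tagged x)) :: v'))).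

Lemma merges_nil F : merges [::] F = 0.
Proof. by rewrite /merges cuts_nil. Qed.

Lemma merges_cons x s F :
  merges (x :: s) F =
  sg (hwt x) *: (uncons s (fun y s' => F (hmul x y :: s')) +
                 merges s (fun s' => F (x :: s'))).
Proof.
rewrite /merges cuts_cons /= scalerDr scale_uncons wt0 add0r; congr (_ + _).
rewrite scale_cuts; apply: eq_cuts => u v _.
rewrite scale_uncons; apply: eq_uncons => y v' _.
rewrite scale_uncons; apply: eq_uncons => z w _.
by rewrite scalerA -sgnD wt_cons (addrA (hwt x)).
Qed.

Lemma derivs_nil d F : derivs d [::] F = 0.
Proof. by rewrite /derivs cuts_nil. Qed.

Lemma derivs_cons d x s F :
  derivs d (x :: s) F = F (toh (d _ (tagged x)) :: s) +
    sg (hwt x) *: derivs d s (fun s' => F (x :: s')).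
Proof.
rewrite /derivs cuts_cons /= wt0 sgn0 scale1r; congr (_ + _).
rewrite scale_cuts; apply: eq_cuts => u v _.
rewrite scale_uncons; apply: eq_uncons => y v' _.
by rewrite scalerA -sgnD wt_cons.
Qed.

(** A product has weight one more than the sum of the weights of its factors, so [F] is only
    evaluated at nonempty words of weight [wt s + 1]. This lets signs that depend on the weight of
    the word be treated as constants. *)
Lemma eq_merges s F G :
  (forall s', wt s' = wt s + 1 -> (0 < size s')%N -> F s' = G s') ->
  merges s F = merges s G.
Proof.
move=> e; apply: eq_cuts => u v es; apply: eq_uncons => x v' ev.
apply: eq_uncons => y v'' ev'; rewrite e //; last by rewrite size_cat /= addnS.
by rewrite es ev ev' !wt_cat !wt_cons hwt_hmul; ring.
Qed.

Lemma eq_derivs d s F G :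
  (forall s', wt s' = wt s + 1 -> (0 < size s')%N -> F s' = G s') ->
  derivs d s F = derivs d s G.
Proof.
move=> e; apply: eq_cuts => u v es; apply: eq_uncons => x v' ev.
rewrite e //; last by rewrite size_cat /= addnS.
by rewrite es ev !wt_cat !wt_cons hwt_d; ring.
Qed.

Lemma mergesD s F G : merges s (fun s' => F s' + G s') = merges s F + merges s G.
Proof.
rewrite /merges -cutsD; apply: eq_cuts => u v _; rewrite -unconsD.
apply: eq_uncons => x v' _; rewrite -unconsD; apply: eq_uncons => y w _.
by rewrite scalerDr.
Qed.

Lemma mergesZ s c F : merges s (fun s' => c *: F s') = c *: merges s F.
Proof.
rewrite /merges scale_cuts; apply: eq_cuts => u v _; rewrite scale_uncons.
apply: eq_uncons => x v' _; rewrite scale_uncons; apply: eq_uncons => y w _.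
by rewrite !scalerA mulrC.
Qed.

Lemma derivsD d s F G : derivs d s (fun s' => F s' + G s') = derivs d s F + derivs d s G.
Proof.
rewrite /derivs -cutsD; apply: eq_cuts => u v _; rewrite -unconsD.
by apply: eq_uncons => x v' _; rewrite scalerDr.
Qed.

Lemma derivsZ d s c F : derivs d s (fun s' => c *: F s') = c *: derivs d s F.
Proof.
rewrite /derivs scale_cuts; apply: eq_cuts => u v _; rewrite scale_uncons.
by apply: eq_uncons => x v' _; rewrite !scalerA mulrC.
Qed.

Lemma merges0 s : merges s (fun=> 0) = 0.
Proof.
rewrite -[RHS](scale0r (merges s (fun=> 0))) -mergesZ.
by apply: eq_merges => *; rewrite scale0r.
Qed.

Lemma derivs0 d s : derivs d s (fun=> 0) = 0.
Proof.
rewrite -[RHS](scale0r (derivs d s (fun=> 0))) -derivsZ.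
by apply: eq_derivs => *; rewrite scale0r.
Qed.

(** A pair of neighbours lies to the left of [x], or ends with [x], or lies in [x :: t]. *)
Lemma merges_cat s x t F :
  merges (s ++ x :: t) F =
  merges s (fun s' => F (s' ++ x :: t)) +
  unrcons s (fun s' y => sg (wt s) *: F (s' ++ hmul y x :: t)) +
  sg (wt s) *: merges (x :: t) (fun t' => F (s ++ t')).
Proof.
elim: s F => [|y s IH] F; first by rewrite /= merges_nil wt0 sgn0 scale1r !add0r.
rewrite cat_cons [LHS]merges_cons IH [X in _ = X + _ + _]merges_cons wt_cons sgnD.
rewrite -[X in _ = _ + _ + X]scalerA !scalerDr !addrA; congr (_ + _).
case: s {IH} => [|z s] /=.
  by rewrite !merges_nil wt0 sgn0 mulr1 !scaler0 !addr0 add0r.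
by rewrite scalerA.
Qed.

Lemma merges_rcons s x F :
  merges (rcons s x) F =
  merges s (fun s' => F (rcons s' x)) +
  unrcons s (fun s' y => sg (wt s) *: F (rcons s' (hmul y x))).
Proof.
rewrite -cats1 merges_cat merges_cons /= merges_nil !addr0 !scaler0 addr0.
congr (_ + _); first by apply: eq_merges => *; rewrite cats1.
by apply: eq_unrcons => *; rewrite cats1.
Qed.

Lemma derivs_cat d s x t F :
  derivs d (s ++ x :: t) F =
  derivs d s (fun s' => F (s' ++ x :: t)) +
  sg (wt s) *: derivs d (x :: t) (fun t' => F (s ++ t')).
Proof.
elim: s F => [|y s IH] F; first by rewrite /= derivs_nil wt0 sgn0 scale1r !add0r.
rewrite cat_cons [LHS]derivs_cons IH [X in _ = X + _]derivs_cons wt_cons sgnD.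
by rewrite -scalerA scalerDr addrA.
Qed.

Lemma derivs_rcons d s x F :
  derivs d (rcons s x) F =
  derivs d s (fun s' => F (rcons s' x)) + sg (wt s) *: F (rcons s (toh (d _ (tagged x)))).
Proof.
rewrite -cats1 derivs_cat derivs_cons /= derivs_nil scaler0 addr0 cats1.
by congr (_ + _); apply: eq_derivs => *; rewrite cats1.
Qed.

Lemma merges_uncons s (F : hom R -> seq (hom R) -> M) :
  merges s (fun s' => uncons s' F) =
  uncons s (fun x s' => sg (hwt x) *:
    (uncons s' (fun y s'' => F (hmul x y) s'') + merges s' (F x))).
Proof. by case: s => [|x s]; rewrite ?merges_nil ?merges_cons. Qed.

(** Merging is a coderivation for deconcatenation: after a merge and a cut, the merged letter lies
    in one block, so undoing the merge gives a cut whose border does not separate the pair. *)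
Lemma merges_cuts s (K : seq (hom R) -> seq (hom R) -> M) :
  merges s (fun s' => cuts s' K) =
  cuts s (fun u v => merges u (K^~ v) + sg (wt u) *: merges v (K u)).
Proof.
elim: s K => [|x s IH] K.
  by rewrite cuts_nil !merges_nil wt0 sgn0 scale1r addr0.
rewrite cuts_cons merges_nil add0r wt0 sgn0 scale1r !merges_cons.
have -> : merges s (fun s' => cuts (x :: s') K) =
    merges s (fun s' => K [::] (x :: s')) + merges s (fun s' => cuts s' (fun u => K (x :: u))).
  by rewrite -mergesD; apply: eq_merges => *; rewrite cuts_cons.
have -> : uncons s (fun y s' => cuts (hmul x y :: s') K) =
    uncons s (fun y s' => K [::] (hmul x y :: s')) +
    uncons s (fun y s' => cuts s' (fun u => K (hmul x y :: u))).
  by rewrite -unconsD; apply: eq_uncons => *; rewrite cuts_cons.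
rewrite IH addrACA scalerDr; congr (_ + _).
rewrite -cuts_uncons -cutsD scale_cuts; apply: eq_cuts => u v _.
by rewrite merges_cons !scalerDr addrA scalerA -sgnD wt_cons.
Qed.

(* With [d] a differential of [R], this is the bar differential on the tensor
   coalgebra of [R], up to the global sign of [derivs d]. *)
Definition bar_diff d s F : M := locked (merges s F - derivs d s F).

Lemma bar_diffE d s F : bar_diff d s F = merges s F - derivs d s F.
Proof. by rewrite /bar_diff -lock. Qed.

Lemma eq_bar_diff d s F G :
  (forall s', wt s' = wt s + 1 -> (0 < size s')%N -> F s' = G s') ->
  bar_diff d s F = bar_diff d s G.
Proof. by move=> e; rewrite !bar_diffE (eq_merges e) (eq_derivs _ e). Qed.

Lemma bar_diffD d s F G :
  bar_diff d s (fun s' => F s' + G s') = bar_diff d s F + bar_diff d s G.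
Proof. by rewrite !bar_diffE mergesD derivsD opprD addrACA. Qed.

Lemma bar_diffZ d s c F : bar_diff d s (fun s' => c *: F s') = c *: bar_diff d s F.
Proof. by rewrite !bar_diffE mergesZ derivsZ scalerBr. Qed.

Lemma bar_diff0 d s : bar_diff d s (fun=> 0) = 0.
Proof. by rewrite !bar_diffE merges0 derivs0 subrr. Qed.

Lemma bar_diff_cons d x s F :
  bar_diff d (x :: s) F =
  sg (hwt x) *: uncons s (fun y s' => F (hmul x y :: s')) -
  F (toh (d _ (tagged x)) :: s) + sg (hwt x) *: bar_diff d s (fun s' => F (x :: s')).
Proof.
rewrite !bar_diffE merges_cons derivs_cons scalerDr scalerBr opprD !addrA.
by congr (_ - _); rewrite addrAC.
Qed.

Lemma bar_diff_rcons d s x F :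
  bar_diff d (rcons s x) F =
  bar_diff d s (fun s' => F (rcons s' x)) +
  unrcons s (fun s' y => sg (wt s) *: F (rcons s' (hmul y x))) -
  sg (wt s) *: F (rcons s (toh (d _ (tagged x)))).
Proof.
by rewrite !bar_diffE merges_rcons derivs_rcons opprD !addrA (addrAC _ _ (- derivs _ _ _)).
Qed.

Lemma merges_cuts_comm s (T : Type) (l : seq T) (F : seq (hom R) -> seq T -> seq T -> M) :
  merges s (fun s' => cuts l (F s')) = cuts l (fun q r => merges s (fun s' => F s' q r)).
Proof.
elim: l F => [|x l IH] F.
  by rewrite cuts_nil; apply: eq_merges => s' _ _; rewrite cuts_nil.
rewrite cuts_cons -IH -mergesD.
by apply: eq_merges => s' _ _; rewrite cuts_cons.
Qed.

Lemma bar_diff_cuts d s (T : Type) (t : seq T) (F : seq (hom R) -> seq T -> seq T -> M) :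
  bar_diff d s (fun s' => cuts t (F s')) = cuts t (fun q r => bar_diff d s (fun s' => F s' q r)).
Proof.
elim: t F => [|x t IH] F.
  by rewrite cuts_nil; apply: eq_bar_diff => s' _ _; rewrite cuts_nil.
rewrite cuts_cons -IH -bar_diffD.
by apply: eq_bar_diff => s' _ _; rewrite cuts_cons.
Qed.

Lemma bar_diff_uncons d s (T : Type) (t : seq T) (F : seq (hom R) -> T -> seq T -> M) :
  bar_diff d s (fun s' => uncons t (F s')) = uncons t (fun x r => bar_diff d s (fun s' => F s' x r)).
Proof. by case: t => [|x t] //=; rewrite bar_diff0. Qed.

End Merges.

(** * Identities in abelian groups by reflection *)

Inductive zmod_expr := ZVar of nat | ZZero | ZAdd of zmod_expr & zmod_expr | ZOpp of zmod_expr.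

Fixpoint zmod_coef (e : zmod_expr) (i : nat) : int :=
  match e with
  | ZVar j => (i == j)%:Z
  | ZZero => 0
  | ZAdd e1 e2 => zmod_coef e1 i + zmod_coef e2 i
  | ZOpp e1 => - zmod_coef e1 i
  end.

Section ZmodExpr.
Variables (V : zmodType) (env : seq V).

Fixpoint zmod_eval (e : zmod_expr) : V :=
  match e with
  | ZVar j => env`_j
  | ZZero => 0
  | ZAdd e1 e2 => zmod_eval e1 + zmod_eval e2
  | ZOpp e1 => - zmod_eval e1
  end.

Lemma zmod_evalE e : zmod_eval e = \sum_(i < size env) env`_i *~ zmod_coef e i.
Proof.
elim: e => [j||e1 IH1 e2 IH2|e1 IH1] /=; rewrite ?IH1 ?IH2.
- have [lt_j|le_j] := ltnP j (size env).
    rewrite (bigD1 (Ordinal lt_j)) //= eqxx mulr1z big1 ?addr0 // => i.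
    by rewrite -val_eqE /= => /negbTE ->; rewrite mulr0z.
  rewrite nth_default // big1 // => i _.
  by rewrite ltn_eqF ?mulr0z // (leq_trans (ltn_ord i)).
- by rewrite big1 // => i _; rewrite mulr0z.
- by rewrite -big_split; apply: eq_bigr => i _; rewrite mulrzDr.
by rewrite -sumrN; apply: eq_bigr => i _; rewrite mulrNz.
Qed.

(** An expression is determined by its integer coefficients at the atoms, and their equality is
    decided by computation. *)
Lemma zmod_eval_eq e1 e2 :
  all (fun i => zmod_coef e1 i == zmod_coef e2 i) (iota 0 (size env)) ->
  zmod_eval e1 = zmod_eval e2.
Proof.
move/allP => e; rewrite !zmod_evalE; apply: eq_bigr => i _.
by congr (_ *~ _); apply/eqP/e; rewrite mem_iota add0n ltn_ord.
Qed.
End ZmodExpr.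

Ltac zmod_index x env :=
  match env with
  | x :: _ => constr:(O)
  | _ :: ?env' => let n := zmod_index x env' in constr:(S n)
  end.
Ltac zmod_atoms t env :=
  match t with
  | ?a + ?b => let env' := zmod_atoms a env in zmod_atoms b env'
  | - ?a => zmod_atoms a env
  | 0 => env
  | _ => match env with
         | _ => let n := zmod_index t env in env
         | _ => constr:(t :: env)
         end
  end.
Ltac zmod_quote t env :=
  match t with
  | ?a + ?b => let x := zmod_quote a env in let y := zmod_quote b env in
               constr:(ZAdd x y)
  | - ?a => let x := zmod_quote a env in constr:(ZOpp x)
  | 0 => constr:(ZZero)
  | _ => let n := zmod_index t env in constr:(ZVar n)
  end.
(** Everything except sums, opposites and 0 is an atom; in particular scaled terms are opaque, so
    signs have to be brought to a common form beforehand. *)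
Ltac zmod :=
  cbv beta;
  match goal with |- ?a = ?b :> ?V =>
    let env := zmod_atoms a (@nil V) in
    let env := zmod_atoms b env in
    let x := zmod_quote a env in
    let y := zmod_quote b env in
    exact: (@zmod_eval_eq _ env x y isT)
  end.

(** * Values of cup products and of Hochschild differentials *)

Section HomLinear.
Variables (k : comPzRingType) (A : gradedAlg k) (M : lmodType k).
Local Notation sg e := (sgn k e).
Local Notation homA := (hom (components A)).
Local Notation homE := (hom (cochains A)).
Implicit Types (phi : homA -> M) (D E : homE).

Definition hom_linear phi : Prop :=
  forall i c (x y : components A i), phi (toh (c *: x + y)) = c *: phi (toh x) + phi (toh y).

(* [phi] is only defined on homogeneous elements together with their degree;
   this is the graph of its restriction to the component of degree [n], as a
   relation on [A], so that values at sums can be computed in [A]. *)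
Definition extends phi (n : int) (a : A) (m : M) : Prop :=
  exists y : components A n, cval y = a /\ phi (toh y) = m.

Section Extends.
Variables (phi : homA -> M) (phiL : hom_linear phi) (n : int).

Lemma extends_hom h : extends phi (hdeg h) (hval h) (phi h).
Proof. by case: h => i y; exists y. Qed.

Lemma extends_fun h m : extends phi (hdeg h) (hval h) m -> phi h = m.
Proof. by case: h => i y [z [/val_inj/= <- <-]]. Qed.

Lemma hom_linear0 : phi (toh (0 : components A n)) = 0.
Proof.
have := phiL (-1) (0 : components A n) 0.
by rewrite scaler0 addr0 scaleN1r addNr.
Qed.

Lemma extends0 : extends phi n 0 0.
Proof. by exists 0; split=> //; exact: hom_linear0. Qed.

Lemma extendsD a b m p :
  extends phi n a m -> extends phi n b p -> extends phi n (a + b) (m + p).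
Proof.
case=> y [<- <-] [z [<- <-]]; exists (y + z); split=> //.
by have := phiL 1 y z; rewrite !scale1r.
Qed.

Lemma extendsZ c a m : extends phi n a m -> extends phi n (c *: a) (c *: m).
Proof.
case=> y [<- <-]; exists (c *: y); split=> //.
by have := phiL c y 0; rewrite hom_linear0 !addr0.
Qed.

Lemma extends_cuts (T : Type) (s : seq T) F G :
  (forall u v, s = u ++ v -> extends phi n (F u v) (G u v)) ->
  extends phi n (cuts s F) (cuts s G).
Proof.
elim: s F G => [|x s IH] F G e; first by rewrite !cuts_nil; apply: e.
rewrite !cuts_cons; apply: extendsD; first exact: e.
by apply: IH => u v es; apply: e; rewrite es.
Qed.

Lemma extends_uncons (T : Type) (s : seq T) F G :
  (forall x s', s = x :: s' -> extends phi n (F x s') (G x s')) ->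
  extends phi n (uncons s F) (uncons s G).
Proof. by case: s => [|x s] e; [exact: extends0 | exact: e]. Qed.

Lemma extends_unrcons (T : Type) (s : seq T) F G :
  (forall s' x, s = rcons s' x -> extends phi n (F s' x) (G s' x)) ->
  extends phi n (unrcons s F) (unrcons s G).
Proof.
by case/lastP: s => [|s x] e; [exact: extends0 | rewrite !unrcons_rcons; exact: e].
Qed.

Lemma extends_eq h a : hdeg h = n -> hval h = a -> extends phi n a (phi h).
Proof. by move=> <- <-; exact: extends_hom. Qed.

End Extends.

Lemma hdeg_heval D s : hdeg (heval D s) = wt s + hdeg D.
Proof. by []. Qed.
Lemma hwt_heval D s : hwt (heval D s) = wt s + hwt D.
Proof. by rewrite /hwt hdeg_heval addrA. Qed.
Lemma hdeg_hmul (R : gralg k) (x y : hom R) : hdeg (hmul x y) = hdeg x + hdeg y.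
Proof. by []. Qed.

(** In [A] this is the definition of the cup product. The degrees of the summands equal that of the
    left side only propositionally, so the identity is carried to [M] through [extends]. *)
Lemma heval_cup phi D E s : hom_linear phi ->
  phi (heval (hmul D E) s) =
  cuts s (fun u v => sg (hdeg E * wt u) *: phi (hmul (heval D u) (heval E v))).
Proof.
move=> phiL; apply: extends_fun.
change (hval (heval (hmul D E) s)) with
  (cuts s (fun u v => sg (hdeg E * wt u) *: (cfun (tagged D) u * cfun (tagged E) v))).
apply: extends_cuts => // u v ->; apply: extendsZ => //; apply: extends_eq => //.
by rewrite !hdeg_hmul !hdeg_heval hdeg_hmul wt_cat; ring.
Qed.

Definition hdelta D : homE := toh (delta (tagged D) : cochains A (tag D + 1)).

Lemma hwt_hdelta D : hwt (hdelta D) = hwt D + 1.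
Proof. exact: (hwt_d (R := cochains A) (@delta k A)). Qed.

(** These are the three kinds of summands of the Hochschild differential. With [hwt D] in place of
    [n - 1], the constant 1 in the exponents of the two outer ones turns into a minus sign. *)
Lemma heval_delta phi D s : hom_linear phi ->
  phi (heval (hdelta D) s) =
  - uncons s (fun x s' => sg (hwt x * hwt D + hwt x) *: phi (hmul x (heval D s')))
  + sg (hwt D) *: merges s (fun s' => phi (heval D s'))
  - unrcons s (fun s' x => sg (hwt D + wt s') *: phi (hmul (heval D s') x)).
Proof.
move=> phiL; apply: extends_fun.
have -> : hdeg (heval (hdelta D) s) = wt s + hdeg D + 1.
  by rewrite hdeg_heval hdegE hwt_hdelta hdegE; ring.
have -> : hval (heval (hdelta D) s) =
  - uncons s (fun x s' => sg (hwt x * hwt D + hwt x) *: (hval x * cfun (tagged D) s'))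
  + sg (hwt D) *: merges s (fun s' => cfun (tagged D) s')
  - unrcons s (fun s' x => sg (hwt D + wt s') *: (cfun (tagged D) s' * hval x)).
  change (hval (heval (hdelta D) s)) with
    (delta_left (tagged D) s + delta_inner (tagged D) s + delta_right (tagged D) s).
  congr (_ + _ + _).
  - rewrite unconsN; case: s => //= x s; rewrite -scaleNr; congr (_ *: _).
    by apply: sgn_parN; rewrite -[hwt D]/(tag D - 1) !parE; parity.
  - rewrite scale_cuts; apply: eq_bigr => -[u [|x [|y v]]] _ /=; rewrite ?scaler0 //.
    rewrite wt_rcons scalerA -sgnD; congr (sg _ *: _).
  rewrite unrconsN; case: s => //= x s; rewrite -scaleNr; congr (_ *: _).
  by apply: sgn_parN; rewrite -[hwt D]/(tag D - 1) !parE; parity.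
have opp n a m : extends phi n a m -> extends phi n (- a) (- m).
  by rewrite -!scaleN1r; apply: extendsZ.
apply: extendsD => //; [apply: extendsD => // |].
- apply/opp/extends_uncons => // x s' ->; apply: extendsZ => //.
  apply: extends_eq => //; rewrite hdeg_hmul hdeg_heval wt_cons /hwt; ring.
- apply: extendsZ => //; apply: extends_cuts => // u v es.
  apply: extends_uncons => // x v' ev; apply: extends_uncons => // y w ew.
  apply: extendsZ => //; apply: extends_eq => //.
  by rewrite hdeg_heval es ev ew !wt_cat !wt_cons hwt_hmul; ring.
apply/opp/extends_unrcons => // s' x ->; apply: extendsZ => //.
apply: extends_eq => //; rewrite hdeg_hmul hdeg_heval wt_rcons /hwt; ring.
Qed.

End HomLinear.

(** * Insertions commute with the bar differentials *)

Section InsertionSteps.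
Variables (k : comPzRingType) (A : gradedAlg k) (M : lmodType k).
Local Notation sg e := (sgn k e).
Local Notation homA := (hom (components A)).
Local Notation homE := (hom (cochains A)).
Implicit Types (s t : seq homA) (Ds : seq homE) (g : seq homA -> M) (G : homA -> seq homA -> M).

Lemma insD Ds s g1 g2 :
  insertions Ds s (fun t => g1 t + g2 t) = insertions Ds s g1 + insertions Ds s g2.
Proof.
rewrite -[X in X + _]scale1r -insertions_lin.
by apply: insertions_ext => t; rewrite scale1r.
Qed.

Lemma insZ Ds s c g : insertions Ds s (fun t => c *: g t) = c *: insertions Ds s g.
Proof.
rewrite -[RHS]addr0 -(@insertions_zero k A M Ds s (fun=> 0)) // -insertions_lin.
by apply: insertions_ext => t; rewrite addr0.
Qed.

Lemma insE D Ds s g :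
  insertions (D :: Ds) s g = cuts s (fun p v => cuts v (fun q r =>
    sg (hwt D * wt v) *: insertions Ds r (fun t => g (p ++ heval D q :: t)))).
Proof. by []. Qed.

(** Either the first letter of [s] stays in front of the block of [D], or that block starts at the
    beginning of [s]. *)
Lemma ins_cons D Ds s g :
  insertions (D :: Ds) s g =
  uncons s (fun x s' => insertions (D :: Ds) s' (fun t => g (x :: t))) +
  sg (hwt D * wt s) *: cuts s (fun q r => insertions Ds r (fun t => g (heval D q :: t))).
Proof.
rewrite insE scale_cuts; case: s => [|x s]; first by rewrite !cuts_nil add0r.
by rewrite cuts_cons addrC.
Qed.

(* The value of the first cochain, on a prefix of [s], is passed to [G] separately. *)
Definition insert_first (Z : seq homE) s G : M :=
  uncons Z (fun D Ds =>
    sg (hwt D * wt s) *: cuts s (fun q r => insertions Ds r (G (heval D q)))).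

Lemma ins_uncons Ds s G :
  insertions Ds s (fun t => uncons t G) =
  uncons s (fun x s' => insertions Ds s' (G x)) + insert_first Ds s G.
Proof. by case: Ds => [|D Ds]; [rewrite addr0 | rewrite ins_cons]. Qed.

(** A block is replaced by a letter whose weight is that of the block plus [hwt D]. Hence all
    resulting words have the same weight, and signs depending on it leave the sum. *)
Lemma ins_wt Ds s (G : int -> seq homA -> M) :
  insertions Ds s (fun t => G (wt t) t) = insertions Ds s (G (wt s + wt Ds)).
Proof.
elim: Ds s G => [|D Ds IH] s G; first by rewrite /= wt0 addr0.
rewrite !insE; apply: eq_cuts => u w es; apply: eq_cuts => q r ew; congr (_ *: _).
pose H e t := G (wt u + hwt (heval D q) + e) (u ++ heval D q :: t).
transitivity (insertions Ds r (fun t => H (wt t) t)).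
  by apply: insertions_ext => t; rewrite /H wt_cat wt_cons addrA.
rewrite IH /H hwt_heval wt_cons es ew !wt_cat; apply: insertions_ext => t.
by congr (G _ _); ring.
Qed.

Lemma unrcons_cons s x (G : seq homA -> homA -> M) :
  unrcons (x :: s) G = unrcons s (fun s' => G (x :: s')) + unnil s (G [::] x).
Proof. by case: s => [|y s] /=; rewrite ?add0r ?addr0. Qed.

Lemma unrcons_cat p s x (G : seq homA -> homA -> M) :
  unrcons (p ++ x :: s) G = unrcons s (fun s' => G (p ++ x :: s')) + unnil s (G p x).
Proof.
elim: p G => [|y p IH] G; first exact: unrcons_cons.
by rewrite cat_cons unrcons_cons IH; case: p {IH} => [|z p]; rewrite /= addr0.
Qed.

Lemma ins_unnil Ds s (m : M) :
  insertions Ds s (fun t => unnil t m) = unnil Ds (unnil s m).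
Proof.
case: Ds => [|D Ds] //=.
rewrite big1 // => p _; rewrite big1 // => q _; rewrite insertions_zero ?scaler0 // => t.
by case: p.1.
Qed.

(** The last letter of the result is the last letter of [s] or the value of the last cochain, whose
    block then ends [s]. The sign appears because each cochain is counted against everything from
    its block on, including what is removed at the end. *)
Lemma ins_unrcons Ds s (G : seq homA -> homA -> M) :
  insertions Ds s (fun t => unrcons t G) =
  unrcons s (fun s' x => sg (wt Ds * hwt x) *: insertions Ds s' (G^~ x)) +
  unrcons Ds (fun Ds' D => cuts s (fun r q =>
    sg (wt Ds * wt q) *: insertions Ds' r (G^~ (heval D q)))).
Proof.
elim: Ds s G => [|D Ds IH] s G.
  rewrite /= addr0; apply: eq_unrcons => s' x _.
  by rewrite wt0 mul0r sgn0 scale1r.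
rewrite insE.
pose G1 p q := fun t x => G (p ++ heval D q :: t) x.
(* Behind the value of [D], the last letter comes from [r] or from the last cochain of [Ds]; in the
   third sum it is the value of [D] itself, which forces [r] and [Ds] to be empty. *)
transitivity (cuts s (fun p v => cuts v (fun q r => sg (hwt D * wt v) *:
   unrcons r (fun r' x => sg (wt Ds * hwt x) *: insertions Ds r' ((G1 p q)^~ x)))) +
  cuts s (fun p v => cuts v (fun q r => sg (hwt D * wt v) *:
   unrcons Ds (fun Ds' D' => cuts r (fun r' q' =>
    sg (wt Ds * wt q') *: insertions Ds' r' ((G1 p q)^~ (heval D' q')))))) +
  cuts s (fun p v => cuts v (fun q r => unnil r (sg (hwt D * wt v) *:
     unnil Ds (G p (heval D q)))))).
  rewrite -!cutsD; apply: eq_cuts => p v _; rewrite -!cutsD; apply: eq_cuts => q r _.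
  rewrite -scalerDr -(IH r (G1 p q)).
  have -> : insertions Ds r (fun t => unrcons (p ++ heval D q :: t) G) =
    insertions Ds r (fun t => unrcons t (G1 p q) + unnil t (G p (heval D q))).
    by apply: insertions_ext => t; rewrite unrcons_cat.
  rewrite insD ins_unnil scalerDr; congr (_ + _).
  by case: r Ds {IH} => [|? ?] [|? ?]; rewrite //= scaler0.
rewrite -addrA; congr (_ + _).
  transitivity (unrcons s (fun s' x => cuts s' (fun p v => cuts v (fun q r =>
      sg (wt (D :: Ds) * hwt x + hwt D * wt v) *: insertions Ds r ((G1 p q)^~ x))))).
    rewrite -(cuts_unrcons_r s (fun p v x => cuts v (fun q r =>
      sg (wt (D :: Ds) * hwt x + hwt D * wt v) *: insertions Ds r ((G1 p q)^~ x)))).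
    apply: eq_cuts => p v _.
    pose K q r x :=
      sg (wt (D :: Ds) * hwt x + hwt D * wt (q ++ r)) *: insertions Ds r ((G1 p q)^~ x).
    transitivity (cuts v (fun q r => unrcons r (K q))); last first.
      rewrite cuts_unrcons_r; apply: eq_unrcons => v' x _.
      by apply: eq_cuts => q r ->.
    apply: eq_cuts => q r ->; rewrite scale_unrcons; apply: eq_unrcons => r' x ->.
    rewrite scalerA -sgnD; congr (_ *: _); apply: sgn_par.
    by rewrite !wt_cons !wt_cat wt_rcons !parE; parity.
  apply: eq_unrcons => s' x _; rewrite insE scale_cuts; apply: eq_cuts => p v _.
  by rewrite scale_cuts; apply: eq_cuts => q r _; rewrite scalerA -sgnD.
case/lastP: Ds IH => [|Ds D'] IH.
  rewrite /= [X in X + _]big1 ?add0r; last first.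
    by move=> p _; rewrite /cuts big1 // => *; rewrite scaler0.
  apply: eq_cuts => p v _.
  by rewrite (cuts_unnil_r v (fun q => sg (hwt D * wt v) *: G p (heval D q))) wt_cons wt0 addr0.
rewrite -rcons_cons !unrcons_rcons.
rewrite [X in _ + X = _]big1 ?addr0; last first.
  move=> p _; rewrite /cuts big1 // => q _.
  by case: (q.2) => //; case: (Ds) => *; rewrite scaler0.
pose F p q r q' := sg (wt (rcons (D :: Ds) D') * wt q' + hwt D * wt (q ++ r)) *:
     insertions Ds r ((G1 p q)^~ (heval D' q')).
transitivity (cuts s (fun p w => cuts w (fun q v => cuts v (F p q)))).
  apply: eq_cuts => p w _; apply: eq_cuts => q v ew; rewrite unrcons_rcons scale_cuts.
  apply: eq_cuts => r q' ev; rewrite ew ev scalerA -sgnD /F; congr (_ *: _).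
  by apply: sgn_par; rewrite wt_cons !wt_rcons !wt_cat !parE; parity.
transitivity (cuts s (fun p w => cuts w (fun v q' => cuts v (fun q r => F p q r q')))).
  by apply: eq_cuts => p w _; rewrite (cutsA w (F p)).
rewrite -(cutsA s (fun p v q' => cuts v (fun q r => F p q r q'))).
apply: eq_cuts => v q' _; rewrite insE scale_cuts; apply: eq_cuts => p w _.
rewrite scale_cuts; apply: eq_cuts => q r ->.
by rewrite scalerA -sgnD.
Qed.

Local Notation bdE := (bar_diff (R := cochains A) (@delta k A)).

Lemma hom_linear_ins Ds s G : (forall t, hom_linear (G^~ t)) ->
  hom_linear (fun h => insertions Ds s (G h)).
Proof.
move=> GL i c x y; rewrite -insertions_lin; apply: insertions_ext => t.
exact: GL.
Qed.

Section Step.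
Variable Ds : seq homE.
Hypothesis ins_merges : forall s g, multilinear g ->
  insertions Ds s (fun t => merges t g) =
  merges s (fun s' => insertions Ds s' g) +
  sg (wt s) *: bdE Ds (fun Z => insertions Z s g).

(** The summands in which the value of [D] heads the inserted word. Its product with the next letter
    belongs to [hdelta D], its product with the value of the next cochain is a cup product, and the
    remaining summands of [hdelta D] are compensated by merges inside the block and by products with
    a letter in front of it. *)
Lemma insert_first_diff D s G :
  (forall t, hom_linear (G^~ t)) -> (forall h, multilinear (G h)) ->
  cuts s (fun q r => sg (hwt D * wt s + hwt D + wt q) *: insertions Ds r
    (fun t => uncons t (fun z => G (hmul (heval D q) z)) + merges t (G (heval D q)))) =
  merges s (fun s' => insert_first (D :: Ds) s' G) +
  sg (wt s) *: bdE (D :: Ds) (fun Z => insert_first Z s G) -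
  uncons s (fun x s' => sg (hwt x) *: insert_first (D :: Ds) s' (fun h => G (hmul x h))).
Proof.
move=> GL GM.
have IL Z r : hom_linear (fun h => insertions Z r (G h)) by exact: hom_linear_ins.
pose c := hwt D * wt s + hwt D; pose K q r : M := insertions Ds r (G (heval D q)).
(* [E1] and [E2] multiply the value of [D] by a letter and by the value of the next cochain; [E3]
   and [E5] merge behind the block and inside it; [E4] differentiates [Ds]; [E6] multiplies by a
   letter from the left. [E5] and [E6] cancel on the right-hand side. *)
pose E1 := cuts s (fun q r => uncons r (fun z r' =>
  sg (c + wt q) *: insertions Ds r' (G (hmul (heval D q) z)))).
pose E2 := cuts s (fun q r =>
  sg (c + wt q) *: insert_first Ds r (fun z => G (hmul (heval D q) z))).
pose E3 := cuts s (fun q r => sg (c + wt q) *: merges r (K q)).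
pose E4 := cuts s (fun q r =>
  sg (c + wt s) *: bdE Ds (fun Z => insertions Z r (G (heval D q)))).
pose E5 := cuts s (fun q r => sg c *: merges q (K^~ r)).
set E6 := uncons s _.
transitivity (E1 + E2 + E3 + E4).
  rewrite /E1 /E2 /E3 /E4 -!cutsD; apply: eq_cuts => q r es.
  rewrite insD ins_uncons ins_merges // 3!scalerDr scale_uncons.
  rewrite [X in _ + (_ + X)]scalerA -sgnD -/c.
  have -> : sg (c + wt q + wt r) = sg (c + wt s) by rewrite es wt_cat; congr (sg _); ring.
  rewrite /K;  zmod.
have -> : merges s (fun s' => insert_first (D :: Ds) s' G) = E5 + E3.
  transitivity (merges s (fun s' => sg c *: cuts s' K)).
    apply: eq_merges => s' ws' _; congr (_ *: _); apply: sgn_par.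
    by rewrite ws' /c !parE; parity.
  rewrite mergesZ merges_cuts scale_cuts /E5 /E3 -cutsD; apply: eq_cuts => q r _.
  by rewrite scalerDr scalerA -sgnD.
rewrite bar_diff_cons -/(hdelta D) scalerDr scalerBr.
have -> : sg (wt s) *: (sg (hwt D) *:
    uncons Ds (fun D1 Ds' => insert_first (hmul D D1 :: Ds') s G)) = E2.
  rewrite /E2 !scale_uncons; case: Ds => [|D1 Ds'] /=.
    by rewrite /cuts big1 // => *; rewrite scaler0.
  transitivity (sg (wt s + hwt D + (hwt D + hwt D1 + 1) * wt s) *:
    cuts s (fun q r => cuts q (fun q1 q2 => sg ((hwt D1 + 1) * wt q1) *:
       insertions Ds' r (G (hmul (heval D q1) (heval D1 q2)))))).
    rewrite !scalerA -!sgnD hwt_hmul addrA; congr (_ *: _); apply: eq_cuts => q r _.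
    rewrite (heval_cup D D1 q (phi := fun h => insertions Ds' r (G h))) //.
    by rewrite hdegE.
  rewrite (cutsA s (fun q1 q2 r => sg ((hwt D1 + 1) * wt q1) *:
       insertions Ds' r (G (hmul (heval D q1) (heval D1 q2))))) scale_cuts.
  apply: eq_cuts => q1 r1 es; rewrite scalerA -sgnD !scale_cuts.
  apply: eq_cuts => q2 r2 er1; rewrite scalerA -sgnD; congr (_ *: _).
  by apply: sgn_par; rewrite /c es er1 !wt_cat !parE; parity.
have -> : sg (wt s) *: (sg (hwt D) *:
    bdE Ds (fun Z => insert_first (D :: Z) s G)) = E4.
  rewrite /= bar_diffZ bar_diff_cuts !scalerA -!sgnD scale_cuts; apply: eq_cuts => q r _.
  by congr (sg _ *: _); rewrite /c; ring.
have -> : sg (wt s) *: insert_first (hdelta D :: Ds) s G = - E6 + E5 - E1.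
  rewrite /= scalerA -sgnD hwt_hdelta /E5 /E6 /E1.
  (* The letter following the block of [D] in [E1] is counted as the last argument of [hdelta D]. *)
  rewrite -(cuts_unrcons s (fun q z r =>
    sg (c + wt q) *: insertions Ds r (G (hmul (heval D q) z)))).
  transitivity (- cuts s (fun q r => uncons q (fun x q' =>
     sg (hwt x + hwt D * (wt s - hwt x)) *: insertions Ds r (G (hmul x (heval D q'))))) +
    cuts s (fun q r => sg c *: merges q (K^~ r)) -
    cuts s (fun q r => unrcons q (fun q' z =>
     sg (c + wt q') *: insertions Ds r (G (hmul (heval D q') z))))).
    rewrite !cutsN scale_cuts -!cutsD; apply: eq_cuts => q r es.
    rewrite (heval_delta D q (phi := fun h => insertions Ds r (G h))) //.
    rewrite !scalerDr !scalerN scale_uncons scale_unrcons; congr (- _ + _ - _).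
    - apply: eq_uncons => x q' _; rewrite scalerA -sgnD; congr (_ *: _).
      by apply: sgn_par; rewrite !parE; parity.
    - rewrite scalerA -sgnD; congr (_ *: _); apply: sgn_par; rewrite !parE; parity.
    apply: eq_unrcons => q' z _; rewrite scalerA -sgnD; congr (_ *: _).
    by apply: sgn_par; rewrite /c !parE; parity.
  congr (- _ + _ - _).
  rewrite (cuts_uncons s (fun x q' r =>
    sg (hwt x + hwt D * (wt s - hwt x)) *: insertions Ds r (G (hmul x (heval D q'))))).
  apply: eq_uncons => x s' es; rewrite /= scalerA -sgnD scale_cuts.
  by apply: eq_cuts => q r _; congr (sg _ *: _); rewrite es wt_cons; ring.
zmod.
Qed.

End Step.

(** Double induction. If a letter of [s] stays in front, the word behind it is shorter; if the value
    of the first cochain is in front, [insert_first_diff] reduces to fewer cochains. *)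
Lemma ins_merges Ds s g : multilinear g ->
  insertions Ds s (fun t => merges t g) =
  merges s (fun s' => insertions Ds s' g) +
  sg (wt s) *: bdE Ds (fun Z => insertions Z s g).
Proof.
elim: Ds s g => [|D Ds IHD] s g gM.
  by rewrite bar_diffE merges_nil derivs_nil subrr scaler0 addr0.
have [n] := ubnP (size s); elim: n s g gM => // n IHs s g gM lt_n.
pose G h t := g (h :: t).
have GL t : hom_linear (G^~ t) by move=> i c x y; exact: (gM [::]).
have GM h : multilinear (G h) by exact: (multilinear_cons [:: h]).
have insG Z s' : (0 < size Z)%N ->
    insertions Z s' g =
    uncons s' (fun x s'' => insertions Z s'' (G x)) + insert_first Z s' G.
  by case: Z => // D' Z _; rewrite ins_cons.
have mergesG x t : merges (x :: t) g =
    sg (hwt x) *: (uncons t (fun y => G (hmul x y)) + merges t (G x)).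
  exact: merges_cons.
have -> : merges s (fun s' => insertions (D :: Ds) s' g) =
    merges s (fun s' => uncons s' (fun x s'' => insertions (D :: Ds) s'' (G x))) +
    merges s (fun s' => insert_first (D :: Ds) s' G).
  by rewrite -mergesD; apply: eq_merges => s' _ _; rewrite insG.
have -> : bdE (D :: Ds) (fun Z => insertions Z s g) =
    uncons s (fun x s' => bdE (D :: Ds) (fun Z => insertions Z s' (G x))) +
    bdE (D :: Ds) (fun Z => insert_first Z s G).
  by rewrite -bar_diff_uncons -bar_diffD; apply: eq_bar_diff => Z _ /insG.
rewrite ins_cons.
have -> : sg (hwt D * wt s) *: cuts s (fun q r =>
      insertions Ds r (fun t => merges (heval D q :: t) g)) =
    cuts s (fun q r => sg (hwt D * wt s + hwt D + wt q) *: insertions Ds r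
      (fun t => uncons t (fun z => G (hmul (heval D q) z)) + merges t (G (heval D q)))).
  rewrite scale_cuts; apply: eq_cuts => q r _.
  rewrite (insertions_ext _ _ (mergesG _)) insZ scalerA -sgnD hwt_heval.
  by congr (sg _ *: _); ring.
rewrite (insert_first_diff (IHD)) // merges_uncons.
set E1 := merges s _; set E2 := bdE _ _.
have -> : uncons s (fun x s' => insertions (D :: Ds) s' (fun t => merges (x :: t) g)) =
    uncons s (fun x s' => sg (hwt x) *: (uncons s' (fun y s'' =>
       insertions (D :: Ds) s'' (G (hmul x y))) + merges s' (fun s'' =>
       insertions (D :: Ds) s'' (G x)))) +
    uncons s (fun x s' => sg (hwt x) *: insert_first (D :: Ds) s' (fun h => G (hmul x h))) +
    sg (wt s) *: uncons s (fun x s' => bdE (D :: Ds) (fun Z => insertions Z s' (G x))).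
  rewrite scale_uncons -!unconsD.
  apply: eq_uncons => x s' es; rewrite (insertions_ext _ _ (mergesG _)) insZ insD.
  rewrite ins_uncons (IHs s' (G x)) //; last by rewrite es in lt_n.
  rewrite es wt_cons (sgnD k (hwt x)) -[in RHS]scalerA -!scalerDr.
  congr (_ *: _); zmod.
have unconsZ0 : uncons s (fun x s' => sg (hwt x) *: (uncons s' (fun y s'' =>
    insertions (D :: Ds) s'' (G (hmul x y))) + merges s' (fun s'' =>
    insertions (D :: Ds) s'' (G x)))) = merges s (fun s' => uncons s' (fun x s'' =>
    insertions (D :: Ds) s'' (G x))) by rewrite merges_uncons.
rewrite [X in _ = _ + X]scalerDr; zmod.
Qed.

End InsertionSteps.

(** * The Hochschild boundary as merges and a rotation *)

HB.instance Definition _ (k : comPzRingType) (R : gralg k) :=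
  GRing.isLinear.Build k (chains R) (chains R) _ (@b k R) (@b_linear k R).

Section Boundary.
Variables (k : comPzRingType) (R : gralg k).
Local Notation sg e := (sgn k e).

(** The cyclic summand of [b], in the same continuation form as [merges]. *)
Definition rotate (M : lmodType k) (w : seq (hom R)) (F : seq (hom R) -> M) : M :=
  uncons w (fun a0 s => unrcons s (fun s' x =>
    sg ((hwt x + 1) * (wt (a0 :: s') + 1) + wt (a0 :: s')) *: F (hmul x a0 :: s'))).

Lemma b_genE (w : seq (hom R)) : b_gen w = - merges w chain + rotate w chain.
Proof.
congr (_ + _).
rewrite /merges cutsN; apply: eq_bigr => -[u [|x [|y v]]] _ /=; rewrite ?oppr0 //.
rewrite -scaleNr; congr (_ *: _); apply: sgn_parN.
by rewrite wt_rcons !parE; parity.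
Qed.

Lemma eq_rotate (M : lmodType k) (s : seq (hom R)) (F G : seq (hom R) -> M) :
  (forall s', (0 < size s')%N -> F s' = G s') -> rotate s F = rotate s G.
Proof.
move=> e; apply: eq_uncons => x v _; apply: eq_unrcons => v' y _.
by rewrite e.
Qed.

Lemma d_genE (d : forall i, R i -> R (i + 1)) (s : seq (hom R)) : d_gen d s = derivs d s chain.
Proof. by apply: eq_bigr => -[u [|x v]]. Qed.

(** With [n] the size of [s], the [n + 1] letters and the shift by [n] give the degree
    [wt (a :: s) + 2 * n + 1]. *)
Lemma sgn_chain_deg (a : hom R) s : sgn k (chain_deg (a :: s)) = - sgn k (hwt a + wt s).
Proof.
apply: sgn_parN; rewrite -wt_cons.
have -> : chain_deg (a :: s) = wt (a :: s) + 1 + 2 * (size s)%:Z.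
  rewrite /chain_deg /wt (eq_bigr (fun x => hwt x + 1)); last by move=> x _; rewrite hdegE.
  rewrite big_split /= big_const_seq count_predT iter_addr_0 /= mulrSr natz; ring.
by rewrite !parE; parity.
Qed.

End Boundary.

(** * The boundary of the first pairing *)

Section HeadPairing.
Variables (k : comPzRingType) (A : gradedAlg k).
Local Notation sg e := (sgn k e).
Local Notation CA := (chains (components A)).
Local Notation homA := (hom (components A)).
Local Notation homE := (hom (cochains A)).
Local Notation bdE := (bar_diff (R := cochains A) (@delta k A)).
Implicit Types (s t u v r q w : seq homA) (Z : seq homE) (x y : homA).

Lemma linear_ins (M N : lmodType k) (f : {linear M -> N}) Z s (g : seq homA -> M) :
  f (insertions Z s g) = insertions Z s (fun t => f (g t)).
Proof.
elim: Z s g => [|D Z IH] s g //; rewrite !insE raddf_cuts.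
apply: eq_cuts => p v _; rewrite raddf_cuts /=; apply: eq_cuts => q r _ /=.
by rewrite linearZ_LR IH.
Qed.

Lemma bZ c (z : CA) : b (c *: z) = c *: b z.
Proof. exact: linearZ. Qed.

Lemma b_cuts (T : Type) (l : seq T) F : b (cuts l F) = cuts l (fun c d => b (F c d)) :> CA.
Proof. exact: raddf_cuts. Qed.

Lemma b_ins Z s (g : seq homA -> CA) : b (insertions Z s g) = insertions Z s (fun t => b (g t)).
Proof. exact: linear_ins. Qed.

(** This is [pair1_gen] rewritten with [insert_first]: since deg D_0 = |D_0| + 1, the factor
    [sg (wt v)] completes the sign of [insert_first]. *)
Definition head_pair w Z : CA :=
  uncons w (fun y v => sg (wt v) *: insert_first Z v (fun h t => chain (hmul y h :: t))).

Lemma head_pair_cons y v D Ds :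
  head_pair (y :: v) (D :: Ds) =
  sg (wt v + hwt D * wt v) *: cuts v (fun q r =>
    insertions Ds r (fun t => chain (hmul y (heval D q) :: t))).
Proof. by rewrite /head_pair /= scalerA -sgnD. Qed.

Lemma head_pair_nil w : head_pair w [::] = 0.
Proof. by case: w => [|y v] //=; rewrite scaler0. Qed.

Lemma pair1_genE y v D Ds : pair1_gen (y :: v) (D :: Ds) = head_pair (y :: v) (D :: Ds).
Proof.
rewrite head_pair_cons scale_cuts; apply: eq_bigr => p _; congr (_ *: _).
by apply: sgn_par; rewrite hdegE !parE; parity.
Qed.

(** The cyclic summands of the boundary in which the letter brought to the front is the value of the
    last cochain, on a block [q] ending the word. *)
Definition rotate_cochain w Z : CA :=
  uncons w (fun y v => unrcons Z (fun Z' D => cuts v (fun v' q =>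
    sg (wt q * (hwt D + hwt y + wt v' + 1) + hwt D * (hwt y + wt v' + wt Z') + 1) *:
    head_pair (hmul (heval D q) y :: v') Z'))).

(** The non-cyclic part of [b] under the insertions is governed by [insert_first_diff]; the cyclic
    part is split according to the origin of the last letter. *)
Lemma b_head_pair y v Z :
  b (head_pair (y :: v) Z) =
  - merges (y :: v) (head_pair^~ Z) +
  sg (hwt y + wt v) *: bdE Z (head_pair (y :: v)) +
  (rotate (y :: v) (head_pair^~ Z) + rotate_cochain (y :: v) Z).
Proof.
case: Z => [|D Ds].
  rewrite head_pair_nil raddf0 bar_diffE merges_nil derivs_nil subrr scaler0 /rotate /=.
  rewrite addr0 [merges _ _](_ : _ = 0); last first.
    by rewrite -[RHS](merges0 _ (y :: v)); apply: eq_merges => *; rewrite head_pair_nil.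
  rewrite oppr0 !add0r addr0; case: v => //= x v.
  by rewrite !scaler0.
pose G h t : CA := chain (hmul y h :: t).
have GL t : hom_linear (G^~ t).
  by move=> i c h h'; rewrite /G (multilinear_mull _ [::] (@chain_multilinear _ _)).
have GM h : multilinear (G h) by exact: chain_cons_ml.
(* [T q] is the weight of the head letter [hmul y (heval D q)]. *)
pose T q := hwt y + wt q + hwt D + 1.
pose cyc q t : CA := unrcons t (fun t' x =>
  sg ((hwt x + 1) * (T q + wt t' + 1) + (T q + wt t')) *: chain (hmul x (hmul y (heval D q)) :: t')).
have bG q t : b (G (heval D q) t) =
    - sg (T q) *: (uncons t (fun z => G (hmul (heval D q) z)) + merges t (G (heval D q))) + cyc q t.
  rewrite /G b_chain b_genE merges_cons; congr (_ + _).
    rewrite -scaleNr; congr (- sg _ *: (_ + _)).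
      by rewrite hwt_hmul hwt_heval /T; ring.
    by apply: eq_uncons => z t' _; rewrite hmulA.
  rewrite /rotate /cyc /=; apply: eq_unrcons => t' x _.
  rewrite wt_cons hwt_hmul hwt_heval; congr (sg _ *: _); rewrite /T; ring.
have -> : b (head_pair (y :: v) (D :: Ds)) =
    sg (hwt y + wt v) *: cuts v (fun q r => sg (hwt D * wt v + hwt D + wt q) *: insertions Ds r
      (fun t => uncons t (fun z => G (hmul (heval D q) z)) + merges t (G (heval D q)))) +
    cuts v (fun q r => sg (wt v + hwt D * wt v) *: insertions Ds r (cyc q)).
  rewrite head_pair_cons bZ b_cuts !scale_cuts -cutsD; apply: eq_cuts => q r _.
  rewrite b_ins (insertions_ext _ _ (bG q)) insD insZ scalerDr; congr (_ + _).
  rewrite !scalerA mulrN -!sgnD; congr (_ *: _); symmetry; apply: sgn_parN.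
  by rewrite /T !parE; parity.
rewrite (insert_first_diff (@ins_merges _ _ _ Ds)) //.
congr (_ + _).
  rewrite merges_cons.
  have -> : merges v (fun v' => head_pair (y :: v') (D :: Ds)) =
      - sg (wt v) *: merges v (fun v' => insert_first (D :: Ds) v' G).
    rewrite -mergesZ; apply: eq_merges => v' wv' _; congr (_ *: _); apply: sgn_parN.
    by rewrite wv' !parE; parity.
  have -> : uncons v (fun x v' => head_pair (hmul y x :: v') (D :: Ds)) =
      sg (wt v) *: uncons v (fun x v' =>
        sg (hwt x) *: insert_first (D :: Ds) v' (fun h => G (hmul x h))).
    rewrite scale_uncons; apply: eq_uncons => x v' ->.
    rewrite !scalerA /= scalerA -!sgnD; congr (_ *: _).
      by apply: sgn_par; rewrite !wt_cons !parE; parity.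
    apply: eq_cuts => q r _; apply: insertions_ext => t.
    by rewrite /G hmulA.
  have -> : bdE (D :: Ds) (head_pair (y :: v)) =
      sg (wt v) *: bdE (D :: Ds) (fun Z => insert_first Z v G).
    by rewrite -bar_diffZ.
  rewrite sgnD; set a := sg (hwt y); set c := sg (wt v).
  have cc : c * c = 1 by rewrite -sgnD; apply: (@sgn_par k _ 0); rewrite parE addbb.
  rewrite !scaleNr !scalerDr !scalerN.
  rewrite ![_ *: (c *: bdE _ _)]scalerA -[_ * c * c]mulrA cc mulr1 !scalerA.
  zmod.
(* By [ins_unrcons], the letter brought to the front is a letter of the word or the value of the
   last cochain; the two sums become [rotate] and [rotate_cochain]. *)
have insC q r : insertions Ds r (cyc q) = unrcons r (fun r' x =>
    sg (wt Ds * hwt x + ((hwt x + 1) * (T q + (wt r' + wt Ds) + 1) + (T q + (wt r' + wt Ds)))) *: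
    insertions Ds r' (fun t => chain (hmul x (hmul y (heval D q)) :: t))) +
  unrcons Ds (fun Ds' D' => cuts r (fun r' p =>
    sg (wt Ds * wt p + ((wt p + hwt D' + 1) * (T q + (wt r' + wt Ds') + 1) +
        (T q + (wt r' + wt Ds')))) *:
    insertions Ds' r' (fun t => chain (hmul (heval D' p) (hmul y (heval D q)) :: t)))).
  pose H x e t : CA := sg ((hwt x + 1) * (T q + e + 1) + (T q + e)) *:
     chain (hmul x (hmul y (heval D q)) :: t).
  rewrite (ins_unrcons Ds r (fun t x => H x (wt t) t)); congr (_ + _).
    apply: eq_unrcons => r' x _.
    by rewrite (ins_wt Ds r' (H x)) /H insZ scalerA -sgnD.
  apply: eq_unrcons => Ds' D' _; apply: eq_cuts => r' p _.
  by rewrite (ins_wt Ds' r' (H (heval D' p))) /H insZ scalerA -sgnD hwt_heval.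
transitivity (cuts v (fun q r => unrcons r (fun r' x =>
    sg (wt v + hwt D * wt v + (wt Ds * hwt x + ((hwt x + 1) * (T q + (wt r' + wt Ds) + 1) +
     (T q + (wt r' + wt Ds))))) *:
    insertions Ds r' (fun t => chain (hmul x (hmul y (heval D q)) :: t)))) +
  cuts v (fun q r => unrcons Ds (fun Ds' D' => cuts r (fun r' p =>
    sg (wt v + hwt D * wt v + (wt Ds * wt p + ((wt p + hwt D' + 1) *
        (T q + (wt r' + wt Ds') + 1) + (T q + (wt r' + wt Ds'))))) *:
    insertions Ds' r' (fun t => chain (hmul (heval D' p) (hmul y (heval D q)) :: t)))))).
  rewrite -cutsD; apply: eq_cuts => q r _; rewrite insC scalerDr; congr (_ + _).
    by rewrite scale_unrcons; apply: eq_unrcons => *; rewrite scalerA -sgnD.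
  rewrite scale_unrcons; apply: eq_unrcons => *; rewrite scale_cuts.
  by apply: eq_cuts => *; rewrite scalerA -sgnD.
congr (_ + _).
  rewrite cuts_unrcons_r; apply: eq_unrcons => v' x ev.
  rewrite head_pair_cons scalerA -sgnD scale_cuts; apply: eq_cuts => q r ev'.
  rewrite hmulA; congr (_ *: _); apply: sgn_par.
  by rewrite /T ev ev' !wt_cons !wt_rcons !wt_cat !parE; parity.
rewrite /rotate_cochain.
(* If [D] is the only cochain, removing it leaves [head_pair] without cochains, which is 0. *)
case/lastP: Ds {insC bG} => [|Ds D'].
  rewrite /= [LHS]big1 // [RHS]big1 // => *; rewrite ?head_pair_nil ?scaler0 //.
rewrite uncons_cons -rcons_cons unrcons_rcons.
pose K q r p := sg (wt (q ++ r ++ p) + hwt D * wt (q ++ r ++ p) +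
   (wt (rcons Ds D') * wt p + ((wt p + hwt D' + 1) *
        (T q + (wt r + wt Ds) + 1) + (T q + (wt r + wt Ds))))) *:
    insertions Ds r (fun t => chain (hmul (heval D' p) (hmul y (heval D q)) :: t)).
transitivity (cuts v (fun q w => cuts w (K q))).
  apply: eq_cuts => q w ev; rewrite unrcons_rcons; apply: eq_cuts => r p ew.
  by rewrite /K ev ew.
rewrite -cutsA; apply: eq_cuts => v' p ev.
rewrite head_pair_cons scalerA -sgnD scale_cuts; apply: eq_cuts => q r ev'.
rewrite hmulA; congr (_ *: _); apply: sgn_par.
by rewrite /T ev' !wt_cons !wt_rcons !wt_cat !parE; parity.
Qed.

End HeadPairing.

(** * The boundary of the second pairing *)

Section WrapPairing.
Variables (k : comPzRingType) (A : gradedAlg k).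
Local Notation sg e := (sgn k e).
Local Notation CA := (chains (components A)).
Local Notation homA := (hom (components A)).
Local Notation homE := (hom (cochains A)).
Local Notation bdE := (bar_diff (R := cochains A) (@delta k A)).
Implicit Types (s t u v r q w : seq homA) (Z : seq homE) (x y : homA) (D E : homE).

(* [xa], ..., [xZ] are the weights of [a_0], [u], [v], [r], [D_m] and the remaining
   cochains; the rest of epsilon_2 is the sign of [head_pair]. *)
Definition wrap_sign (xa xu xv xr xD xZ : int) : int :=
  (xa + xu + xv) * xr + xD * (xa + xu + xv + xr + xZ + 1).

Definition wrap_pair w Z : CA :=
  uncons w (fun a s => unrcons Z (fun Zm D => cuts3 s (fun u v r =>
    sg (wrap_sign (hwt a) (wt u) (wt v) (wt r) (hwt D) (wt Zm)) *:
    head_pair (heval D (r ++ a :: u) :: v) Zm))).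

Lemma wrap_pair_rcons a s Zm D :
  wrap_pair (a :: s) (rcons Zm D) = cuts3 s (fun u v r =>
    sg (wrap_sign (hwt a) (wt u) (wt v) (wt r) (hwt D) (wt Zm)) *:
    head_pair (heval D (r ++ a :: u) :: v) Zm).
Proof. by rewrite /wrap_pair uncons_cons unrcons_rcons. Qed.

Lemma wrap_pair_nil w : wrap_pair w [::] = 0.
Proof. by case: w. Qed.

(** The only cochain swallows the cyclic block and no D_0 is left to multiply it, in agreement with
    the convention for m = 0. *)
Lemma wrap_pair1 w D : wrap_pair w [:: D] = 0.
Proof.
case: w => // a s; rewrite -[[:: D]]/(rcons [::] D) wrap_pair_rcons /cuts3.
rewrite /cuts big1 // => p _; rewrite big1 // => q _.
by rewrite head_pair_nil scaler0.
Qed.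

Lemma pair2_genE a s Z : pair2_gen (a :: s) Z = wrap_pair (a :: s) Z.
Proof.
case: Z => [|D0 Z]; first by rewrite wrap_pair_nil.
case/lastP: Z => [|Ds D]; first by rewrite wrap_pair1.
rewrite pair2E -rcons_cons wrap_pair_rcons.
apply: eq_bigr => -[u w] _; apply: eq_bigr => -[v r] _.
rewrite head_pair_cons scalerA -sgnD scale_cuts.
rewrite -[LHS]/(cuts v (fun q v1 => p2_signed D0 D Ds a u q v1 r)).
apply: eq_cuts => q v1 ev; rewrite /p2_signed /p2_term /p2_sign; congr (_ *: _).
apply: sgn_par; rewrite /wrap_sign /= ev wt_cons wt_cat hdegE !parE; parity.
Qed.

Lemma hom_linear_head v Z : hom_linear (fun y => head_pair (y :: v) Z).
Proof.
case: Z => [|D Ds] i c x y; cbv beta; first by rewrite !head_pair_nil scaler0 addr0.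
rewrite !head_pair_cons -scale_lin; congr (_ *: _).
rewrite scale_cuts -cutsD; apply: eq_cuts => q r _.
rewrite -insertions_lin; apply: insertions_ext => t.
exact: (multilinear_mulr _ [::] (@chain_multilinear _ _)).
Qed.

(** By associativity the value of [D] can be absorbed into the head letter, with [D0] as the new
    first cochain. *)
Lemma head_pair_cup y v D D0 Ds :
  head_pair (y :: v) (hmul D D0 :: Ds) = sg ((hwt D + 1) * wt v) *: cuts v (fun q r =>
    head_pair (hmul y (heval D q) :: r) (D0 :: Ds)).
Proof.
rewrite head_pair_cons; pose F q1 q2 r := sg (wt v + (hwt D + hwt D0 + 1) * wt v
    + (hwt D0 + 1) * wt q1) *:
    insertions Ds r (fun t => chain (hmul y (hmul (heval D q1) (heval D0 q2)) :: t)).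
transitivity (cuts v (fun q r => cuts q (fun q1 q2 => F q1 q2 r))).
  rewrite scale_cuts; apply: eq_cuts => q r _.
  rewrite (heval_cup D D0 q
    (phi := fun h => insertions Ds r (fun t => chain (hmul y h :: t)))).
    rewrite scale_cuts; apply: eq_cuts => q1 q2 _; rewrite scalerA -sgnD /F.
    by rewrite hwt_hmul hdegE.
  apply: (hom_linear_ins _ _ (G := fun h t => chain (hmul y h :: t))) => t i c x z.
  exact: (multilinear_mull _ [::] (@chain_multilinear _ _)).
rewrite cutsA scale_cuts; apply: eq_cuts => q1 w ev.
rewrite head_pair_cons scalerA -sgnD scale_cuts; apply: eq_cuts => q2 r ew.
rewrite hmulA /F; congr (_ *: _); apply: sgn_par.
by rewrite ev wt_cat !parE; parity.
Qed.

Lemma b_cuts3 (T : Type) (l : seq T) F :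
  b (cuts3 l F) = cuts3 l (fun l1 l2 l3 => b (F l1 l2 l3)) :> CA.
Proof. by rewrite /cuts3 b_cuts; apply: eq_cuts => *; rewrite b_cuts. Qed.

(** * Cancellation of the terms with a cyclic block *)

Section WrapTerms.
Variables (a : homA) (s : seq homA) (D : homE) (Zm : seq homE).

Let dval u r := heval D (r ++ a :: u).
Let wsg u v r := wrap_sign (hwt a) (wt u) (wt v) (wt r) (hwt D) (wt Zm).
Let K y v := head_pair (y :: v) Zm.

Lemma hwt_dval u r : hwt (dval u r) = wt r + (hwt a + wt u) + hwt D.
Proof. by rewrite /dval hwt_heval wt_cat wt_cons. Qed.

(** These sums express both sides of [b_wrap_pair_rcons]. The [val_] sums multiply the value on the
    cyclic block by a letter of [v]; the [merge_] sums multiply neighbours, [merge_au] and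
    [merge_ra] involving [a]; the [cup_] sums multiply the values of [E] and [D], with [a] an
    argument of [D] in [cup_left] and of [E] in [cup_right]; in the [first_] sums [a] is a factor
    beside the value of [D]. *)
Let val_right := cuts3 s (fun u v r => uncons v (fun x v' =>
  sg (wsg u v r + hwt (dval u r)) *: K (hmul (dval u r) x) v')).
Let val_left := cuts3 s (fun u v r => unrcons v (fun v' x =>
  sg (wsg u v r + ((hwt x + 1) * (hwt (dval u r) + wt v' + 1) + (hwt (dval u r) + wt v'))) *:
    K (hmul x (dval u r)) v')).
Let merge_u := cuts3 s (fun u v r =>
  sg (wsg u v r + hwt D + wt r + hwt a) *: merges u (fun u' => K (dval u' r) v)).
Let merge_v := cuts3 s (fun u v r =>
  sg (wsg u v r + hwt (dval u r)) *: merges v (K (dval u r))).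
Let merge_r := cuts3 s (fun u v r =>
  sg (wsg u v r + hwt D) *: merges r (fun r' => K (dval u r') v)).
Let merge_au := cuts3 s (fun u v r => uncons u (fun x u' =>
  sg (wsg u v r + hwt D + wt r + hwt a) *: K (heval D (r ++ hmul a x :: u')) v)).
Let merge_ra := cuts3 s (fun u v r => unrcons r (fun r' x =>
  sg (wsg u v r + hwt D + wt r) *: K (heval D (r' ++ hmul x a :: u)) v)).
Let bd_Zm := cuts3 s (fun u v r =>
  sg (wsg u v r + hwt (dval u r) + wt v) *: bdE Zm (head_pair (dval u r :: v))).
Let cup_left := unrcons Zm (fun Z' E => cuts3 s (fun u v r => cuts v (fun v' q =>
  sg (wsg u v r + (wt q * (hwt E + hwt (dval u r) + wt v' + 1)
      + hwt E * (hwt (dval u r) + wt v' + wt Z') + 1)) *: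
    head_pair (hmul (heval E q) (dval u r) :: v') Z'))).
Let cup_right := unrcons Zm (fun Z' E => cuts3 s (fun u v r => cuts u (fun u' q =>
  sg (wt s + hwt a + wt Zm + wrap_sign (hwt a) (wt u) (wt v) (wt r) (hwt E + hwt D + 1) (wt Z')
      + (hwt D + 1) * (wt r + hwt a + wt u')) *:
    head_pair (hmul (heval E (r ++ a :: u')) (heval D q) :: v) Z'))).
Let first_right := cuts s (fun u v =>
  sg (wsg u v [::] + hwt a * hwt D + hwt a) *: K (hmul a (heval D u)) v).
Let first_left := cuts s (fun v r =>
  sg (wsg [::] v r + hwt D + wt r) *: K (hmul (heval D r) a) v).

(** Each summand is a [head_pair] with head letter [dval u r], to which [b_head_pair] applies. *)
Lemma b_wrap_pair :
  b (wrap_pair (a :: s) (rcons Zm D)) =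
  - val_right - merge_v + bd_Zm + val_left + cup_left.
Proof.
rewrite wrap_pair_rcons b_cuts3.
rewrite /cup_left -cuts3_unrcons_out !cuts3N -!cuts3D; apply: eq_cuts3 => u v r es.
rewrite bZ b_head_pair merges_cons -/(dval u r) -/(wsg u v r) !scalerDr !scalerN.
rewrite !scalerDr !scalerA -!sgnD !addrA opprD !scale_uncons.
rewrite /rotate /rotate_cochain !uncons_cons !scale_unrcons.
congr (_ + _ + _ + _ + _).
- by apply: eq_unrcons => v' x _; rewrite scalerA -sgnD wt_cons.
apply: eq_unrcons => Z' E _; rewrite scale_cuts; apply: eq_cuts => v' q _.
by rewrite scalerA -sgnD.
Qed.

(** By [merges_cuts] a merged pair of letters of [s] lies within one of the three blocks; what
    remains is the product of [a] with the first letter of [s], which thus belongs to [u]. *)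
Lemma merges_wrap_pair :
  merges (a :: s) (fun w => wrap_pair w (rcons Zm D)) = merge_au + merge_u + merge_v + merge_r.
Proof.
rewrite merges_cons scalerDr -!addrA; congr (_ + _).
  rewrite scale_uncons /merge_au.
  transitivity (uncons s (fun x s' => cuts3 s' (fun u v r =>
      sg (wsg (x :: u) v r + hwt D + wt r + hwt a) *: K (heval D (r ++ hmul a x :: u)) v)));
    last first.
    by rewrite -cuts3_uncons; apply: eq_cuts3 => u v r _; apply: eq_uncons => x u' ->.
  apply: eq_uncons => x s' _; rewrite wrap_pair_rcons scale_cuts3.
  apply: eq_cuts3 => u v r _; rewrite scalerA -sgnD; congr (_ *: _); apply: sgn_par.
  by rewrite /wsg /wrap_sign hwt_hmul wt_cons !parE; parity.
pose F (u v r : seq homA) : CA := sg (wsg u v r) *: K (dval u r) v.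
transitivity (sg (hwt a) *: merges s (fun s' => cuts s' (fun u w => cuts w (F u)))).
  by congr (_ *: _); apply: eq_merges => s' _ _; rewrite wrap_pair_rcons.
rewrite merges_cuts scale_cuts /merge_u /merge_v /merge_r /cuts3 -!cutsD.
apply: eq_cuts => u w _; rewrite merges_cuts.
transitivity (sg (hwt a) *: (cuts w (fun v r => merges u (fun u' => F u' v r)) +
   sg (wt u) *: cuts w (fun v r => merges v (fun v' => F u v' r) +
      sg (wt v) *: merges r (F u v)))).
  by rewrite merges_cuts_comm.
rewrite [in LHS]scale_cuts -[X in _ *: X]cutsD [LHS]scale_cuts -!cutsD; apply: eq_cuts => v r _.
rewrite !scalerDr !scalerA -!sgnD; congr (_ + (_ + _)).
- transitivity (sg (hwt a) *: merges u (fun u' =>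
      sg (wsg u v r + wt r + hwt D) *: K (dval u' r) v)).
    congr (_ *: _); apply: eq_merges => u' wu _; congr (_ *: _); apply: sgn_par.
    by rewrite /wsg /wrap_sign wu !parE; parity.
  rewrite mergesZ scalerA -sgnD; congr (_ *: _); apply: sgn_par.
  by rewrite !parE; parity.
- transitivity (sg (hwt a + wt u) *: merges v (fun v' =>
      sg (wsg u v r + wt r + hwt D) *: K (dval u r) v')).
    congr (_ *: _); apply: eq_merges => v' wv _; congr (_ *: _); apply: sgn_par.
    by rewrite /wsg /wrap_sign wv !parE; parity.
  rewrite mergesZ scalerA -sgnD; congr (_ *: _); apply: sgn_par.
  by rewrite hwt_dval !parE; parity.
transitivity (sg (hwt a + (wt u + wt v)) *: merges r (fun r' =>
      sg (wsg u v r + hwt a + wt u + wt v + hwt D) *: K (dval u r') v)).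
  rewrite addrA; congr (_ *: _); apply: eq_merges => r' wr _; congr (_ *: _); apply: sgn_par.
  by rewrite /wsg /wrap_sign wr !parE; parity.
rewrite mergesZ scalerA -sgnD; congr (_ *: _); apply: sgn_par.
by rewrite !parE; parity.
Qed.

Lemma rotate_wrap_pair :
  rotate (a :: s) (fun w => wrap_pair w (rcons Zm D)) = - merge_ra.
Proof.
rewrite /rotate uncons_cons.
have -> : merge_ra = unrcons s (fun s' x => cuts3 s' (fun u v r =>
    sg (wsg u v (rcons r x) + hwt D + wt (rcons r x)) *: K (heval D (r ++ hmul x a :: u)) v)).
  by rewrite -cuts3_unrcons; apply: eq_cuts3 => u v r _; apply: eq_unrcons => r' x ->.
rewrite unrconsN; apply: eq_unrcons => s' x es; rewrite wrap_pair_rcons scale_cuts3 cuts3N.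
apply: eq_cuts3 => u v r es'; rewrite scalerA -sgnD -scaleNr; congr (_ *: _).
apply: sgn_parN; rewrite /wsg /wrap_sign es' hwt_hmul wt_rcons wt_cons !wt_cat !parE; parity.
Qed.

Lemma rotate_cochain_first : rotate_cochain (a :: s) (rcons Zm D) = - first_left.
Proof.
rewrite /rotate_cochain uncons_cons unrcons_rcons cutsN; apply: eq_cuts => v r _.
rewrite -scaleNr; congr (_ *: _); apply: sgn_parN.
by rewrite /wsg /wrap_sign wt0 !parE; parity.
Qed.

(** Rotation multiplies [D] into [D0] from the left, so by [head_pair_cup] the value of [D] stands
    directly to the right of [a]. *)
Lemma rotate_head_pair :
  - sg (hwt a + wt s) *: rotate (rcons Zm D) (head_pair (a :: s)) = first_right.
Proof.
rewrite /rotate /first_right /K /wsg; case: Zm => [|D0 Zt].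
  rewrite [X in _ *: X](_ : _ = 0) // scaler0 /cuts big1 // => p _.
  by rewrite head_pair_nil scaler0.
rewrite rcons_cons uncons_cons unrcons_rcons head_pair_cup scaleNr !scalerA -!sgnD.
rewrite -scaleNr scale_cuts; apply: eq_cuts => u v es; congr (_ *: _); symmetry; apply: sgn_parN.
rewrite /wrap_sign wt0 wt_cons es wt_cat !parE; parity.
Qed.

(** After the rotation [E] swallows [a], and [D], multiplied into [D0], takes the initial block [q]
    of [v]. Moving the border so that [q] belongs to [u] gives [cup_right]. *)
Lemma rotate_wrap_pair_cochains :
  - sg (hwt a + wt s) *: rotate (rcons Zm D) (wrap_pair (a :: s)) = - cup_right.
Proof.
rewrite /rotate /cup_right; case: Zm => [|D0 Zt]; first by rewrite /= scaler0 oppr0.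
rewrite rcons_cons uncons_cons unrcons_rcons.
(* With only two cochains the rotation leaves a single one, and [cup_right] leaves [head_pair]
   without cochains. *)
case/lastP: Zt => [|Zq E].
  rewrite wrap_pair1 !scaler0 -[unrcons _ _]/(cuts3 _ _) /cuts3 /cuts big1 ?oppr0 // => p _.
  rewrite big1 // => q _; rewrite big1 // => u _.
  by rewrite head_pair_nil scaler0.
rewrite -!rcons_cons unrcons_rcons wrap_pair_rcons scaleNr; congr (- _).
rewrite scalerA -sgnD scale_cuts3.
pose F u1 u2 v r := sg (wt s + hwt a + wt (rcons (D0 :: Zq) E) +
  wrap_sign (hwt a) (wt u1 + wt u2) (wt v) (wt r) (hwt E + hwt D + 1) (wt (D0 :: Zq))
      + (hwt D + 1) * (wt r + hwt a + wt u1)) *: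
    head_pair (hmul (heval E (r ++ a :: u1)) (heval D u2) :: v) (D0 :: Zq).
transitivity (cuts3 s (fun u v r => cuts u (fun u1 u2 => F u1 u2 v r))); last first.
  by apply: eq_cuts3 => u v r _; apply: eq_cuts => u1 u2 ->; rewrite wt_cat.
rewrite cuts3_move_uv; apply: eq_cuts3 => u v r es.
rewrite head_pair_cup !scalerA -!sgnD scale_cuts; apply: eq_cuts => q v' ev.
congr (_ *: _); apply: sgn_par.
rewrite /wrap_sign !wt_rcons !wt_cons hwt_hmul es ev !wt_cat !parE; parity.
Qed.

(** Expanding the cup product cuts [r ++ a :: u] in two. If [a] is an argument of [D], the block of
    [E] is an initial piece of [r], which is moved to the end of [v]; otherwise the block of [D] is
    a final piece of [u]. *)
Lemma wrap_pair_cup :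
  sg (hwt a + wt s) *: unrcons Zm (fun Z' E =>
    sg (wt Zm) *: wrap_pair (a :: s) (rcons Z' (hmul E D))) = cup_left + cup_right.
Proof.
rewrite /cup_left /cup_right /wsg.
case/lastP: Zm => [|Z' E]; first by rewrite scaler0 addr0.
rewrite !unrcons_rcons wrap_pair_rcons scalerA -sgnD scale_cuts3.
pose F u v q r2 := sg (wt s + hwt a + wt (rcons Z' E)
    + wrap_sign (hwt a) (wt u) (wt v) (wt q + wt r2) (hwt E + hwt D + 1) (wt Z')
    + (hwt D + 1) * wt q) *: head_pair (hmul (heval E q) (heval D (r2 ++ a :: u)) :: v) Z'.
transitivity (cuts3 s (fun u v r => cuts r (F u v)) + cuts3 s (fun u v r => cuts u (fun u' q =>
  sg (wt s + hwt a + wt (rcons Z' E)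
      + wrap_sign (hwt a) (wt u) (wt v) (wt r) (hwt E + hwt D + 1) (wt Z')
      + (hwt D + 1) * (wt r + hwt a + wt u')) *:
    head_pair (hmul (heval E (r ++ a :: u')) (heval D q) :: v) Z'))).
  rewrite -cuts3D; apply: eq_cuts3 => u v r es.
  rewrite (heval_cup E D _ (phi := fun h => head_pair (h :: v) Z')); last exact: hom_linear_head.
  rewrite cuts_cat !scalerDr !scale_cuts; congr (_ + _).
    apply: eq_cuts => q r2 er; rewrite 2!scalerA -!sgnD /F; congr (_ *: _); apply: sgn_par.
    by rewrite hwt_hmul hdegE er wt_cat !parE; parity.
  apply: eq_cuts => u1 q eu; rewrite 2!scalerA -!sgnD; congr (_ *: _); apply: sgn_par.
  by rewrite hwt_hmul hdegE wt_cat wt_cons !parE; parity.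
congr (_ + _); rewrite -(cuts3_move_vr s F); apply: eq_cuts3 => u v r es.
apply: eq_cuts => v' q ev; congr (_ *: _); apply: sgn_par.
by rewrite hwt_dval /wrap_sign wt_rcons es ev !wt_cat !parE; parity.
Qed.

(** In [hdelta D] on [r ++ a :: u], the left factor is the first letter of [r], or [a] if [r] is
    empty; the right factor is the last letter of [u], or [a] if [u] is empty; the merges are sorted
    by their position relative to [a]. *)
Lemma wrap_pair_delta :
  - (sg (hwt a + wt s + wt Zm) *: wrap_pair (a :: s) (rcons Zm (hdelta D))) =
  - val_right + val_left + merge_r + merge_ra + merge_au + merge_u
  - first_right - first_left.
Proof.
(* The first letter of [v] is counted as the last letter of [u]; dually, in [val_left] the last
   letter of [v] becomes the first of [r]. *)
have -> : val_right = cuts3 s (fun u v r => unrcons u (fun u' x =>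
    sg (wsg u v r + hwt D + wt r + hwt a + wt u') *: K (hmul (dval u' r) x) v)).
  pose F u x v r := sg (wsg (rcons u x) v r + hwt D + wt r + hwt a + wt u) *:
    K (hmul (dval u r) x) v.
  transitivity (cuts3 s (fun u v r => unrcons u (fun u' x => F u' x v r))).
    rewrite cuts3_pass_uv; apply: eq_cuts3 => u v r _; apply: eq_uncons => x v' ev.
    congr (_ *: _); apply: sgn_par; rewrite hwt_dval /wsg /wrap_sign ev wt_rcons wt_cons.
    by rewrite !parE; parity.
  by apply: eq_cuts3 => u v r _; apply: eq_unrcons => u' x ->.
have -> : val_left = - cuts3 s (fun u v r => uncons r (fun x r' =>
    sg (wsg u v r + hwt x * hwt D + hwt x) *: K (hmul x (dval u r')) v)).
  pose F u v x r := sg (wsg u v (x :: r) + hwt x * hwt D + hwt x) *: K (hmul x (dval u r)) v.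
  transitivity (- cuts3 s (fun u v r => uncons r (F u v))); last first.
    congr (- _); apply: eq_cuts3 => u v r _; by apply: eq_uncons => x r' ->.
  rewrite -cuts3_pass_vr cuts3N; apply: eq_cuts3 => u v r _; rewrite unrconsN.
  apply: eq_unrcons => v' x ev; rewrite -scaleNr; congr (_ *: _); apply: sgn_parN.
  rewrite hwt_dval /wsg /wrap_sign ev wt_rcons wt_cons !parE; parity.
have -> : first_right = cuts3 s (fun u v r => unnil r (
    sg (wsg u v r + hwt a * hwt D + hwt a) *: K (hmul a (heval D u)) v)).
  rewrite /first_right -cuts3_unnil_r.
  by apply: eq_cuts3 => u v [|x r].
have -> : first_left = cuts3 s (fun u v r => unnil u (
    sg (wsg u v r + hwt D + wt r) *: K (hmul (heval D r) a) v)).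
  rewrite /first_left -cuts3_unnil_l.
  by apply: eq_cuts3 => -[|x u] v r.
rewrite wrap_pair_rcons scale_cuts3 !cuts3N -!cuts3D; apply: eq_cuts3 => u v r es.
set B1 := unrcons u _; set B2 := uncons r _; set B3 := _ *: merges r _.
set B4 := unrcons r _; set B5 := uncons u _; set B6 := _ *: merges u _.
set B7 := unnil r _; set B8 := unnil u _.
(* Regrouped in the order of [heval_delta]: left factors, merges, right factors. *)
transitivity (- (B2 + B7) + (B3 + B4 + (B5 + B6)) - (B1 + B8)); last by zmod.
rewrite scalerA -sgnD (heval_delta D _ (phi := fun h => head_pair (h :: v) Zm)); last exact: hom_linear_head.
set c := sg _.
have -> : c = - sg (wsg u v r).
  apply: sgn_parN; rewrite /wsg /wrap_sign hwt_hdelta es !wt_cat !parE; parity.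
rewrite uncons_cat unrcons_cat merges_cat merges_cons scaleNr opprK.
rewrite !(scalerDr, scalerN).
congr (- (_ + _) + (_ + _ + (_ + _)) - (_ + _)).
- rewrite scale_uncons; apply: eq_uncons => x r' _.
  by rewrite scalerA -sgnD addrA.
- by rewrite scale_unnil scalerA -sgnD addrA.
- by rewrite scalerA -sgnD.
- rewrite !scale_unrcons; apply: eq_unrcons => x r' _.
  by rewrite 2!scalerA -!sgnD addrA.
- rewrite !scale_uncons; apply: eq_uncons => x u' _.
  by rewrite 3!scalerA -!sgnD.
- by rewrite 3!scalerA -!sgnD.
- rewrite scale_unrcons; apply: eq_unrcons => u' x _.
  rewrite scalerA -sgnD wt_cat wt_cons; congr (sg _ *: _); ring.
by rewrite scale_unnil scalerA -sgnD addrA.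
Qed.

Lemma bar_diff_wrap_pair :
  sg (hwt a + wt s) *: bdE Zm (fun Z => wrap_pair (a :: s) (rcons Z D)) = bd_Zm.
Proof.
transitivity (sg (hwt a + wt s) *: bdE Zm (fun Z => cuts3 s (fun u v r =>
    sg (wsg u v r + hwt D) *: head_pair (dval u r :: v) Z))).
  congr (_ *: _); apply: eq_bar_diff => Z wZ _; rewrite wrap_pair_rcons.
  apply: eq_cuts3 => u v r _; congr (_ *: _); apply: sgn_par.
  by rewrite /wsg /wrap_sign wZ !parE; parity.
rewrite /cuts3 bar_diff_cuts scale_cuts; apply: eq_cuts => u w es.
rewrite bar_diff_cuts scale_cuts; apply: eq_cuts => v r ew.
rewrite bar_diffZ scalerA -sgnD; congr (_ *: _); apply: sgn_par.
by rewrite hwt_dval es ew !wt_cat !parE; parity.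
Qed.

(** The term [rotate_cochain], left over from [b_head_pair], is added on the left because it is
    cancelled only by [first_left], a part of [hdelta D] acting on the cyclic block. *)
Lemma b_wrap_pair_rcons :
  rotate_cochain (a :: s) (rcons Zm D) + b (wrap_pair (a :: s) (rcons Zm D)) =
  - merges (a :: s) (fun w => wrap_pair w (rcons Zm D)) +
  rotate (a :: s) (fun w => wrap_pair w (rcons Zm D)) +
  sg (hwt a + wt s) *: bdE (rcons Zm D) (wrap_pair (a :: s)) +
  (- sg (hwt a + wt s) *: rotate (rcons Zm D) (head_pair (a :: s)) +
   - sg (hwt a + wt s) *: rotate (rcons Zm D) (wrap_pair (a :: s))).
Proof.
(* The differential of [rcons Zm D] splits into that of [Zm], the product of the last cochain of
   [Zm] with [D], and [hdelta D]. *)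
rewrite bar_diff_rcons -/(hdelta D) scalerBr scalerDr scalerA -sgnD.
rewrite rotate_cochain_first b_wrap_pair merges_wrap_pair rotate_wrap_pair.
rewrite rotate_head_pair rotate_wrap_pair_cochains bar_diff_wrap_pair.
rewrite wrap_pair_cup wrap_pair_delta; zmod.
Qed.

End WrapTerms.

Lemma b_wrap_pair_rotate a s Z :
  rotate_cochain (a :: s) Z + b (wrap_pair (a :: s) Z) =
  - merges (a :: s) (fun w => wrap_pair w Z) + rotate (a :: s) (fun w => wrap_pair w Z) +
  sg (hwt a + wt s) *: bdE Z (wrap_pair (a :: s)) +
  (- sg (hwt a + wt s) *: rotate Z (head_pair (a :: s)) +
   - sg (hwt a + wt s) *: rotate Z (wrap_pair (a :: s))).
Proof.
case/lastP: Z => [|Zm D]; last exact: b_wrap_pair_rcons.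
have -> : merges (a :: s) (fun w => wrap_pair w [::]) = 0.
  by rewrite -[RHS](merges0 _ (a :: s)); apply: eq_merges => *; rewrite wrap_pair_nil.
have -> : rotate (a :: s) (fun w => wrap_pair w [::]) = 0.
  rewrite /rotate /=; case: s => //= x s'; exact: scaler0.
rewrite wrap_pair_nil raddf0 bar_diffE merges_nil derivs_nil subrr.
by rewrite !scaler0 oppr0 !addr0.
Qed.

Lemma b_pair_gen a s Z :
  b (pair_gen (a :: s) Z) =
  - merges (a :: s) (fun w => pair_gen w Z) + rotate (a :: s) (fun w => pair_gen w Z) +
  sg (hwt a + wt s) *: (bdE Z (pair_gen (a :: s)) - rotate Z (pair_gen (a :: s))).
Proof.
have pairE w Y : (0 < size w)%N -> pair_gen w Y = head_pair w Y + wrap_pair w Y.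
  case: w => // y v _; rewrite /pair_gen pair2_genE; congr (_ + _).
  by case: Y => [|D Ds]; [rewrite head_pair_nil | exact: pair1_genE].
have -> : merges (a :: s) (fun w => pair_gen w Z) =
    merges (a :: s) (fun w => head_pair w Z) + merges (a :: s) (fun w => wrap_pair w Z).
  by rewrite -mergesD; apply: eq_merges => w _ /pairE.
have -> : bdE Z (pair_gen (a :: s)) = bdE Z (head_pair (a :: s)) + bdE Z (wrap_pair (a :: s)).
  by rewrite -bar_diffD; apply: eq_bar_diff => Y _ _; rewrite pairE.
have -> : rotate (a :: s) (fun w => pair_gen w Z) =
    rotate (a :: s) (fun w => head_pair w Z) + rotate (a :: s) (fun w => wrap_pair w Z).
  rewrite /rotate !uncons_cons -unrconsD; apply: eq_unrcons => s' x _.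
  by rewrite pairE // scalerDr.
have -> : rotate Z (pair_gen (a :: s)) = rotate Z (head_pair (a :: s)) + rotate Z (wrap_pair (a :: s)).
  rewrite /rotate -unconsD; apply: eq_uncons => D0 Y _; rewrite -unrconsD.
  by apply: eq_unrcons => Y' D _; rewrite pairE // scalerDr.
have bD (y z : CA) : b (y + z) = b y + b z by exact: raddfD.
rewrite pairE // bD b_head_pair.
have e := b_wrap_pair_rotate a s Z.
rewrite [X in _ = _ + X]scalerBr !scalerDr.
rewrite !scaleNr in e.
set m := merges (a :: s) (fun w => head_pair w Z); set rh := rotate (a :: s) (fun w => head_pair w Z).
set bh := _ *: bdE Z (head_pair _).
(* The exceptional cyclic term of the first pairing is grouped with the boundary of the second. *)
transitivity (- m + bh + rh + (rotate_cochain (a :: s) Z + b (wrap_pair (a :: s) Z))); first by zmod.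
rewrite e; zmod.
Qed.

End WrapPairing.

(** * Passage from generators to all chains *)

Section LinearImages.
Variables (k : comPzRingType) (R : gralg k) (M N : lmodType k) (f : {linear M -> N}).
Implicit Types (s : seq (hom R)) (F : seq (hom R) -> M).

Lemma linear_merges s F : f (merges s F) = merges s (f \o F).
Proof.
rewrite /merges raddf_cuts; apply: eq_cuts => u v _; rewrite raddf_uncons.
apply: eq_uncons => x v' _; rewrite raddf_uncons; apply: eq_uncons => y v'' _.
exact: linearZ.
Qed.

Lemma linear_derivs d s F : f (derivs d s F) = derivs d s (f \o F).
Proof.
rewrite /derivs raddf_cuts; apply: eq_cuts => u v _; rewrite raddf_uncons.
apply: eq_uncons => x v' _; exact: linearZ.
Qed.

Lemma linear_rotate s F : f (rotate s F) = rotate s (f \o F).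
Proof.
rewrite /rotate raddf_uncons; apply: eq_uncons => x v _; rewrite raddf_unrcons.
by apply: eq_unrcons => v' y _; exact: linearZ.
Qed.

End LinearImages.

Lemma b_pairing_chain (k : comPzRingType) (A : gradedAlg k) (a : hom (components A)) s
    (D : hom (cochains A)) Ds :
  b (pairing (chain (a :: s)) (chain (D :: Ds))) =
  pairing (b (chain (a :: s))) (chain (D :: Ds)) +
  sgn k (chain_deg (a :: s)) *:
    pairing (chain (a :: s)) (b (chain (D :: Ds)) + delta_ext (chain (D :: Ds))).
Proof.
(* The partial maps of the pairing are packed as linear maps so that they can be moved inside
   [merges], [derivs] and [rotate]. *)
pose pl (x : chains (cochains A)) : {linear _ -> _} := HB.pack (fun z : chains (components A) => pairing z x)
  (GRing.isLinear.Build k _ _ _ (fun z => pairing z x) (pairing_linear_l x)).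
pose pr (z : chains (components A)) : {linear _ -> _} := HB.pack (fun x : chains (cochains A) => pairing z x)
  (GRing.isLinear.Build k _ _ _ (fun x => pairing z x) (pairing_linear_r z)).
have pairE w Z : (0 < size w)%N -> (0 < size Z)%N ->
    pairing (chain w) (chain Z) = pair_gen w Z :> chains (components A).
  by case: w Z => // a' w [|D' Z] // _ _; exact: pairing_chain.
rewrite pairE // b_pair_gen delta_ext_chain !b_chain !b_genE d_genE sgn_chain_deg.
congr (_ + _).
  rewrite -[RHS]/(pl _ _) (linearD (pl _)) (linearN (pl _)) (linear_merges (pl _)) (linear_rotate (pl _)).
  congr (- _ + _); first by apply: eq_merges => w _ w_gt0; rewrite /= pairE.
  by apply: eq_rotate => w w_gt0; rewrite /= pairE.
rewrite scaleNr -scalerN; congr (_ *: _).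
rewrite -[pairing _ _]/(pr _ _) !(linearD (pr _)) (linearN (pr _)).
rewrite (linear_merges (pr _)) (linear_derivs (pr _)) (linear_rotate (pr _)).
have -> : merges (D :: Ds) (pr (chain (a :: s)) \o chain) = merges (D :: Ds) (pair_gen (a :: s)).
  by apply: eq_merges => Z _ Z_gt0; rewrite /= pairE.
have -> : derivs (R := cochains A) (@delta k A) (D :: Ds) (pr (chain (a :: s)) \o chain) =
    derivs (R := cochains A) (@delta k A) (D :: Ds) (pair_gen (a :: s)).
  by apply: eq_derivs => Z _ Z_gt0; rewrite /= pairE.
have -> : rotate (D :: Ds) (pr (chain (a :: s)) \o chain) = rotate (D :: Ds) (pair_gen (a :: s)).
  by apply: eq_rotate => Z Z_gt0; rewrite /= pairE.
rewrite bar_diffE; zmod.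
Qed.

Lemma pairing0l (k : comPzRingType) (A : gradedAlg k) (x : chains (cochains A)) :
  pairing 0 x = 0 :> chains (components A).
Proof.
by have := pairing_linear_l x (-1) 0 0; rewrite scaler0 addr0 scaleN1r addNr.
Qed.

Lemma pairing0r (k : comPzRingType) (A : gradedAlg k) (a : chains (components A)) :
  pairing a 0 = 0 :> chains (components A).
Proof.
by have := pairing_linear_r a (-1) 0 0; rewrite scaler0 addr0 scaleN1r addNr.
Qed.

Lemma delta_ext0 (k : comPzRingType) (A : gradedAlg k) : delta_ext 0 = 0 :> chains (cochains A).
Proof.
by have := @delta_ext_linear k A (-1) 0 0; rewrite scaler0 addr0 scaleN1r addNr.
Qed.

Theorem theorem2p1 (k : comPzRingType) (A : gradedAlg k) (e : int)
    (a : chains (components A)) (x : chains (cochains A)) :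
  chain_homog e a ->
  b (pairing a x) =
    pairing (b a) x + sgn k e *: pairing a (b x + delta_ext x).
Proof.
case=> u [u_deg ->]; elim: u u_deg => [|[c w] u IHu] u_deg.
  by rewrite big_nil pairing0l !raddf0 !pairing0l scaler0 addr0.
rewrite big_cons pairing_linear_l !b_linear !pairing_linear_l.
rewrite IHu => [|t tu]; last by apply: u_deg; rewrite inE tu orbT.
rewrite scale_lin addrACA -scalerDr; congr (_ *: _ + _).
(* Homogeneity enters here: the sign prescribed by [e] is the one of each generator. *)
have <- : chain_deg w = e by apply: (u_deg (c, w)); rewrite inE eqxx.
(* The presentation of a homogeneous chain may contain the empty word, whose [chain] is 0 by
   convention. *)
case: w {u_deg} => [|a0 s].
  by rewrite -[chain _]/0 pairing0l !raddf0 !pairing0l scaler0 addr0.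
(* All terms are linear in [x], so [x] is expanded into the generators of a representative. *)
rewrite -(cls_repr x) cls_sum; elim: (repr x) => [|[d [D Ds]] v IHv].
  by rewrite big_nil pairing0r !raddf0 delta_ext0 addr0 !pairing0r scaler0 addr0.
rewrite big_cons pairing_linear_r !b_linear delta_ext_linear addrACA -scalerDr.
rewrite !pairing_linear_r IHv /= b_pairing_chain.
by rewrite scale_lin addrACA -scalerDr.
Qed.
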